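(* Let $\eta=(\eta_1,\dots,\eta_t)$ be a sequence of positive integers with sum $n$, let $R=(R_1,\dots,R_t)$ with $R_i=(\mu_i^{\eta_i})$ the rectangle with $\eta_i$ rows and $\mu_i$ columns, and let $\lambda=(\lambda_1\ge\dots\ge\lambda_n\ge0)$ be a partition with $|\lambda|=\sum_i|R_i|$. Let $k$ be a positive integer with $k\ge\lambda_1$ and $k\ge\mu_i$ for all $i$, and put $\widetilde\lambda=(k-\lambda_n,\dots,k-\lambda_1)$ and $\widetilde R=(\widetilde R_1,\dots,\widetilde R_t)$ with $\widetilde R_i=((k-\mu_i)^{\eta_i})$. Then the duality map $T\mapsto\widetilde T$ on column strict tableaux (with respect to the $n\times k$ rectangle) restricts to a bijection $$LRT(\lambda;R)\to LRT(\widetilde\lambda;\widetilde R).$$ Furthermore, for every $T\in LRT(\lambda;R)$, $$\mathrm{charge}_R(T)=\mathrm{charge}_{\widetilde R}(\widetilde T),$$ where $\mathrm{charge}_R(T)=\frac1{t!}\sum_{u\in\Sigma_{[t]}}d_{uR}(uT)$.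
   Context: Tableaux. Tableaux are in English notation; column strict means weakly increasing along rows and strictly increasing down columns. The row-reading word $\mathrm{word}(T)$ of a (skew) tableau reads the rows from bottom to top, each row left to right. $P(w)$ is the Schensted (insertion) tableau of a word $w$, and $P(T)=P(\mathrm{word}(T))$ for a skew tableau $T$. $T|_A$ is the (skew) subtableau of entries in the interval $A$. Dual tableau. For a column strict tableau $T$ of shape $\lambda$ with entries in $[n]=\{1,\dots,n\}$ and at most $k$ columns, $\widetilde T$ is the column strict tableau of shape $\widetilde\lambda$ whose $j$-th column is the set complement in $[n]$ of the $(k+1-j)$-th column of $T$, for $1\le j\le k$ (missing columns are regarded as empty). LR tableaux. For a sequence of rectangles $R=((\mu_1^{\eta_1}),\dots,(\mu_t^{\eta_t}))$, with $\mu_i\ge 0$, let $A_1,A_2,\dots,A_t$ be the successive subintervals of $[n]$ of sizes $\eta_1,\dots,\eta_t$. A word in the alphabet $A_i$ is lattice (with respect to $A_i$) if in every final subword the numbers of occurrences of the letters of $A_i$, taken in increasing order of letters, form a partition; a (skew) tableau is lattice if its row-reading word is. $LRT(\lambda;R)$ is the set of column strict tableaux $T$ of shape $\lambda$ in which each letter of $A_i$ occurs exactly $\mu_i$ times for all $i$, and such that $T|_{A_i}$ is lattice with respect to $A_i$ for all $i$. The same definition is used for a pair of rectangles with a consecutive interval of $\mathbb Z$ in place of $[n]$. It is known that for two rectangles $R_1,R_2$ and any partition $\rho$, $|LRT(\rho;(R_1,R_2))|=|LRT(\rho;(R_2,R_1))|\in\{0,1\}$. Symmetry bijections. $\Sigma_{[t]}$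 acts on rearrangements of $R$ in the obvious way; $s_pR$ exchanges the $p$-th and $(p+1)$-st rectangles. For an adjacent transposition $s_p$ the bijection $s_p:LRT(\lambda;R)\to LRT(\lambda;s_pR)$ is defined as follows. Let $B=A_p\cup A_{p+1}$ and $T\in LRT(\lambda;R)$. Let $(P,Q)$ be the tableau pair obtained by column insertion of $\mathrm{word}(T|_B)$ (letters column-inserted from the last to the first; $P$ is the insertion tableau, equal to $P(T|_B)$, and $Q$ the standard recording tableau). Then $P\in LRT(\rho;(R_p,R_{p+1}))$ in the alphabet $B$, where $\rho$ is the shape of $P$. Let $P'$ be the unique element of $LRT(\rho;(R_{p+1},R_p))$ in the alphabet $B$. There is a (unique) column strict tableau $U$ of the same skew shape as $T|_B$ whose row-reading word corresponds to $(P',Q)$ under column insertion. Then $s_pT$ agrees with $U$ on the alphabet $B$ and with $T$ on the complement of $B$. For $u\in\Sigma_{[t]}$ fix a reduced word $u=s_{a_1}s_{a_2}\cdots s_{a_r}$ (the same fixed choice for every sequence of rectangles), and define $uT=s_{a_1}(s_{a_2}(\cdots(s_{a_r}T)))\in LRT(\lambda;uR)$. Statistic. For $T\in LRT(\lambda;R)$ and $1\le p\le t-1$, $d_{p,R}(T)$ is the number of cells of $P(T|_{A_p\cup A_{p+1}})$ lying strictly to the right of the $c$-th column, where $c=\max(\mu_p,\mu_{p+1})$; and $d_R(T)=\sum_{p=1}^{t-1}(t-p)\,d_{p,R}(T)$. In $d_{uR}(uT)$ the alphabets and column numbers are those of the sequence $uR$. *)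

(* Defs.v *)
From mathcomp Require Import all_boot all_fingroup all_algebra.
From mathcomp Require Import boolp classical_sets functions.

Set Implicit Arguments.
Unset Strict Implicit.
Unset Printing Implicit Defensive.

(** A tableau is the list of its rows, top row first (English notation).
    Rows may be empty, so that a partition with trailing zero parts is a
    legitimate shape. *)
Definition tableau := seq (seq nat).

(** A skew tableau is a list of rows [(o, r)]: the entries [r] occupy the
    columns [o], ..., [o + size r - 1] (columns are numbered from 0). *)
Definition skewtab := seq (nat * seq nat).

Definition straight (T : tableau) : skewtab := [seq (0, r) | r <- T].

Definition skew_shape (S : skewtab) : seq (nat * nat) :=
  [seq (r.1, size r.2) | r <- S].

Definition in_row (r : nat * seq nat) (c : nat) : bool :=
  r.1 <= c < r.1 + size r.2.

Definition entry (r : nat * seq nat) (c : nat) : nat := nth 0 r.2 (c - r.1).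

Definition row_above (r r' : nat * seq nat) : bool :=
  all (fun c => in_row r c && in_row r' c ==> (entry r c < entry r' c))
      (iota 0 (r.1 + size r.2)).

Definition colstrict (S : skewtab) : bool :=
  all (fun r => sorted leq r.2) S && pairwise row_above S.

Definition word (S : skewtab) : seq nat := flatten (rev [seq r.2 | r <- S]).

(** The skew subtableau of the entries of [T] in the interval
    [{a, ..., a + m - 1}]; the smaller entries of [T] form the inner shape. *)
Definition restr (a m : nat) (T : tableau) : skewtab :=
  [seq (count (fun x => x < a) r, [seq x <- r | a <= x < a + m]) | r <- T].

(** The list of the first [m] columns of [T], each read from top to bottom;
    columns that are missing in [T] are empty.  Applied to a list of columns
    it returns the list of rows. *)
Definition transp (m : nat) (T : tableau) : tableau :=
  [seq [seq nth 0 r j | r <- T & j < size r] | j <- iota 0 m].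

(** [x] replaces the first entry [y] of the line such that [e x y], which is
    bumped out; if there is none, [x] is appended to the line. *)
Fixpoint bump (e : rel nat) (x : nat) (l : seq nat) : option nat * seq nat :=
  if l is y :: l' then
    if e x y then (Some y, x :: l')
    else let: (b, l'') := bump e x l' in (b, y :: l'')
  else (None, [:: x]).

(** The second component is the index of the line that has grown.  With
    [e := ltn] and a list of rows this is Schensted row insertion; with
    [e := leq] and a list of columns this is column insertion. *)
Fixpoint insert (e : rel nat) (x : nat) (T : tableau) : tableau * nat :=
  if T is l :: T' then
    let: (b, l') := bump e x l in
    if b is Some y then
      let: (T'', j) := insert e y T' in (l' :: T'', j.+1)
    else (l' :: T', 0)
  else ([:: [:: x]], 0).

Definition schensted (w : seq nat) : tableau :=
  foldl (fun T x => (insert ltn x T).1) [::] w.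

(** Insertion and recording tableaux, both as lists of columns, for the column
    insertion of the letters of [w] from the last one to the first one. *)
Definition column_insertion_cols (w : seq nat) : tableau * tableau :=
  foldr (fun x PQ =>
           let: (P, Q) := PQ in
           let: (P', j) := insert leq x P in
           (P', set_nth [::] Q j (rcons (nth [::] Q j) (size (flatten Q)).+1)))
        ([::], [::]) w.

Definition column_insertion (w : seq nat) : tableau * tableau :=
  let: (P, Q) := column_insertion_cols w in
  (transp (size (head [::] P)) P, transp (size (head [::] Q)) Q).

(** The dual tableau with respect to the [n] x [k] rectangle. *)
Definition dual (n k : nat) (T : tableau) : tableau :=
  transp n [seq [seq x <- iota 1 n | x \notin C] | C <- rev (transp k T)].

(** The pair [(mu, eta)] is the rectangle with [mu] columns and [eta] rows. *)
Definition rect := (nat * nat)%type.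
Definition ncols (r : rect) : nat := r.1.
Definition nrows (r : rect) : nat := r.2.

(** The alphabet is split into consecutive intervals whose sizes are the
    heights of the rectangles; [a] is its first letter.  Rectangles are indexed
    from 0. *)
Definition block_start (a : nat) (R : seq rect) (i : nat) : nat :=
  a + sumn (take i [seq nrows r | r <- R]).
Definition rect_at (R : seq rect) (i : nat) : rect := nth (0, 0) R i.
Definition block_size (R : seq rect) (i : nat) : nat := nrows (rect_at R i).

Definition lattice (a m : nat) (w : seq nat) : bool :=
  all (fun j => sorted geq [seq count_mem x (drop j w) | x <- iota a m])
      (iota 0 (size w)).

Definition LRT (a : nat) (lam : seq nat) (R : seq rect) (T : tableau) : bool :=
  [&& shape T == lam,
      colstrict (straight T),
      all (fun x => a <= x < block_start a R (size R)) (flatten T) &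
      all (fun i =>
             let b := block_start a R i in
             let m := block_size R i in
             all (fun x => count_mem x (flatten T) == ncols (rect_at R i))
                 (iota b m)
             && lattice b m (word (restr b m T)))
          (iota 0 (size R))].

Definition adj (p i : nat) : nat :=
  if i == p then p.+1 else if i == p.+1 then p else i.

Definition adj_rects (p : nat) (R : seq rect) : seq rect :=
  mkseq (fun i => rect_at R (adj p i)) (size R).

Definition pair_start (R : seq rect) (p : nat) : nat := block_start 1 R p.
Definition pair_size (R : seq rect) (p : nat) : nat :=
  block_size R p + block_size R p.+1.

Definition restr_pair (R : seq rect) (p : nat) (T : tableau) : skewtab :=
  restr (pair_start R p) (pair_size R p) T.

(** [T] with its entries in [{a, ..., a + m - 1}] replaced by those of [U], a
    skew tableau with the same shape as [restr a m T]. *)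
Definition paste (a m : nat) (T : tableau) (U : skewtab) : tableau :=
  [seq [seq x <- ru.1 | x < a] ++ ru.2.2 ++ [seq x <- ru.1 | a + m <= x]
  | ru <- zip T U].

(** The bijection [s_p].  [xget d A] is an element of [A], or [d] when [A] is
    empty; for [T] in [LRT 1 lam R] and [p.+1 < size R] both sets below are
    singletons. *)
Definition adj_tab (p : nat) (R : seq rect) (T : tableau) : tableau :=
  let S := restr_pair R p T in
  let: (P, Q) := column_insertion (word S) in
  let P' := xget P [set X | LRT (pair_start R p) (shape P)
                              [:: rect_at R p.+1; rect_at R p] X] in
  let U := xget S [set X | [&& skew_shape X == skew_shape S, colstrict X &
                               column_insertion (word X) == (P', Q)]] in
  paste (pair_start R p) (pair_size R p) T U.

(** The pair [(uR, uT)] for [u = s_{a_1} ... s_{a_r}], the rightmost factor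
    acting first. *)
Definition act_word (a : seq nat) (R : seq rect) (T : tableau) :
    seq rect * tableau :=
  foldr (fun p RT => (adj_rects p RT.1, adj_tab p RT.1 RT.2)) (R, T) a.

(** [u = s_{a_1} \o ... \o s_{a_r}] as functions on the indices. *)
Definition is_word_of (t : nat) (u : 'S_t) (a : seq nat) : Prop :=
  all (fun p => p.+1 < t) a /\ forall i : 'I_t, foldr adj i a = u i :> nat.

Definition reduced_word (t : nat) (u : 'S_t) (a : seq nat) : Prop :=
  is_word_of u a /\ forall b, is_word_of u b -> size a <= size b.

Definition d_at (p : nat) (R : seq rect) (T : tableau) : nat :=
  let c := maxn (ncols (rect_at R p)) (ncols (rect_at R p.+1)) in
  \sum_(r <- schensted (word (restr_pair R p T))) (size r - c).

(** As indices start from 0, the weight [t - p] becomes [t - p.+1]. *)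
Definition d_stat (R : seq rect) (T : tableau) : nat :=
  \sum_(0 <= p < (size R).-1) (size R - p.+1) * d_at p R T.

(** [rw] chooses a reduced word for each permutation, independently of [R]. *)
Definition charge (t : nat) (rw : 'S_t -> seq nat) (R : t.-tuple rect)
    (T : tableau) : rat :=
  ((t`!%:R)^-1 *
   \sum_(u : 'S_t)
     (d_stat (act_word (rw u) R T).1 (act_word (rw u) R T).2)%:R)%R.

Definition rects (t : nat) (mu eta : t.-tuple nat) : t.-tuple rect :=
  [tuple (tnth mu i, tnth eta i) | i < t].

(* Main.v *)
Require Import Defs.
From mathcomp Require Import all_boot all_fingroup all_algebra.
From mathcomp Require Import boolp classical_sets functions.
From mathcomp Require Import zify.

(** The proof uses the crystal operators e_i, f_i of type A on words.  A word is lattice on an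
    interval of letters when the e_i of that interval vanish on it; for the constant content
    of a rectangle the f_i then vanish too.  Complementing the columns of a tableau and
    reversing their order exchanges e_i and f_i, whence the bijection.

    Schensted insertion commutes with the operators, which do not change recording tableaux,
    and highest weight tableaux are determined by their shape.  Hence s_p T is the only tableau
    with the lattice conditions for s_p R in the component of T for the letters of
    A_p and A_(p+1), and s_p commutes with duality.  Such a tableau exists because reversing a
    word together with its alphabet preserves the shape of its insertion tableau.

    Finally the shape rho of P(T|B) is complemented by duality, and for two rectangles with
    columns mu_1 and mu_2 the parts of rho exceed max(mu_1, mu_2) by as much in total as they
    fall short of min(mu_1, mu_2). *)

Set Implicit Arguments.
Unset Strict Implicit.
Unset Printing Implicit Defensive.

(** Complementation acts on columns, while the lattice conditions, the restriction to an interval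
    and the words inserted by [s_p] concern rows. Crystal operators make sense for both readings of
    a tableau and crystal equivalence identifies the two, so each fact is proved in the reading
    where it is local and then transported. The equivalence is defined by observation (contents and
    [eps] along every sequence of operators) instead of by Knuth moves, which makes it stable under
    operators by construction.

    The map [s_p] is given by two choices of unique elements, so its value has to be recognised
    rather than computed. The criterion is a path of operators with indices inside the alphabet of
    the pair, which leaves all other letters in place. Duality turns it into the path of the
    opposite operators, so the dual tableau meets the same criterion. The charges then agree summand
    by summand, for each permutation and each p.

    Tableaux in a box have exactly n rows, empty ones included: words do not see empty rows, but
    duality turns them into full ones. *)

(** * Crystal operators on words *)

(* Bracket each letter i+1 with a letter i to its right: [phi] and [eps] count the
   unmatched letters i and i+1, [eop] lowers the leftmost unmatched i+1 and [fop] raises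
   the rightmost unmatched i.  Both are the identity when there is no such letter. *)
Fixpoint phi (i : nat) (w : seq nat) : nat :=
  if w is x :: w' then (x == i) + (phi i w' - (x == i.+1)) else 0.

Fixpoint eps (i : nat) (w : seq nat) : nat :=
  if w is x :: w' then eps i w' + ((x == i.+1) - phi i w') else 0.

Fixpoint eop (i : nat) (w : seq nat) : seq nat :=
  if w is x :: w' then
    if phi i w' < (x == i.+1) then i :: w' else x :: eop i w'
  else [::].

Fixpoint fop (i : nat) (w : seq nat) : seq nat :=
  if w is x :: w' then
    if (x == i.+1) < phi i w' then x :: fop i w'
    else (if x == i then i.+1 else x) :: w'
  else [::].

(** Tensor product rule: when [u] is put to the left of [v], only the unmatched [i.+1] of [u] and
    the unmatched [i] of [v] can form new pairs. The recursions for [eps] and [phi] are entangled,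
    hence the joint proof. *)
Lemma eps_phi_cat i u v :
  eps i (u ++ v) = eps i v + (eps i u - phi i v) /\
  phi i (u ++ v) = phi i u + (phi i v - eps i u).
Proof.
elim: u => [|x u [IHe IHp]] /=; first by split; lia.
rewrite IHe IHp; split; lia.
Qed.

Lemma eps_cat i u v : eps i (u ++ v) = eps i v + (eps i u - phi i v).
Proof. by case: (eps_phi_cat i u v). Qed.

Lemma phi_cat i u v : phi i (u ++ v) = phi i u + (phi i v - eps i u).
Proof. by case: (eps_phi_cat i u v). Qed.

Lemma eop_cat i u v :
  eop i (u ++ v) = if phi i v < eps i u then eop i u ++ v else u ++ eop i v.
Proof.
elim: u => [|x u IH] //=; rewrite phi_cat IH.
do ?case: ifP => //=; lia.
Qed.

Lemma eop_id i w : eps i w = 0 -> eop i w = w.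
Proof.
by elim: w => //= x w IH h; rewrite IH ?if_same; [case: ifP => //|]; lia.
Qed.

Lemma fop_id i w : phi i w = 0 -> fop i w = w.
Proof.
by case: w => //= x w h; do ?case: ifP => //; lia.
Qed.

Lemma fop_cat i u v :
  fop i (u ++ v) = if eps i u < phi i v then u ++ fop i v else fop i u ++ v.
Proof.
elim: u => [|x u IH] /=; first by case: posnP => [/fop_id|].
rewrite phi_cat IH.
do ?case: ifP => //=; lia.
Qed.

Lemma eps_phi_eop i w : 0 < eps i w ->
  eps i (eop i w) = (eps i w).-1 /\ phi i (eop i w) = (phi i w).+1.
Proof.
elim: w => //= x w IH h; case: ifP => h1 /=; first by split; lia.
by case: IH => [|-> ->]; first lia; split; lia.
Qed.

Lemma eps_phi_fop i w : 0 < phi i w ->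
  eps i (fop i w) = (eps i w).+1 /\ phi i (fop i w) = (phi i w).-1.
Proof.
elim: w => //= x w IH h; case: ifP => h1 /=; last first.
  by case: ifP => h2; split; lia.
by case: IH => [|-> ->]; first lia; split; lia.
Qed.

Lemma eopK i w : 0 < eps i w -> fop i (eop i w) = w.
Proof.
elim: w => //= x w IH h; case: ifP => h1 /=.
  by case: ifP => h2; [lia|rewrite eqxx; congr cons; lia].
have [|he hp] := @eps_phi_eop i w; first lia.
by rewrite hp IH; [case: ifP => //; lia|lia].
Qed.

Lemma fopK i w : 0 < phi i w -> eop i (fop i w) = w.
Proof.
elim: w => //= x w IH h; case: ifP => h1 /=; last first.
  have -> : x = i by lia.
  by rewrite eqxx eqxx; case: ifP => //; lia.
have [|he hp] := @eps_phi_fop i w; first lia.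
by rewrite hp IH; [case: ifP => //; lia|lia].
Qed.

Lemma phi_eps_count i w :
  phi i w + count_mem i.+1 w = eps i w + count_mem i w.
Proof. by elim: w => //= x w IH; lia. Qed.

Lemma perm_eop i w : 0 < eps i w -> perm_eq (i.+1 :: eop i w) (i :: w).
Proof.
elim: w => //= x w IH h; case: ifP => h1; first (have -> : x = i.+1 by lia);
  first by apply/seq.permP => p /=; rewrite addnCA.
have /seq.permP IH' : perm_eq (i.+1 :: eop i w) (i :: w) by apply: IH; lia.
by apply/seq.permP => p; move: (IH' p) => /=; lia.
Qed.

Lemma perm_fop i w : 0 < phi i w -> perm_eq (i :: fop i w) (i.+1 :: w).
Proof.
move=> h; have [he hp] := eps_phi_fop h.
by rewrite -{2}(fopK h) perm_sym perm_eop // he.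
Qed.

Lemma size_eop i w : size (eop i w) = size w.
Proof. by elim: w => //= x w IH; case: ifP => //= _; rewrite IH. Qed.

Lemma size_fop i w : size (fop i w) = size w.
Proof. by elim: w => //= x w IH; case: ifP => //= _; rewrite IH. Qed.

Definition crystal_op (o : bool * nat) (w : seq nat) : seq nat :=
  if o.1 then eop o.2 w else fop o.2 w.

Definition run (g : seq (bool * nat)) (w : seq nat) : seq nat := foldr crystal_op w g.

Lemma run_cat g h w : run (g ++ h) w = run g (run h w).
Proof. exact: foldr_cat. Qed.

Lemma size_crystal_op o w : size (crystal_op o w) = size w.
Proof. by rewrite /crystal_op; case: ifP; rewrite ?size_eop ?size_fop. Qed.

Definition flip_op (o : bool * nat) := (~~ o.1, o.2).

Lemma flip_opK o w : crystal_op o w = w \/ crystal_op (flip_op o) (crystal_op o w) = w.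
Proof.
case: o => -[] i; rewrite /crystal_op /=.
  by case: (posnP (eps i w)) => [/eop_id|/eopK]; [left|right].
by case: (posnP (phi i w)) => [/fop_id|/fopK]; [left|right].
Qed.

(* The two words occupy the same position in isomorphic components of the crystal. *)
Definition crystal_eq (w w' : seq nat) : Prop :=
  forall g, perm_eq (run g w) (run g w') /\
            forall i, eps i (run g w) = eps i (run g w').

Lemma crystal_eq_perm w w' : crystal_eq w w' -> perm_eq w w'.
Proof. by move=> /(_ [::])[]. Qed.

Lemma crystal_eq_eps w w' i : crystal_eq w w' -> eps i w = eps i w'.
Proof. by move=> /(_ [::])[]. Qed.

(** [phi - eps] is a difference of contents, so observing [eps] and the content is enough. *)
Lemma crystal_eq_phi w w' i : crystal_eq w w' -> phi i w = phi i w'.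
Proof.
move=> h; have := phi_eps_count i w; have := phi_eps_count i w'.
have /seq.permP p := crystal_eq_perm h.
by rewrite (crystal_eq_eps i h) !p; lia.
Qed.

Lemma crystal_eq_run g w w' : crystal_eq w w' -> crystal_eq (run g w) (run g w').
Proof. by move=> h g'; rewrite -!run_cat. Qed.

Lemma crystal_eq_crystal_op o w w' : crystal_eq w w' ->
  crystal_eq (crystal_op o w) (crystal_op o w').
Proof. exact: (@crystal_eq_run [:: o]). Qed.

Lemma crystal_eq_refl w : crystal_eq w w.
Proof. by move=> g. Qed.

Lemma crystal_eq_sym w w' : crystal_eq w w' -> crystal_eq w' w.
Proof. by move=> h g; have [p e] := h g; rewrite perm_sym; split=> // i; rewrite e. Qed.

Lemma crystal_eq_trans w2 w1 w3 : crystal_eq w1 w2 -> crystal_eq w2 w3 -> crystal_eq w1 w3.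
Proof.
move=> h h' g; have [p e] := h g; have [p' e'] := h' g.
by split; [exact: perm_trans p'|move=> i; rewrite e].
Qed.

Lemma crystal_eq_bisim (K : seq nat -> seq nat -> Prop) :
  (forall w w', K w w' -> perm_eq w w' /\ forall i, eps i w = eps i w') ->
  (forall w w' o, K w w' -> K (crystal_op o w) (crystal_op o w')) ->
  forall w w', K w w' -> crystal_eq w w'.
Proof.
move=> h1 h2 w w' k g; apply: h1.
by elim: g => //= o g; exact: h2.
Qed.

(** By the tensor product rule, [eps] and [phi] alone decide which factor an operator changes, so
    concatenations of equivalent factors form a bisimulation. *)
Lemma crystal_eq_cat u u' v v' : crystal_eq u u' -> crystal_eq v v' ->
  crystal_eq (u ++ v) (u' ++ v').
Proof.
move=> hu hv.
apply: (@crystal_eq_bisim (fun w w' => exists u u' v v', [/\ w = u ++ v,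
   w' = u' ++ v', crystal_eq u u' & crystal_eq v v'])); last by exists u, u', v, v'.
  move=> _ _ [{}u [{}u' [{}v [{}v' [-> -> {}hu {}hv]]]]]; split.
    by apply: perm_cat; exact: crystal_eq_perm.
  by move=> i;
    rewrite !eps_cat !(crystal_eq_eps _ hu) !(crystal_eq_eps _ hv) (crystal_eq_phi _ hv).
move=> _ _ [b i] [{}u [{}u' [{}v [{}v' [-> -> {}hu {}hv]]]]].
rewrite /crystal_op /=; case: b.
  rewrite !eop_cat (crystal_eq_eps _ hu) (crystal_eq_phi _ hv).
  case: ifP => _; [exists (eop i u), (eop i u'), v, v'|exists u, u', (eop i v), (eop i v')];
    split=> //.
    exact: (@crystal_eq_crystal_op (true, i)).
  exact: (@crystal_eq_crystal_op (true, i)).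
rewrite !fop_cat (crystal_eq_eps _ hu) (crystal_eq_phi _ hv).
case: ifP => _; [exists u, u', (fop i v), (fop i v')|exists (fop i u), (fop i u'), v, v'];
  split=> //.
  exact: (@crystal_eq_crystal_op (false, i)).
exact: (@crystal_eq_crystal_op (false, i)).
Qed.

(** The opposite operator recovers the word unless the operator acted as the identity; equivalence
    puts both words in the same case. *)
Lemma crystal_op_inj_crystal_eq o w w' : crystal_eq w w' ->
  crystal_op o w = crystal_op o w' -> w = w'.
Proof.
case: o => b i h; rewrite /crystal_op /=; case: b.
  have he := crystal_eq_eps i h; case: (posnP (eps i w)) => e0.
    by rewrite !eop_id // -he.
  by move=> /(congr1 (fop i)); rewrite !eopK // -he.
have he := crystal_eq_phi i h; case: (posnP (phi i w)) => e0.
  by rewrite !fop_id // -he.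
by move=> /(congr1 (eop i)); rewrite !fopK // -he.
Qed.

Lemma run_inj_crystal_eq g w w' : crystal_eq w w' -> run g w = run g w' -> w = w'.
Proof.
move=> h; elim: g => //= o g IH e; apply: IH.
by apply: crystal_op_inj_crystal_eq e; exact: crystal_eq_run.
Qed.

(** The moves are stated without context; [crystal_eq_cat] supplies it. *)
Inductive knuth : seq nat -> seq nat -> Prop :=
| KnuthRefl w : knuth w w
| Knuth1 x y z : x < y <= z -> knuth [:: y; z; x] [:: y; x; z]
| Knuth2 x y z : x <= y < z -> knuth [:: x; z; y] [:: z; x; y].

(** Operators of index [i] distinguish only these three kinds of letters, which leaves finitely many
    cases for a Knuth move. *)
Lemma letter_cases i x :
  [\/ x = i, x = i.+1 | (x == i) = false /\ (x == i.+1) = false].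
Proof.
case: (eqVneq x i) => [|_]; first by constructor 1.
by case: (eqVneq x i.+1); [constructor 2|constructor 3].
Qed.

Lemma knuth_perm_eps w w' :
  knuth w w' -> perm_eq w w' /\ forall i, eps i w = eps i w'.
Proof.
have F1 i : (i == i.+1) = false by lia.
have F2 i : (i.+1 == i) = false by lia.
case=> [{}w|x y z h|x y z h]; first by [].
  split; first by rewrite perm_cons; apply/seq.permP => p /=; rewrite addnCA.
  move=> i.
  case: (letter_cases i x) => [ex|ex|[ex ex']]; case: (letter_cases i y) => [ey|ey|[ey ey']];
  case: (letter_cases i z) => [ez|ez|[ez ez']];
  by rewrite ?ex ?ey ?ez in h *; rewrite /= ?eqxx ?F1 ?F2 ?ex ?ex' ?ey ?ey' ?ez ?ez' //; lia.
split; first by apply/seq.permP => p /=; rewrite addnCA.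
  move=> i.
  case: (letter_cases i x) => [ex|ex|[ex ex']]; case: (letter_cases i y) => [ey|ey|[ey ey']];
  case: (letter_cases i z) => [ez|ez|[ez ez']];
  by rewrite ?ex ?ey ?ez in h *; rewrite /= ?eqxx ?F1 ?F2 ?ex ?ex' ?ey ?ey' ?ez ?ez' //; lia.
Qed.

(** An operator may turn a move of the first kind into one of the second: [eop 1] sends 221 and 212
    to 121 and 211. *)
Lemma knuth_crystal_op o w w' : knuth w w' -> knuth (crystal_op o w) (crystal_op o w').
Proof.
have F1 i : (i == i.+1) = false by lia.
have F2 i : (i.+1 == i) = false by lia.
case: o => b i [{}w|x y z h|x y z h]; first exact: KnuthRefl.
all: case: (letter_cases i x) => [ex|ex|[ex ex']]; case: (letter_cases i y) => [ey|ey|[ey ey']];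
  case: (letter_cases i z) => [ez|ez|[ez ez']];
  rewrite ?ex ?ey ?ez in h *; try (exfalso; lia);
  case: b; rewrite /crystal_op /= ?eqxx ?F1 ?F2 ?ex ?ex' ?ey ?ey' ?ez ?ez' /= ?eqxx ?F1 ?F2 ?ex ?ex' ?ey ?ey' ?ez ?ez' /=;
  first [exact: KnuthRefl | apply: Knuth1; lia | apply: Knuth2; lia].
Qed.

Lemma knuth_crystal_eq w w' : knuth w w' -> crystal_eq w w'.
Proof.
apply: crystal_eq_bisim => [|? ? ?]; [exact: knuth_perm_eps|exact: knuth_crystal_op].
Qed.

(** * Insertion *)

(* Rows and columns are treated together: the flag is [true] for lists of rows and
   [false] for lists of columns. *)
Definition lerel (d : bool) : rel nat :=
  if d then (ltn : rel nat) else leq.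

Lemma lerelE d x y : lerel d x y = (x + d <= y).
Proof. by case: d; rewrite /lerel /= ?addn1 ?addn0. Qed.

(** Weak increase for rows, strict increase for columns; [d] is used as a number so that one
    arithmetic argument covers both. *)
Definition line_sorted (d : bool) : pred (seq nat) := pairwise (fun x y => x < y + d).

(* For sorted lines: the row [s] fits below the row [r] if [d], the column [s] fits to the
   right of the column [r] otherwise.  In this counting form the condition is easy to track
   when a letter changes, and it is reversed by complementation. *)
Definition line_le (d : bool) (r s : seq nat) : Prop :=
  forall c, count (fun x => x < c + d) s <= count (fun x => x < c) r.

Definition tab (d : bool) (T : tableau) : Prop :=
  all (line_sorted d) T /\ forall j, line_le d (nth [::] T j) (nth [::] T j.+1).

Definition nonnil (T : tableau) : bool := all (fun l => 0 < size l) T.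

Lemma line_le_nil d r : line_le d r [::].
Proof. by []. Qed.

Lemma tab_nil d : tab d [::].
Proof. by split=> // j; rewrite !nth_nil. Qed.

Lemma tab_cons d l T :
  tab d (l :: T) <-> [/\ line_sorted d l, line_le d l (head [::] T) & tab d T].
Proof.
split=> [[/= /andP[sl sT] h]|[sl hl [sT h]]].
  by split=> //; [move: (h 0); rewrite /= nth0|split=> // j; exact: (h j.+1)].
by split=> /=; [rewrite sl|case=> [|j] /=; [rewrite nth0|exact: h]].
Qed.

Lemma ltd_trans d : transitive (fun x y => x < y + nat_of_bool d).
Proof. by move=> y x z; case: d; lia. Qed.

Lemma line_sorted_sorted d l : line_sorted d l = sorted (fun x y => x < y + d) l.
Proof. by rewrite sorted_pairwise //; exact: ltd_trans. Qed.

Lemma row_sortedE l : line_sorted true l = sorted leq l.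
Proof.
by rewrite line_sorted_sorted; apply: eq_sorted => x y /=; rewrite addn1 ltnS.
Qed.

Lemma col_sortedE l : line_sorted false l = sorted ltn l.
Proof. by rewrite line_sorted_sorted; apply: eq_sorted => x y /=; rewrite addn0. Qed.

Lemma line_sorted_cat d u v : line_sorted d (u ++ v) =
  [&& all (fun x => all (fun y => x < y + d) v) u, line_sorted d u & line_sorted d v].
Proof. exact: pairwise_cat. Qed.

Lemma line_sorted_cons d x l : line_sorted d (x :: l) = all (fun y => x < y + d) l && line_sorted d l.
Proof. by []. Qed.

Lemma line_sorted_filter d p l : line_sorted d l -> line_sorted d (filter p l).
Proof. by move=> h; apply: pairwise_filter. Qed.

Variant bump_spec (d : bool) x l : option nat * seq nat -> Prop :=
| BumpNone of all (fun z => z < x + d) l : bump_spec d x l (None, rcons l x)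
| BumpSome u y v of l = u ++ y :: v & all (fun z => z < x + d) u & x + d <= y :
    bump_spec d x l (Some y, u ++ x :: v).

Lemma bumpP d x l : bump_spec d x l (Defs.bump (lerel d) x l).
Proof.
elim: l => [|y l IH] /=; first exact: (@BumpNone d x [::]).
rewrite lerelE; case: leqP => h; first exact: (@BumpSome d x (y :: l) [::] y l).
case: IH => [hl|u z v -> hu hz].
  by rewrite -rcons_cons; apply: BumpNone => /=; rewrite h.
by apply: (@BumpSome d x _ (y :: u)) => //=; rewrite h.
Qed.

Lemma line_sorted_bump d x l : line_sorted d l -> line_sorted d (Defs.bump (lerel d) x l).2.
Proof.
case: bumpP => [hl|u y v -> hu hy] /=.
  rewrite -cats1 line_sorted_cat => sl; rewrite sl /= !andbT.
  by apply: sub_all hl => z hz; rewrite /= hz.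
rewrite !line_sorted_cat !line_sorted_cons => /and3P[h1 -> /andP[h2 ->]]; rewrite !andbT /=.
apply/andP; split; last by apply: sub_all h2 => z; lia.
apply/allP => z zu; rewrite /= (allP hu) //=.
by case/andP: (allP h1 _ zu).
Qed.

(** The critical thresholds are the [c] above [y] for which the letter [z] bumped from [s], if any,
    is not below [c + d]. There the new line has, below [c + d], the letters that [y] does not bump
    and [y] itself. The hypothesis at threshold [y] bounds the former by a count that omits the [y]
    of the first line, which leaves room for one more. *)
Lemma line_le_bump (d : bool) u y v x s : x + d <= y -> all (fun z => z < x + d) u ->
  line_sorted d s -> line_le d (u ++ y :: v) s ->
  line_le d (u ++ x :: v) (Defs.bump (lerel d) y s).2.
Proof.
move=> hxy hu ss h c; have := h c; have := h y; rewrite !count_cat /=.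
have lec (w : seq nat) : count (fun z => z < c + d) w <= size w by exact: count_size.
case: bumpP => [hs|us z vs es hs hz] /=.
  rewrite -cats1 !count_cat /=.
  move: hs; rewrite all_count => /eqP hs; move: (lec s).
  have [yc|cy] := ltnP y c; last by case: (d) hxy => /=; lia.
  have /leq_add : count (fun z => z < y) u <= count (fun z => z < c) u.
    by apply: sub_count => q /=; lia.
  have : count (fun z => z < y) v <= count (fun z => z < c) v.
    by apply: sub_count => q /=; lia.
  move=> h1 /(_ _ _ h1); lia.
rewrite !es !count_cat /=.
have [yc|cy] := ltnP y c; last by case: (d) hxy => /=; lia.
have [zc|cz] := ltnP z (c + d); first by lia.
have hvs : count (fun z => z < c + d) vs = 0.
  apply/eqP; rewrite -leqn0 leqNgt -has_count; apply/hasPn => q qv.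
  move: ss; rewrite es line_sorted_cat line_sorted_cons => /and3P[_ _ /andP[/allP /(_ _ qv)]].
  by case: (d) cz; lia.
move: hs; rewrite all_count => /eqP hs; move: (lec us).
have /leq_add : count (fun z => z < y) u <= count (fun z => z < c) u.
  by apply: sub_count => q /=; lia.
have : count (fun z => z < y) v <= count (fun z => z < c) v.
  by apply: sub_count => q /=; lia.
move=> h1 /(_ _ _ h1); lia.
Qed.

Lemma head_insert d x T :
  head [::] (insert (lerel d) x T).1 = (Defs.bump (lerel d) x (head [::] T)).2.
Proof.
case: T => [|l T] //=; case: (Defs.bump _ _ _) => -[y|] l' //=.
by case: (insert _ _ _).
Qed.

Lemma line_le_rcons d l x s : line_le d l s -> line_le d (rcons l x) s.
Proof.
by move=> h c; rewrite -cats1 count_cat (leq_trans (h c)) ?leq_addr.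
Qed.

Lemma tab_insert d x T : tab d T -> tab d (insert (lerel d) x T).1.
Proof.
elim: T x => [|l T IH] x.
  by move=> _; apply/tab_cons; split=> //; exact: tab_nil.
move=> /tab_cons[sl hl tT] /=; have := line_sorted_bump x sl.
case: bumpP => [hs|u y v el hs hy] /= sl'.
  by apply/tab_cons; split=> //; exact: line_le_rcons.
have := IH y tT; have := head_insert d y T.
case: (insert _ _ _) => T' j /= e tT'.
apply/tab_cons; split=> //; rewrite e; apply: line_le_bump => //; last by rewrite -el.
by case: T tT {IH hl e} => //= r T /tab_cons[].
Qed.

Lemma shape_insert d x T :
  shape (insert (lerel d) x T).1
    = incr_nth (shape T) (insert (lerel d) x T).2.
Proof.
elim: T x => [|l T IH] x //=.
case: bumpP => [hs|u y v el hs hy] /=; first by rewrite size_rcons.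
have := IH y; case: (insert _ _ _) => T' j /= ->.
by rewrite el !size_cat.
Qed.

Lemma nonnil_insert d x T :
  nonnil T -> nonnil (insert (lerel d) x T).1.
Proof.
elim: T x => [|l T IH] x //= /andP[hl hT].
case: bumpP => [hs|u y v el hs hy] /=; first by rewrite size_rcons hT.
have := IH y hT; case: (insert _ _ _) => T' j /= ->.
by rewrite size_cat /= addnS.
Qed.

Definition rword (T : tableau) : seq nat := flatten (rev T).

Definition cword (T : tableau) : seq nat := flatten [seq rev C | C <- T].

Lemma rword_cons r T : rword (r :: T) = rword T ++ r.
Proof. by rewrite /rword rev_cons flatten_rcons. Qed.

Lemma perm_rword T : perm_eq (rword T) (flatten T).
Proof.
elim: T => //= r T IH; rewrite rword_cons perm_catC perm_cat2l //.
Qed.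

Lemma perm_cword T : perm_eq (cword T) (flatten T).
Proof. by elim: T => //= r T IH; apply: perm_cat => //; rewrite perm_rev. Qed.

Lemma crystal_eq_catl u v v' : crystal_eq v v' -> crystal_eq (u ++ v) (u ++ v').
Proof. by move=> h; apply: crystal_eq_cat => //; exact: crystal_eq_refl. Qed.

Lemma crystal_eq_catr u u' v : crystal_eq u u' -> crystal_eq (u ++ v) (u' ++ v).
Proof. by move=> h; apply: crystal_eq_cat => //; exact: crystal_eq_refl. Qed.

Lemma crystal_eq_cons x v v' : crystal_eq v v' -> crystal_eq (x :: v) (x :: v').
Proof. exact: (@crystal_eq_catl [:: x]). Qed.

Lemma knuth_crystal_eq_cat w w' v : knuth w w' -> crystal_eq (w ++ v) (w' ++ v).
Proof. by move=> h; apply: crystal_eq_catr; exact: knuth_crystal_eq. Qed.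

(** [x] travels left through [v] by moves of the first kind, then [y] travels left through [u] by
    moves of the second kind. *)
Lemma crystal_eq_bump_row x u y v : x < y -> line_sorted true (u ++ y :: v) ->
  all (fun z => z <= x) u -> crystal_eq (u ++ y :: v ++ [:: x]) (y :: u ++ x :: v).
Proof.
move=> xy; rewrite line_sorted_cat => /and3P[_ su sv] ux.
apply: (@crystal_eq_trans (u ++ y :: x :: v)).
  apply: crystal_eq_catl; elim: v y xy sv => [|z v IH] y xy /=.
    by move=> _; exact: crystal_eq_refl.
  rewrite -/(line_sorted true) => /andP[/andP[yz _] svz].
  apply: (@crystal_eq_trans [:: y, z, x & v]).
    apply: crystal_eq_cons; apply: IH => //; move: yz; lia.
  apply: (@knuth_crystal_eq_cat [:: y; z; x] [:: y; x; z]).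
  by apply: Knuth1; rewrite xy /=; move: yz; lia.
elim/last_ind: u x xy v su ux {sv} => [|u q IH] x xy v; first by move=> *; exact: crystal_eq_refl.
rewrite -cats1 line_sorted_cat all_cat /= !andbT => /andP[uq su] /andP[ux qx].
rewrite -!catA /=.
apply: (@crystal_eq_trans (u ++ [:: y, q, x & v])).
  apply: crystal_eq_catl; apply: (@knuth_crystal_eq_cat [:: q; y; x] [:: y; q; x]).
  by apply: Knuth2; rewrite qx.
apply: IH => //; first by lia.
apply: sub_all uq => z /=; lia.
Qed.

(** Mirror image of the row case: [x] travels right through [rev v], then [y] travels right through
    [rev u]. *)
Lemma crystal_eq_bump_col x u y v : x <= y -> line_sorted false (u ++ y :: v) ->
  all (fun z => z < x) u ->
  crystal_eq (x :: rev (u ++ y :: v)) (rev (u ++ x :: v) ++ [:: y]).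
Proof.
move=> xy; rewrite line_sorted_cat line_sorted_cons => /and3P[_ su /andP[yv sv]] ux.
rewrite !rev_cat !rev_cons -!cats1 -!catA /=.
apply: (@crystal_eq_trans (rev v ++ [:: x, y & rev u])).
  move: (rev u) => s {su ux}.
  elim/last_ind: v yv sv => [|v z IH]; first by move=> *; exact: crystal_eq_refl.
  rewrite all_rcons -cats1 line_sorted_cat /= !andbT => /andP[yz yv] /andP[vz sv].
  rewrite rev_cat /=; apply: (@crystal_eq_trans (z :: x :: rev v ++ y :: s)).
    (* [h], the letter after [z], is the third letter that the Knuth move requires; it is [y] itself
       when [v] is exhausted. *)
    have [h [s' [-> hh]]] : exists h s', rev v ++ y :: s = h :: s' /\ y <= h < z.
      case/lastP: v yv vz {IH sv} => [|v q]; first by exists y, s; split=> //; move: yz; lia.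
      rewrite rev_rcons !all_rcons => /andP[yq _] /andP[qz _].
      by exists q, (rev v ++ y :: s); split=> //; move: yq qz; lia.
    by apply: (@knuth_crystal_eq_cat [:: x; z; h] [:: z; x; h]); apply: Knuth2; lia.
  by apply: crystal_eq_cons; exact: IH.
apply: crystal_eq_catl => {v yv sv}.
elim/last_ind: u x xy su ux => [|u q IH] x xy; first by move=> *; exact: crystal_eq_refl.
rewrite -cats1 line_sorted_cat all_cat /= !andbT => /andP[uq su] /andP[ux qx].
rewrite rev_cat /=; apply: (@crystal_eq_trans (x :: q :: y :: rev u)).
  by apply: (@knuth_crystal_eq_cat [:: x; y; q] [:: x; q; y]); apply: Knuth1; lia.
apply: crystal_eq_cons; apply: IH => //; first by lia.
by apply: sub_all uq => z /=; lia.
Qed.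

Lemma crystal_eq_insert_row x T : tab true T ->
  crystal_eq (rword T ++ [:: x]) (rword (insert ltn x T).1).
Proof.
elim: T x => [|r T IH] x; first by move=> _; exact: crystal_eq_refl.
move=> /tab_cons[sr _ tT]; rewrite rword_cons /=.
case: (@bumpP true) => [hs|u y v el hs hy] /=.
  by rewrite rword_cons -cats1 catA; exact: crystal_eq_refl.
have := IH y tT; case: (insert _ _ _) => T' j /= h.
rewrite rword_cons -catA el -catA; apply: (@crystal_eq_trans (rword T ++ y :: u ++ x :: v)).
  apply: crystal_eq_catl; apply: crystal_eq_bump_row; [lia|by rewrite -el|].
  by apply: sub_all hs => z /=; lia.
by rewrite -cat1s catA; exact: crystal_eq_catr.
Qed.

Lemma crystal_eq_insert_col x T : tab false T ->
  crystal_eq (x :: cword T) (cword (insert leq x T).1).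
Proof.
elim: T x => [|r T IH] x; first by move=> _; exact: crystal_eq_refl.
move=> /tab_cons[sr _ tT]; rewrite /=.
case: (@bumpP false) => [hs|u y v el hs hy] /=.
  by rewrite /cword /= rev_rcons; exact: crystal_eq_refl.
have := IH y tT; case: (insert _ _ _) => T' j /= h.
rewrite /cword /= -!/(cword _) el.
apply: (@crystal_eq_trans (rev (u ++ x :: v) ++ y :: cword T)); last exact: crystal_eq_catl.
rewrite -cat1s catA -[X in crystal_eq _ (_ ++ X)]cat1s [X in crystal_eq _ X]catA.
apply: crystal_eq_catr; apply: crystal_eq_bump_col; [lia|by rewrite -el|].
by apply: sub_all hs => z /=; lia.
Qed.

Lemma schensted_rcons w x : schensted (rcons w x) = (insert ltn x (schensted w)).1.
Proof. by rewrite /schensted foldl_rcons. Qed.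

Lemma schenstedP w :
  [/\ tab true (schensted w), nonnil (schensted w) & crystal_eq w (rword (schensted w))].
Proof.
elim/last_ind: w => [|w x [tw nw cw]].
  by split; [exact: tab_nil|by []|exact: crystal_eq_refl].
rewrite schensted_rcons; split.
- exact: (@tab_insert true).
- exact: (@nonnil_insert true).
- rewrite -cats1; apply: crystal_eq_trans (crystal_eq_insert_row x tw).
  exact: crystal_eq_catr.
Qed.

Lemma col_insP w :
  [/\ tab false (column_insertion_cols w).1, nonnil (column_insertion_cols w).1
    & crystal_eq w (cword (column_insertion_cols w).1)].
Proof.
elim: w => [|x w [tw nw cw]].
  by split; [exact: tab_nil|by []|exact: crystal_eq_refl].
rewrite /=; case: (column_insertion_cols w) tw nw cw => P Q /= tw nw cw.
have := @tab_insert false x P tw; have := @nonnil_insert false x P nw.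
have := crystal_eq_insert_col x tw; rewrite /lerel.
case: (insert _ _ _) => P' j /= h ? ?; split=> //.
by apply: crystal_eq_trans h; exact: crystal_eq_cons.
Qed.

(** * Transposition *)

Definition line_size (T : tableau) i := size (nth [::] T i).

Definition entry_at (T : tableau) i j := nth 0 (nth [::] T i) j.

Definition decr (T : tableau) := forall i, line_size T i.+1 <= line_size T i.

Lemma line_size_gt0 T i j : j < line_size T i -> i < size T.
Proof. by rewrite /line_size; case: (ltnP i (size T)) => // h; rewrite nth_default. Qed.

Lemma count_lt_line_sorted d r c j : line_sorted d r ->
  (j < count (fun x => x < c) r) = (j < size r) && (nth 0 r j < c).
Proof.
elim: r j => [|x r IH] j; first by rewrite /= ltn0.
rewrite line_sorted_cons => /andP[xr sr] /=.
case: (ltnP x c) => xc; first by case: j => [|j] //=; rewrite add1n !ltnS IH.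
have -> : count (fun x => x < c) r = 0.
  apply/eqP; rewrite -leqn0 leqNgt -has_count; apply/hasPn => y /(allP xr).
  by case: d {xr sr IH} => /=; lia.
rewrite ltn0; case: j => [|j] /=; first by lia.
case: ltnP => //= jr; have := allP xr _ (mem_nth 0 jr).
by case: d {xr sr IH} => /=; lia.
Qed.

Lemma leq_from_lt a b : (forall i, i < a -> i < b) -> a <= b.
Proof. by case: a => // a; apply. Qed.

(** A sorted line has more than [j] letters below [c] exactly when its entry [j] exists and is below
    [c]; this trades counts for entries. *)
Lemma line_leP d r s : line_sorted d r -> line_sorted d s ->
  line_le d r s <->
  (size s <= size r /\ forall j, j < size s -> nth 0 r j + d <= nth 0 s j).
Proof.
move=> sr ss; split=> [h|[h1 h2] c].
  have key j : j < size s -> (j < size r) && (nth 0 r j + d <= nth 0 s j).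
    (* For this threshold [c], the number [c + d] is one more than entry [j] of [s], so the count
       includes that entry. *)
    move=> js; have := h (nth 0 s j + 1 - d).
    have : j < count (fun x => x < nth 0 s j + 1 - d + d) s.
      by rewrite (count_lt_line_sorted _ _ ss) js; case: (d) => /=; lia.
    move=> /leq_trans h' /h'; rewrite (count_lt_line_sorted _ _ sr).
    by case: (d) => /=; lia.
  split; first by apply: leq_from_lt => j /key/andP[].
  by move=> j /key/andP[].
apply: leq_from_lt => j; rewrite (count_lt_line_sorted _ _ ss) (count_lt_line_sorted _ _ sr).
by move=> /andP[js]; have := h2 j js; lia.
Qed.

Lemma line_sortedP d l :
  line_sorted d l <-> forall j, j.+1 < size l -> nth 0 l j < nth 0 l j.+1 + d.
Proof.
rewrite line_sorted_sorted; split=> [h j jl|h]; first exact: (sortedP 0 h).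
by apply/(sortedP 0).
Qed.

Lemma tabP d T :
  tab d T <-> [/\ decr T,
    forall i j, j.+1 < line_size T i -> entry_at T i j < entry_at T i j.+1 + d &
    forall i j, j < line_size T i.+1 -> entry_at T i j + d <= entry_at T i.+1 j].
Proof.
have srt_nth U i : all (line_sorted d) U -> line_sorted d (nth [::] U i).
  move=> h; have [iU|iU] := ltnP i (size U); last by rewrite nth_default.
  exact: (allP h _ (mem_nth _ iU)).
split=> [[sT oT]|[h1 h2 h3]].
  split=> [i|i|i j]; last 2 first.
  - by apply/line_sortedP; exact: srt_nth.
  - by move=> jT; case: (proj1 (line_leP (srt_nth _ i sT) (srt_nth _ i.+1 sT)) (oT i)) => _;
    exact.
  by case: (proj1 (line_leP (srt_nth _ i sT) (srt_nth _ i.+1 sT)) (oT i)).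
have sT : all (line_sorted d) T.
  by apply/(all_nthP [::]) => i iT; apply/line_sortedP => j; exact: h2.
split=> // j; apply/line_leP; try exact: srt_nth.
by split; [exact: h1|exact: h3].
Qed.

Lemma tab_decr d T : tab d T -> decr T.
Proof. by case/tabP. Qed.

Lemma decr_leq T i j : decr T -> i <= j -> line_size T j <= line_size T i.
Proof.
move=> h; elim: j => [|j IH]; first by rewrite leqn0 => /eqP->.
rewrite leq_eqVlt => /predU1P[->//|]; rewrite ltnS => /IH.
exact: leq_trans (h j).
Qed.

Lemma decr_sorted T : sorted geq (shape T) <-> decr T.
Proof.
split=> [h i|h].
  have [iT|iT] := ltnP i.+1 (size T); last by rewrite /line_size nth_default.
  have := sortedP 0 h i; rewrite size_map => /(_ iT) /=.
  by rewrite !(nth_map [::]) // ltnW.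
apply/(sortedP 0) => i; rewrite size_map => iT /=.
by rewrite !(nth_map [::]) ?(ltnW iT) //; exact: h.
Qed.

Lemma tableau_eq T T' : size T = size T' -> (forall i, line_size T i = line_size T' i) ->
  (forall i j, j < line_size T i -> entry_at T i j = entry_at T' i j) -> T = T'.
Proof.
move=> h hs he; apply: (@eq_from_nth _ [::]) => // i iT.
apply: (@eq_from_nth _ 0); first exact: hs.
by move=> j; exact: he.
Qed.

(** Row lengths decrease, so the rows that reach column [j] are the first ones and the filter shifts
    no index. *)
Lemma col_nth T j i : decr T ->
  let c := [seq nth 0 r j | r <- T & j < size r] in
  (i < size c) = (j < line_size T i) /\ (j < line_size T i -> nth 0 c i = entry_at T i j).
Proof.
elim: T i => [|r T IH] i; first by rewrite /= /line_size nth_nil.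
move=> h /=; have hT : decr T by move=> q; exact: (h q.+1).
case: (ltnP j (size r)) => jr /=.
  case: i => [|i] /=; first by rewrite /line_size /entry_at /= ltn0Sn jr.
  by case: (IH i hT); rewrite ltnS.
have h0 q : j < line_size T q = false.
  apply/negbTE; rewrite -leqNgt; apply: leq_trans jr.
  exact: (@decr_leq (r :: T) 0 q.+1).
have -> : [seq r0 <- T | j < size r0] = [::].
  apply/eqP; rewrite -size_eq0 size_filter -leqn0 leqNgt -has_count.
  by apply/hasPn => q /(nthP [::])[a aT <-]; rewrite -/(line_size T a) h0.
case: i => [|i]; rewrite /= /line_size /= ?ltnNge ?jr //= -ltnNge.
by rewrite -/(line_size T i) h0.
Qed.

Lemma size_transp m T : size (transp m T) = m.
Proof. by rewrite /transp size_map size_iota. Qed.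

Lemma nth_transp m T j : j < m ->
  nth [::] (transp m T) j = [seq nth 0 r j | r <- T & j < size r].
Proof. by move=> jm; rewrite (nth_map 0) ?size_iota // nth_iota. Qed.

Lemma transp_line_size m T i j : decr T ->
  (i < line_size (transp m T) j) = (j < m) && (j < line_size T i).
Proof.
move=> h; rewrite /line_size; case: (ltnP j m) => jm; last by rewrite nth_default ?size_transp.
by rewrite nth_transp //; case: (col_nth j i h).
Qed.

Lemma transp_en m T i j : decr T -> j < m -> j < line_size T i ->
  entry_at (transp m T) j i = entry_at T i j.
Proof.
by move=> h jm jT; rewrite /entry_at nth_transp //; case: (col_nth j i h) => _; exact.
Qed.

Lemma transp_decr m T : decr T -> decr (transp m T).
Proof.
move=> h j; apply: leq_from_lt => i; rewrite !transp_line_size // => /andP[? ?].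
by apply/andP; split; lia.
Qed.

Lemma tab_transp d m T : tab d T -> tab (~~ d) (transp m T).
Proof.
move=> /tabP[h1 h2 h3]; apply/tabP; split; first exact: transp_decr.
  move=> j i; rewrite transp_line_size // => /andP[jm ji].
  have := h3 _ _ ji; have := h1 i; rewrite !transp_en //; last by move: ji (h1 i); lia.
  by case: (d); lia.
move=> j i; rewrite transp_line_size // => /andP[jm ji].
by rewrite !transp_en ?(ltnW jm) ?(ltnW ji) //; have := h2 _ _ ji; case: (d); lia.
Qed.

Lemma transpK m T : decr T -> line_size T 0 <= m ->
  transp (size T) (transp m T) = T.
Proof.
move=> h hm; have h' := transp_decr m h.
have hs i : line_size (transp (size T) (transp m T)) i = line_size T i.
  apply/eqP; rewrite eqn_leq; apply/andP; split; apply: leq_from_lt => j.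
    by rewrite !transp_line_size // => /and3P[].
  move=> jT; rewrite !transp_line_size // jT andbT.
  by rewrite (line_size_gt0 jT) (leq_trans jT) // (leq_trans _ hm) // decr_leq.
apply: tableau_eq => [|//|i j]; first by rewrite size_transp.
rewrite hs => jT; have iT := line_size_gt0 jT.
have jm : j < m by rewrite (leq_trans jT) // (leq_trans _ hm) // decr_leq.
by rewrite !transp_en // transp_line_size // jm.
Qed.

Lemma tab_catl d T U : tab d (T ++ U) -> tab d T.
Proof.
case; rewrite all_cat => /andP[sT _] h; split=> // j.
have [jT|jT] := ltnP j.+1 (size T); last by rewrite (nth_default _ jT).
by have := h j; rewrite !nth_cat jT (ltnW jT).
Qed.

Lemma tab_nseq d m : tab d (nseq m [::]).
Proof. by apply/tabP; split=> [i|i j|i j]; rewrite /line_size !nth_nseq !if_same. Qed.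

Lemma tab_en_leq T i j j' : tab false T -> j <= j' -> i < line_size T j' ->
  entry_at T j i <= entry_at T j' i.
Proof.
move=> tT; have [h1 _ h3] := proj1 (tabP _ _) tT.
elim: j' => [|j' IH]; first by rewrite leqn0 => /eqP->.
rewrite leq_eqVlt => /predU1P[->//|]; rewrite ltnS => /IH{}IH h.
by rewrite (leq_trans (IH _)) ?(leq_trans h) //; have := h3 _ _ h; rewrite addn0.
Qed.

(** * Row insertion of column words *)

Definition row_insert (T : tableau) x := (insert ltn x T).1.

Lemma crystal_eq_foldl_row_insert T w : tab true T ->
  crystal_eq (rword T ++ w) (rword (foldl row_insert T w)).
Proof.
elim: w T => [|x w IH] T tT; first by rewrite cats0; exact: crystal_eq_refl.
rewrite -cat1s catA; apply: (@crystal_eq_trans (rword (row_insert T x) ++ w)).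
  by apply: crystal_eq_catr; exact: crystal_eq_insert_row.
by apply: IH; exact: (@tab_insert true).
Qed.

Fixpoint addcol (T : tableau) (C : seq nat) : tableau :=
  match T, C with
  | r :: T', c :: C' => rcons r c :: addcol T' C'
  | _, _ => T
  end.

Fixpoint leqcol (T : tableau) (C : seq nat) : bool :=
  match T, C with
  | r :: T', c :: C' => all (fun x => x <= c) r && leqcol T' C'
  | _, _ => true
  end.

Lemma bump_none (e : rel nat) x l :
  all (fun z => ~~ e x z) l -> Defs.bump e x l = (None, rcons l x).
Proof. by elim: l => //= z l IH /andP[/negbTE -> /IH ->]. Qed.

Lemma bump_some (e : rel nat) x u y v : all (fun z => ~~ e x z) u -> e x y ->
  Defs.bump e x (u ++ y :: v) = (Some y, u ++ x :: v).
Proof.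
move=> hu hy; elim: u hu => /= [|z u IH]; first by rewrite hy.
by move=> /andP[/negbTE -> /IH ->].
Qed.

(** The last letter of each row reached by [C] is the one bumped there, so inserting [x] pushes the
    added column down by one row. *)
Lemma row_insert_addcol T x C : size C < size T -> line_sorted false (x :: C) ->
  leqcol T (x :: C) -> row_insert (addcol T C) x = addcol T (x :: C).
Proof.
elim: T x C => [|r T IH] x [|c C] //.
  move=> _ _ /= /andP[rx _]; rewrite /row_insert /= bump_none //=.
    by case: T {IH} => //.
  by apply: sub_all rx => z /=; lia.
rewrite line_sorted_cons => hs /andP[/= /andP[xc _] sC] /andP[rx hC].
rewrite /row_insert /= -cats1 bump_some; last 2 first.
- by apply: sub_all rx => z /=; lia.
- by rewrite /=; lia.
have := IH c C; rewrite /row_insert; case: (insert _ _ _) => T' j /= -> //.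
by rewrite cats1.
Qed.

Lemma leqcol_behead T x C : line_sorted false (x :: C) -> leqcol T (x :: C) -> leqcol T C.
Proof.
elim: T x C => [|r T IH] x [|c C] //.
rewrite line_sorted_cons => /andP[/= /andP[xc _] sC] /andP[rx hC].
rewrite (IH c) // andbT.
by apply: sub_all rx => z /=; lia.
Qed.

Lemma foldl_row_insert_col T C : size C <= size T -> line_sorted false C -> leqcol T C ->
  foldl row_insert T (rev C) = addcol T C.
Proof.
elim: C => [|x C IH] h; first by case: T h.
move=> sC hC; rewrite rev_cons foldl_rcons IH ?(ltnW h) ?(leqcol_behead sC) //.
  exact: row_insert_addcol.
by case/andP: sC.
Qed.

Lemma nth_addcol T C i : i < size T -> nth [::] (addcol T C) i =
  if i < size C then rcons (nth [::] T i) (nth 0 C i) else nth [::] T i.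
Proof. by elim: T C i => [|r T IH] [|c C] [|i] //=; exact: IH. Qed.

Lemma size_addcol T C : size (addcol T C) = size T.
Proof. by elim: T C => [|r T IH] [|c C] //=; rewrite IH. Qed.

Lemma leqcol_nth T C : size C <= size T -> 
  (forall i, i < size C -> all (fun x => x <= nth 0 C i) (nth [::] T i)) ->
  leqcol T C.
Proof.
elim: T C => [|r T IH] [|c C] //= h hC.
by rewrite (hC 0) //= IH // => i iC; exact: (hC i.+1).
Qed.

Lemma transp_rcons m Cs C : size C <= m ->
  transp m (rcons Cs C) = addcol (transp m Cs) C.
Proof.
move=> hC; apply: (@eq_from_nth _ [::]); first by rewrite size_addcol !size_transp.
rewrite size_transp => i im; rewrite nth_addcol ?size_transp // !nth_transp //.
by rewrite filter_rcons; case: ifP => // _; rewrite map_rcons.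
Qed.

(** Each column, inserted from bottom to top, is appended to the right of the previous ones.
    Starting from [m] empty rows keeps the number of rows fixed. *)
Lemma foldl_row_insert_cword m Cs : tab false Cs -> line_size Cs 0 <= m ->
  foldl row_insert (nseq m [::]) (cword Cs) = transp m Cs.
Proof.
elim/last_ind: Cs => [|Cs C IH] tC hm.
  apply: (@eq_from_nth _ [::]); rewrite ?size_transp ?size_nseq //= => i im.
  by rewrite nth_transp // nth_nseq im.
have tCs : tab false Cs by move: tC; rewrite -cats1; exact: tab_catl.
have dC := tab_decr tC.
have hCs : line_size Cs 0 <= m by move: hm; rewrite /line_size nth_rcons; case: (Cs).
have hCm : size C <= m.
  apply: leq_trans hm; have := @decr_leq _ 0 (size Cs) dC isT.
  by rewrite {1}/line_size nth_rcons ltnn eqxx.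
rewrite /cword map_rcons flatten_rcons foldl_cat -/(cword Cs) IH //.
rewrite transp_rcons // foldl_row_insert_col ?size_transp //.
  have [/allP h _] := tC; apply: h; by rewrite mem_rcons mem_head.
apply: leqcol_nth; rewrite ?size_transp // => i iC.
rewrite nth_transp ?(leq_trans iC) //.
apply/allP => y /mapP[c]; rewrite mem_filter => /andP[ic /(nthP [::])[j jC ej]] ->.
have := @tab_en_leq _ i j (size Cs) tC (ltnW jC).
by rewrite /line_size /entry_at !nth_rcons ltnn eqxx jC ej; exact.
Qed.

(** The bridge between the two readings: row insertion of the column word rebuilds the tableau, and
    every insertion respects crystal equivalence. *)
Lemma crystal_eq_cword_transp m Cs : tab false Cs -> line_size Cs 0 <= m ->
  crystal_eq (cword Cs) (rword (transp m Cs)).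
Proof.
move=> tC hm; rewrite -foldl_row_insert_cword //.
have := crystal_eq_foldl_row_insert (cword Cs) (tab_nseq true m).
suff -> : rword (nseq m [::]) = [::] by [].
by elim: m {hm} => //= m IH; rewrite rword_cons IH.
Qed.

Lemma crystal_eq_rword_transp k T : tab true T -> line_size T 0 <= k ->
  crystal_eq (rword T) (cword (transp k T)).
Proof.
move=> tT hk; have dT := tab_decr tT; rewrite -{1}(transpK dT hk).
apply: crystal_eq_sym; apply: crystal_eq_cword_transp; first exact: (@tab_transp true).
apply: leq_from_lt => i; rewrite transp_line_size // => /andP[_].
exact: line_size_gt0.
Qed.

(** * Crystal operators on tableaux *)

(** No [i.+1] stands before an [i] in a row, so nothing is matched. *)
Lemma phi_eps_row i r : line_sorted true r ->
  phi i r = count_mem i r /\ eps i r = count_mem i.+1 r.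
Proof.
elim: r => //= x r IH /andP[xr /IH[-> ->]].
have [ex|xi] := eqVneq x i.+1; last by split; lia.
rewrite ex; suff -> : count_mem i r = 0 by split; lia.
apply/eqP; rewrite -leqn0 leqNgt -has_count; apply/hasPn => y /(allP xr) /=; rewrite ex; lia.
Qed.

Lemma mem_eop i w y : y \in eop i w -> (y == i) || (y \in w).
Proof.
have [/eop_id ->|h] := posnP (eps i w); first by move=> ->; rewrite orbT.
have /perm_mem e := perm_eop h.
by move=> yw; have := e y; rewrite !inE yw orbT => <-.
Qed.

Lemma line_sorted_eop_row i r : line_sorted true r -> line_sorted true (eop i r).
Proof.
elim: r => //= x r IH; rewrite -/(line_sorted true) => /andP[xr sr].
have [hp he] := phi_eps_row i sr.
case: ifP => h /=; rewrite -/(line_sorted true).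
  by rewrite sr andbT; apply: sub_all xr => y /=; lia.
rewrite IH // andbT.
have [/eop_id -> //|e0] := posnP (eps i r).
have /hasP[y yr /eqP ey] : has (pred1 i.+1) r by rewrite has_count -he.
have xi : x <= i.
  have := allP xr _ yr; have := hp; rewrite ey /=; case: (eqVneq x i.+1) => [ex|]; last by lia.
  suff -> : count_mem i r = 0 by move: h; rewrite ex eqxx; lia.
  by apply/eqP; rewrite -leqn0 leqNgt -has_count; apply/hasPn => z /(allP xr) /=; lia.
apply/allP => z /mem_eop /predU1P[->|/(allP xr)//]; lia.
Qed.

Lemma count_ltS c (l : seq nat) :
  count (fun x => x < c.+1) l = count (fun x => x < c) l + count_mem c l.
Proof. by elim: l => //= x l ->; lia. Qed.

Lemma count_lt_eop i w c : 0 < eps i w ->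
  count (fun x => x < c) (eop i w) = count (fun x => x < c) w + (c == i.+1).
Proof.
by move=> /perm_eop /seq.permP /(_ (fun x => x < c)) /=; lia.
Qed.

(* The last clause lets the induction put a row [A] back on top. *)
Lemma row_eop i T : tab true T -> 0 < eps i (rword T) ->
  exists T2, [/\ eop i (rword T) = rword T2, shape T2 = shape T, tab true T2 &
    forall A, line_le true A (head [::] T) -> count_mem i A < eps i (rword T) ->
      line_le true A (head [::] T2)].
Proof.
elim: T => // r T IH /tab_cons[sr oT tT].
have [hp he] := phi_eps_row i sr.
rewrite rword_cons eps_cat => e0; rewrite eop_cat; case: ifP => h.
  have [|T2 [e es t hA]] := IH tT; first by lia.
  exists (r :: T2); rewrite rword_cons e /= es; split=> //.
  by apply/tab_cons; split=> //; apply: hA; rewrite -?hp.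
have e0r : 0 < eps i r by lia.
exists (eop i r :: T); rewrite rword_cons /= size_eop; split=> //.
  apply/tab_cons; split=> //; first exact: line_sorted_eop_row.
  by move=> c; rewrite count_lt_eop // (leq_trans (oT c)) ?leq_addr.
(* Only the count at [c = i] changes. There the condition at [i.+1] gives the missing unit, since
   [A] has fewer letters [i] than [r] has letters [i.+1]. *)
move=> A oA hA c; rewrite count_lt_eop // addn1 eqSS.
case: eqP => [->|_]; last by rewrite addn0 -addn1; exact: oA.
have := oA i.+1; move: hA e0r h; rewrite he !addn1 !count_ltS /=; lia.
Qed.

(** In a column read from bottom to top, [i.+1] is directly followed by [i] when both occur, and the
    two match. *)
Lemma rev_col_sig i C : line_sorted false C ->
  phi i (rev C) = (i \in C) && (i.+1 \notin C) /\
  eps i (rev C) = (i.+1 \in C) && (i \notin C).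
Proof.
elim/last_ind: C => // C x IH; rewrite -cats1 line_sorted_cat => /and3P[/allP h /IH[hp he] _].
have hx y : y \in C -> y < x by move=> /h /=; rewrite andbT addn0.
rewrite cats1 rev_rcons /= hp he !mem_rcons !inE.
have := hx i; have := hx i.+1.
by case: (i \in C); case: (i.+1 \in C) => /=; lia.
Qed.

Lemma line_sorted_uniq C : line_sorted false C -> uniq C.
Proof. by rewrite col_sortedE; apply: sorted_uniq; [exact: ltn_trans|exact: ltnn]. Qed.

Lemma phi0 i w : i \notin w -> phi i w = 0.
Proof.
elim: w => //= x w IH; rewrite inE negb_or => /andP[ix /IH ->].
by rewrite eq_sym (negbTE ix).
Qed.

Lemma eps0 i w : i.+1 \notin w -> eps i w = 0.
Proof.
elim: w => //= x w IH; rewrite inE negb_or => /andP[ix /IH ->].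
by rewrite eq_sym (negbTE ix).
Qed.

Definition subst_letter (x y z : nat) := if z == x then y else z.

Lemma subst_letter_id x y (w : seq nat) : x \notin w -> map (subst_letter x y) w = w.
Proof.
move=> h; rewrite -[RHS]map_id; apply/eq_in_map => z zw; rewrite /subst_letter.
by case: eqP => // zx; rewrite -zx zw in h.
Qed.

Lemma eop_uniq i w : uniq w -> i \notin w -> eop i w = map (subst_letter i.+1 i) w.
Proof.
elim: w => //= x w IH /andP[xw uw]; rewrite inE negb_or => /andP[ix iw].
rewrite phi0 // /subst_letter; case: eqP => [e|_] /=; last by rewrite IH.
by rewrite -/(subst_letter _ _) subst_letter_id // -e.
Qed.

Lemma fop_uniq i w : uniq w -> i.+1 \notin w -> fop i w = map (subst_letter i i.+1) w.
Proof.
elim: w => //= x w IH /andP[xw uw]; rewrite inE negb_or => /andP[ix iw].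
rewrite eq_sym (negbTE ix) IH //; case: ifP => h.
  rewrite /subst_letter; case: eqP => // e; move: h; rewrite -e phi0 //.
rewrite /subst_letter; congr cons; rewrite -IH //.
by rewrite fop_id //; lia.
Qed.

Lemma line_sorted_subst_letter x y C : line_sorted false C -> y \notin C ->
  (y == x.+1) || (x == y.+1) -> line_sorted false (map (subst_letter x y) C).
Proof.
move=> sC hy hxy; rewrite /line_sorted pairwise_map.
apply: (@sub_in_pairwise _ (mem C)) sC; last by apply/allP.
move=> u v uC vC; rewrite /subst_letter /= => huv.
have uy : u != y by apply: contraNneq hy => <-.
have vy : v != y by apply: contraNneq hy => <-.
by case: (u =P x); case: (v =P x); move: huv hxy uy vy; rewrite /= ?addn0; lia.
Qed.

Definition compl_col (a n : nat) (C : seq nat) := [seq x <- iota a n | x \notin C].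

Definition dual_cols (a n : nat) (Cs : tableau) := [seq compl_col a n C | C <- rev Cs].

Lemma mem_compl_col a n C x : (x \in compl_col a n C) = (a <= x < a + n) && (x \notin C).
Proof. by rewrite mem_filter mem_iota andbC. Qed.

Lemma line_sorted_compl_col a n C : line_sorted false (compl_col a n C).
Proof. by rewrite col_sortedE; apply: sorted_filter;
  [exact: ltn_trans|exact: iota_ltn_sorted]. Qed.

Lemma line_sorted_eq C D : line_sorted false C -> line_sorted false D -> C =i D -> C = D.
Proof.
by rewrite !col_sortedE; apply: irr_sorted_eq; [exact: ltn_trans|exact: ltnn].
Qed.

(** A column with an unmatched [i.+1] contains [i.+1] and not [i], its complement [i] and not
    [i.+1]; both operators exchange the roles of these two letters. *)
Lemma col_eop a n i C : a <= i -> i.+1 < a + n -> line_sorted false C ->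
  0 < eps i (rev C) ->
  exists2 C2, eop i (rev C) = rev C2 /\ fop i (rev (compl_col a n C)) = rev (compl_col a n C2)
            & line_sorted false C2.
Proof.
move=> ai ia sC; have [_ he] := rev_col_sig i sC; rewrite he.
case iC: (i.+1 \in C) => //=; case jC: (i \in C) => //= _.
have h1 : i.+1 \notin compl_col a n C by rewrite mem_compl_col iC andbF.
have s2 : line_sorted false (map (subst_letter i.+1 i) C).
  by apply: line_sorted_subst_letter => //; rewrite ?jC ?eqxx ?orbT.
exists (map (subst_letter i.+1 i) C) => //; split.
  by rewrite eop_uniq ?rev_uniq ?mem_rev ?jC ?line_sorted_uniq // map_rev.
rewrite fop_uniq ?rev_uniq ?mem_rev ?(line_sorted_uniq (line_sorted_compl_col _ _ _)) //.
rewrite map_rev; congr rev; apply: line_sorted_eq; [|exact: line_sorted_compl_col|].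
  by apply: line_sorted_subst_letter; rewrite ?line_sorted_compl_col ?eqxx.
move=> x; rewrite mem_compl_col; apply/mapP/andP => [[y]|[xa xC]].
  rewrite mem_compl_col => /andP[ya yC] ->; rewrite /subst_letter; case: eqP => [ey|yi].
    split; first by lia.
    apply/mapP => -[z zC]; rewrite /subst_letter; case: eqP => //; lia.
  split=> //; apply/mapP => -[z zC]; rewrite /subst_letter; case: eqP => [_ /esym|_ ez];
    first by lia.
  by move: yC; rewrite ez zC.
have [ex|xi] := eqVneq x i.+1.
  by exists i; rewrite ?mem_compl_col ?jC /subst_letter ?eqxx //; lia.
have xni : x != i.
  apply: contraNneq xC => ->; apply/mapP; exists i.+1 => //.
  by rewrite /subst_letter eqxx.
exists x; rewrite ?/subst_letter ?(negbTE xni) // mem_compl_col xa /=.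
apply: contraNN xC => xC; apply/mapP; exists x => //.
by rewrite /subst_letter (negbTE xi).
Qed.

Lemma cword_rcons Cs C : cword (rcons Cs C) = cword Cs ++ rev C.
Proof. by rewrite /cword map_rcons flatten_rcons. Qed.

Lemma cword_cons C Cs : cword (C :: Cs) = rev C ++ cword Cs.
Proof. by []. Qed.

Lemma dual_cols_cons a n C Cs : dual_cols a n (C :: Cs) = rcons (dual_cols a n Cs) (compl_col a n C).
Proof. by rewrite /dual_cols rev_cons map_rcons. Qed.

Lemma compl_col_sig a n i C : a <= i -> i.+1 < a + n -> line_sorted false C ->
  phi i (rev (compl_col a n C)) = eps i (rev C) /\
  eps i (rev (compl_col a n C)) = phi i (rev C).
Proof.
move=> ai ia sC.
have [-> ->] := rev_col_sig i sC; have [-> ->] := rev_col_sig i (line_sorted_compl_col a n C).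
by rewrite !mem_compl_col; case: (i \in C); case: (i.+1 \in C) => /=; lia.
Qed.

(** Complementation exchanges [phi] and [eps] of each column, and reversing the order of the columns
    exchanges the two sides of the tensor product rule. *)
Lemma dual_cols_sig a n i Cs : a <= i -> i.+1 < a + n -> all (line_sorted false) Cs ->
  phi i (cword (dual_cols a n Cs)) = eps i (cword Cs) /\
  eps i (cword (dual_cols a n Cs)) = phi i (cword Cs).
Proof.
move=> ai ia; elim: Cs => //= C Cs IH /andP[sC /IH[hp he]].
have [hpC heC] := compl_col_sig ai ia sC.
rewrite dual_cols_cons cword_rcons /cword /= -/(cword Cs).
by rewrite !phi_cat !eps_cat hp he hpC heC.
Qed.

(* The last clause lets the induction put a column [A] back on the left. *)
Lemma cols_eop a n i Cs : a <= i -> i.+1 < a + n ->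
  tab false Cs -> 0 < eps i (cword Cs) ->
  exists Cs2, [/\ eop i (cword Cs) = cword Cs2,
    fop i (cword (dual_cols a n Cs)) = cword (dual_cols a n Cs2),
    shape Cs2 = shape Cs, tab false Cs2 &
    forall A, line_sorted false A -> line_le false A (head [::] Cs) ->
      eps i (rev A) <= phi i (cword Cs) -> line_le false A (head [::] Cs2)].
Proof.
move=> ai ia; elim: Cs => // C Cs IH /tab_cons[sC oC tC].
have [hp he] := rev_col_sig i sC.
have [hdp hde] := dual_cols_sig ai ia (proj1 tC).
have [hpC heC] := compl_col_sig ai ia sC.
rewrite dual_cols_cons cword_rcons fop_cat hde hpC.
rewrite cword_cons eps_cat phi_cat eop_cat => e0.
case: ifP => h; last first.
  have [|Cs2 [e ed es t hA]] := IH tC; first by lia.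
  exists (C :: Cs2); rewrite dual_cols_cons cword_cons cword_rcons e ed /= es; split=> //.
  by apply/tab_cons; split=> //; apply: hA => //; lia.
have [|C2 [e ed] s2] := col_eop ai ia sC; first by lia.
have eC : 0 < eps i (rev C) by lia.
have hc c : count (fun x => x < c) C2 = count (fun x => x < c) C + (c == i.+1).
  by rewrite -count_rev -e count_lt_eop // count_rev.
have sz2 : size C2 = size C by rewrite -size_rev -e size_eop size_rev.
exists (C2 :: Cs); rewrite dual_cols_cons cword_cons cword_rcons e ed /= sz2; split=> //.
  apply/tab_cons; split=> // c.
  by rewrite hc (leq_trans (oC c)) ?leq_addr.
move=> A sA oA hA c; have {oA} oA c' : count (fun x => x < c') C <= count (fun x => x < c') A.
  by have := oA c'; rewrite addn0.
(* Only the count at [c = i.+1] changes. [C] contains [i.+1] but not [i], and by [hA] the column [A]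
   does not contain [i.+1] without [i]; the conditions at [i] and [i.+2] then give the missing
   unit. *)
rewrite addn0 hc; case: eqP => [->|_]; last by rewrite addn0.
have := oA i.+2; have := oA i; move: hA; rewrite !count_ltS !count_uniq_mem ?line_sorted_uniq //.
have [_ ->] := rev_col_sig i sA; move: eC; rewrite hp he.
by case: (i \in C); case: (i.+1 \in C); case: (i \in A); case: (i.+1 \in A) => //=; lia.
Qed.

(** * Highest weight words *)

Fixpoint yamanouchi (a : nat) (sh : seq nat) : tableau :=
  if sh is s :: sh' then nseq s a :: yamanouchi a.+1 sh' else [::].

Lemma count_le_all p (w : seq nat) : count p w = 0 -> all (predC p) w.
Proof. by move=> /eqP; rewrite -leqn0 leqNgt -has_count -all_predC. Qed.

Lemma count0_notin x (w : seq nat) : x \notin w -> count_mem x w = 0.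
Proof. by move/count_memPn. Qed.

Lemma tab_letters a r T : tab true (r :: T) -> all (leq a) r ->
  all (leq a) (flatten T) -> all (leq a.+1) (flatten T).
Proof.
move=> [_ h] hr hT; apply/allP => x /flattenP[s /(nthP [::])[j jT <-] xs].
have : count (fun y => y < a) (nth [::] (r :: T) j) = 0.
  apply/eqP; rewrite -leqn0 leqNgt -has_count; apply/hasPn => y yr.
  rewrite -leqNgt; case: j jT yr {xs} => [|j] jT yr; first exact: (allP hr).
  by apply: (allP hT); apply/flattenP; exists (nth [::] T j) => //; apply: mem_nth; exact: ltnW.
have := h j a; move=> /[swap] ->; rewrite leqn0 => /eqP /count_le_all /allP /(_ x xs) /=.
by rewrite /= addn1 ltnS -ltnNge.
Qed.

(** The top row is the right factor of the reading word, so its own [eps] vanish and it contains no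
    letter above [a]. The other rows then start from [a.+1], and a row of letters [a] cannot cancel
    any of their unmatched letters. *)
Lemma high_yamanouchi a T : tab true T -> all (leq a) (rword T) ->
  (forall i, a <= i -> eps i (rword T) = 0) -> T = yamanouchi a (shape T).
Proof.
elim: T a => // r T IH a tT; rewrite rword_cons all_cat => /andP[lT lr] h.
have [sr _ tT'] := proj1 (tab_cons _ _ _) tT.
have er i : a <= i -> eps i r = 0 by move=> /h; rewrite eps_cat; lia.
have r1 : all (pred1 a) r.
  apply/allP => x xr; have := allP lr _ xr; rewrite leq_eqVlt => /predU1P[->|]; first exact: eqxx.
  case: x xr => // x xr; rewrite ltnS => /er.
  by have [_ ->] := phi_eps_row x sr; move=> /count_memPn; rewrite xr.
have lT' : all (leq a.+1) (rword T).
  rewrite (perm_all _ (perm_rword T)); apply: tab_letters tT _ _ => //.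
  by rewrite -(perm_all _ (perm_rword T)).
rewrite /= -(all_pred1P _ _ r1); congr cons; apply: IH => // i ai.
have := h i (ltnW ai); rewrite eps_cat.
rewrite (@phi0 i r) ?subn0; first by lia.
by apply: contraL ai => /(allP r1) /eqP ->; rewrite ltnn.
Qed.

Lemma count_yamanouchi a sh j : count_mem (a + j) (rword (yamanouchi a sh)) = nth 0 sh j.
Proof.
suff h b : count_mem b (rword (yamanouchi a sh)) = if b < a then 0 else nth 0 sh (b - a).
  by rewrite h ltnNge leq_addr /= addKn.
elim: sh a => [|s sh IH] a /=; first by rewrite nth_nil if_same.
rewrite rword_cons count_cat IH count_nseq /=.
case: (ltngtP b a) => ba.
- by rewrite ltnS (ltnW ba); case: ltngtP ba.
- case: (ltngtP a b) ba => // ab _; rewrite mul0n addn0 ltnS leqNgt ab /=.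
  by have -> : b - a = (b - a.+1).+1 by lia.
- by rewrite ba leqnn subnn /= ?mul1n ?addn0.
Qed.

(** * Raising and lowering within an interval of letters *)

Definition letters_in (a b : nat) (w : seq nat) : bool := all (fun x => a <= x < b) w.

Definition op_in (a b : nat) (o : bool * nat) : bool := (a <= o.2) && (o.2.+1 < b).

Lemma mem_fop i w y : y \in fop i w -> (y == i.+1) || (y \in w).
Proof.
have [/fop_id ->|h] := posnP (phi i w); first by move=> ->; rewrite orbT.
have /perm_mem e := perm_fop h.
by move=> yw; have := e y; rewrite !inE yw orbT => <-.
Qed.

Lemma letters_in_crystal_op a b o w : op_in a b o -> letters_in a b w ->
  letters_in a b (crystal_op o w).
Proof.
case: o => c i; rewrite /op_in /crystal_op /= => hi /allP hw; apply/allP => x.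
case: c => [/mem_eop|/mem_fop] /predU1P[->|/hw //]; lia.
Qed.

Lemma letters_in_run a b g w : all (op_in a b) g -> letters_in a b w -> letters_in a b (run g w).
Proof. by elim: g => //= o g IH /andP[ho hg] hw; apply: letters_in_crystal_op => //;
  exact: IH. Qed.

Lemma letters_in_ex w : exists b, letters_in 0 b w.
Proof.
exists (\max_(x <- w) x).+1; apply/allP => x xw /=.
by rewrite ltnS; exact: (@leq_bigmax_seq _ _ xpredT id).
Qed.

(** Every effective raising step decreases the sum of the letters. No upper bound on [i] appears in
    the conclusion, as letters from [b] on do not occur. *)
Lemma raise a b w : letters_in a b w -> exists g,
  [/\ all (op_in a b) g, all fst g & forall i, a <= i -> eps i (run g w) = 0].
Proof.
have [m] := ubnP (sumn w); elim: m w => // m IH w; rewrite ltnS => hm lw.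
have [/hasP[i] |/hasPn h] := boolP (has (fun i => 0 < eps i w) (iota a (b - a).-1)).
  rewrite mem_iota => hi e0.
  have hI : op_in a b (true, i) by rewrite /op_in /=; lia.
  have hs : sumn (eop i w) < sumn w.
    by have := perm_sumn (perm_eop e0); rewrite /=; lia.
  have [|g [h1 h2 h3]] := IH (eop i w) (leq_trans hs hm); first exact: (letters_in_crystal_op hI).
  exists (rcons g (true, i)); rewrite !all_rcons hI h1 h2; split=> // j.
  by rewrite -cats1 run_cat; exact: h3.
exists [::]; split=> // i ai /=.
have [ib|ib] := ltnP i.+1 b.
  by apply/eqP; rewrite -leqn0 leqNgt; apply: h; rewrite mem_iota; lia.
by apply: eps0; apply/negP => /(allP lw); lia.
Qed.

Lemma sumn_leq_letters_in b w : letters_in 0 b w -> sumn w <= size w * b.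
Proof.
elim: w => //= x w IH /andP[xb /IH h]; rewrite mulSn; lia.
Qed.

(** Every effective lowering step increases the sum of the letters, which is bounded by
    [size w * b]. *)
Lemma lower a b w : letters_in a b w -> exists g,
  all (op_in a b) g /\ forall i, i.+1 < b -> phi i (run g w) = 0.
Proof.
have [m] := ubnP (size w * b - sumn w); elim: m w => // m IH w; rewrite ltnS => hm lw.
have [/hasP[i] |/hasPn h] := boolP (has (fun i => 0 < phi i w) (iota a (b - a).-1)).
  rewrite mem_iota => hi e0.
  have hI : op_in a b (false, i) by rewrite /op_in /=; lia.
  have lf := letters_in_crystal_op hI lw.
  have hs : sumn (fop i w) = (sumn w).+1.
    by have := perm_sumn (perm_fop e0); rewrite /=; lia.
  have := @sumn_leq_letters_in b (fop i w); rewrite hs size_fop => hb.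
  have [|//|g [h1 h3]] := IH (fop i w).
    rewrite size_fop hs; have : sumn w < size w * b.
      apply: hb; apply: sub_all lf => x; lia.
    by move: hm; lia.
  exists (rcons g (false, i)); rewrite !all_rcons hI h1; split=> // j.
  by rewrite -cats1 run_cat; exact: h3.
exists [::]; split=> // i ib /=.
have [ai|ai] := leqP a i.
  by apply/eqP; rewrite -leqn0 leqNgt; apply: h; rewrite mem_iota; lia.
by apply: phi0; apply/negP => /(allP lw); lia.
Qed.

Lemma run_raise_tab g T : all fst g -> tab true T ->
  exists T2, [/\ run g (rword T) = rword T2, shape T2 = shape T & tab true T2].
Proof.
move=> + tT; elim: g => [_|[[] i] g IH] //=; first by exists T.
move=> /IH[T2 [-> es t2]]; rewrite /crystal_op /=.
have [/eop_id ->|e0] := posnP (eps i (rword T2)); first by exists T2.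
have [T3 [e es3 t3 _]] := row_eop t2 e0.
by exists T3; rewrite es3.
Qed.

Lemma rword_inj T1 T2 : shape T1 = shape T2 -> rword T1 = rword T2 -> T1 = T2.
Proof.
move=> hs h; apply: (can_inj revK); apply: eq_from_flatten_shape => //.
by rewrite /shape !map_rev; congr rev.
Qed.

Lemma cword_inj C1 C2 : shape C1 = shape C2 -> cword C1 = cword C2 -> C1 = C2.
Proof.
move=> hs h; apply: (inj_map (can_inj revK)); apply: eq_from_flatten_shape => //.
by rewrite /shape -!map_comp !(eq_map (f := size \o rev) (g := size)) // => x /=;
  rewrite size_rev.
Qed.

(** The same operators raise both to Yamanouchi tableaux, whose shapes can be read off their equal
    contents; injectivity of the operators leads back. The sizes must agree because empty rows leave
    no trace in a word. *)
Lemma tab_crystal_eq_eq T1 T2 : tab true T1 -> tab true T2 -> size T1 = size T2 ->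
  crystal_eq (rword T1) (rword T2) -> T1 = T2.
Proof.
move=> t1 t2 hsz h12; have [b lb] := letters_in_ex (rword T1).
have [g [_ gf hg]] := raise lb.
have [T1' [e1 s1 t1']] := run_raise_tab gf t1.
have [T2' [e2 s2 t2']] := run_raise_tab gf t2.
have h12' := crystal_eq_run g h12; rewrite e1 e2 in h12'.
have y1 : T1' = yamanouchi 0 (shape T1).
  rewrite -s1; apply: high_yamanouchi => //; first exact/allP.
  by move=> i _; rewrite -e1 hg.
have y2 : T2' = yamanouchi 0 (shape T2).
  rewrite -s2; apply: high_yamanouchi => //; first exact/allP.
  by move=> i _; rewrite -(crystal_eq_eps _ h12') -e1 hg.
have hsh : shape T1 = shape T2.
  apply: (@eq_from_nth _ 0); first by rewrite !size_map.
  move=> j _; rewrite -(count_yamanouchi 0 (shape T1)) -(count_yamanouchi 0 (shape T2)) -y1 -y2.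
  exact: (seq.permP (crystal_eq_perm h12')).
apply: rword_inj => //; apply: (run_inj_crystal_eq (g := g)) => //.
by rewrite e1 e2 y1 y2 hsh.
Qed.

Lemma rword_pad T m : rword (T ++ nseq m [::]) = rword T.
Proof.
elim: T => [|r T IH] /=; last by rewrite !rword_cons IH.
by elim: m => //= m IH; rewrite rword_cons IH.
Qed.

Lemma tab_pad T m : tab true T -> tab true (T ++ nseq m [::]).
Proof.
elim: T => [|r T IH] /=; first by move=> _; exact: tab_nseq.
move=> /tab_cons[sr oT /IH tT]; apply/tab_cons; split=> //.
by case: T oT {IH tT} => //= _; case: m.
Qed.

Lemma nonnil_filter T m : nonnil T ->
  [seq r <- T ++ nseq m [::] | 0 < size r] = T.
Proof.
move=> nT; rewrite filter_cat (all_filterP nT) -[RHS]cats0; congr cat.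
by elim: m.
Qed.

Lemma nonnil_crystal_eq_eq T1 T2 : tab true T1 -> tab true T2 ->
  nonnil T1 -> nonnil T2 -> crystal_eq (rword T1) (rword T2) -> T1 = T2.
Proof.
move=> t1 t2 n1 n2 h.
rewrite -(nonnil_filter (size T2) n1) -(nonnil_filter (size T1) n2).
congr filter; apply: tab_crystal_eq_eq; rewrite ?rword_pad //; try exact: tab_pad.
by rewrite !size_cat !size_nseq (nonnil_filter (size T1) n2) addnC.
Qed.

Lemma schensted_crystal_eq w w' : crystal_eq w w' -> schensted w = schensted w'.
Proof.
move=> h; have [t n c] := schenstedP w; have [t' n' c'] := schenstedP w'.
by apply: nonnil_crystal_eq_eq => //; apply: crystal_eq_trans c'; apply: crystal_eq_trans h;
  exact: crystal_eq_sym.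
Qed.

Lemma schensted_tab T : tab true T -> nonnil T -> schensted (rword T) = T.
Proof.
move=> tT nT; have [t n c] := schenstedP (rword T).
by apply: nonnil_crystal_eq_eq => //; exact: crystal_eq_sym.
Qed.

Lemma shape_nonnil T T' : shape T = shape T' -> nonnil T -> nonnil T'.
Proof.
move=> h; rewrite /nonnil -(all_map size (fun s => 0 < s)) -/(shape T) h.
by rewrite all_map.
Qed.

Lemma shape_schensted_eop i w : shape (schensted (eop i w)) = shape (schensted w).
Proof.
have [/eop_id -> //|e0] := posnP (eps i w).
have [t n c] := schenstedP w.
have [|T2 [e es t2 _]] := @row_eop i _ t; first by rewrite -(crystal_eq_eps _ c).
rewrite -es (schensted_crystal_eq (w' := rword T2)).
  by rewrite schensted_tab //; apply: shape_nonnil n.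
by rewrite -e; exact: (crystal_eq_crystal_op (true, i)).
Qed.

Lemma shape_schensted_run g w : shape (schensted (run g w)) = shape (schensted w).
Proof.
elim: g => //= -[b i] g <-; move: (run g w) => {}w; rewrite /crystal_op /=.
case: b; first exact: shape_schensted_eop.
have [/fop_id -> //|p0] := posnP (phi i w).
by rewrite -{2}(fopK p0) shape_schensted_eop.
Qed.

Lemma shapeE T j : nth 0 (shape T) j = line_size T j.
Proof. exact: nth_shape. Qed.

Lemma line_size_schensted_run g w j : line_size (schensted (run g w)) j = line_size (schensted w) j.
Proof. by rewrite -!shapeE shape_schensted_run. Qed.

(** The insertion tableau of a highest weight word is Yamanouchi, so the content is the shape. *)
Lemma high_count a w j : all (leq a) w -> (forall i, a <= i -> eps i w = 0) ->
  count_mem (a + j) w = line_size (schensted w) j.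
Proof.
have [t n c] := schenstedP w => lw hw.
rewrite (seq.permP (crystal_eq_perm c)) {1}(@high_yamanouchi a (schensted w)) //.
- by rewrite count_yamanouchi shapeE.
- by rewrite -(perm_all _ (crystal_eq_perm c)).
- by move=> i /hw; rewrite (crystal_eq_eps i c).
Qed.

Lemma letters_in_leq a b w : letters_in a b w -> all (leq a) w.
Proof. by apply: sub_all => x /andP[]. Qed.

(** Otherwise the highest weight word of the component would contain the letter [a + N]. *)
Lemma size_schensted a N w : letters_in a (a + N) w -> size (schensted w) <= N.
Proof.
move=> lw; have [g [hI _ hg]] := raise lw.
have lg := letters_in_run hI lw.
rewrite leqNgt; apply/negP => h.
have [_ n _] := schenstedP w; have := allP n _ (mem_nth [::] h).
rewrite -/(line_size _ _) -(line_size_schensted_run g) -(high_count _ (letters_in_leq lg) hg).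
by rewrite count0_notin //; apply/negP => /(allP lg); lia.
Qed.

(** Row and column insertion both give tableaux crystal equivalent to [w], and such a tableau is
    unique. *)
Lemma column_insertion_fst w : (column_insertion w).1 = schensted w.
Proof.
have [t n c] := col_insP w; rewrite /column_insertion.
case: (column_insertion_cols w) t n c => P Q /= t n c.
have e : size (head [::] P) = line_size P 0 by rewrite /line_size nth0.
rewrite e; have c' := crystal_eq_cword_transp t (leqnn (line_size P 0)).
rewrite -[LHS]schensted_tab; first by apply: schensted_crystal_eq; apply: crystal_eq_sym;
  apply: crystal_eq_trans c'.
  exact: (@tab_transp false).
apply/(all_nthP [::]) => i; rewrite size_transp => hi.
by rewrite -[size _]/(line_size (transp (line_size P 0) P) i) transp_line_size ?hi;
  last exact: tab_decr t.
Qed.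

Lemma shape_size (T1 T2 : tableau) : shape T1 = shape T2 -> size T1 = size T2.
Proof. by move/(congr1 size); rewrite !size_map. Qed.

(** * Duality *)

Lemma count_compl_col a n C p : line_sorted false C -> letters_in a (a + n) C ->
  count p (compl_col a n C) + count p C = count p (iota a n).
Proof.
move=> sC lC; rewrite addnC -(seq.permP (permEl (perm_filterC (mem C) (iota a n)))) count_cat.
congr addn; apply/seq.permP/uniq_perm; rewrite ?filter_uniq ?iota_uniq ?line_sorted_uniq //.
move=> x; rewrite mem_filter mem_iota /=.
by case xC: (x \in C) => //=; move/(allP lC): xC.
Qed.

Lemma size_compl_col a n C : line_sorted false C -> letters_in a (a + n) C ->
  size (compl_col a n C) + size C = n.
Proof.
by move=> sC lC; rewrite -!(count_predT) count_compl_col // count_predT size_iota.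
Qed.

Lemma letters_in_compl_col a n C : letters_in a (a + n) (compl_col a n C).
Proof. by apply/allP => x; rewrite mem_compl_col => /andP[]. Qed.

Lemma compl_colK a n C : line_sorted false C -> letters_in a (a + n) C ->
  compl_col a n (compl_col a n C) = C.
Proof.
move=> sC lC; apply: line_sorted_eq; rewrite ?line_sorted_compl_col // => x.
rewrite !mem_compl_col; case xC: (x \in C); last by rewrite andbT andbN.
by rewrite andbF andbT; exact: (allP lC).
Qed.

Definition cols_in (a n : nat) (Cs : tableau) : bool :=
  all (fun C => line_sorted false C && letters_in a (a + n) C) Cs.

Lemma cols_in_dual_cols a n Cs : cols_in a n (dual_cols a n Cs).
Proof.
by rewrite /cols_in all_map; apply/allP => C _ /=;
  rewrite line_sorted_compl_col letters_in_compl_col.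
Qed.

Lemma dual_colsK a n Cs : cols_in a n Cs -> dual_cols a n (dual_cols a n Cs) = Cs.
Proof.
move=> h; rewrite /dual_cols -map_rev revK -map_comp -[RHS]map_id.
by apply/eq_in_map => C /(allP h) /andP[sC lC]; exact: compl_colK.
Qed.

Lemma shape_dual_cols a n Cs : cols_in a n Cs ->
  shape (dual_cols a n Cs) = rev [seq n - s | s <- shape Cs].
Proof.
move=> h; rewrite /shape /dual_cols !map_rev -!map_comp; congr rev.
by apply/eq_in_map => C /(allP h) /andP[sC lC] /=; rewrite -{2}(size_compl_col sC lC) addnK.
Qed.

Lemma nth_dual_cols a n Cs j : j < size Cs ->
  nth [::] (dual_cols a n Cs) j = compl_col a n (nth [::] Cs (size Cs - j.+1)).
Proof. by move=> jC; rewrite (nth_map [::]) ?size_rev // nth_rev. Qed.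

Lemma size_dual_cols a n Cs : size (dual_cols a n Cs) = size Cs.
Proof. by rewrite size_map size_rev. Qed.

Lemma tab_dual_cols a n Cs : cols_in a n Cs -> tab false Cs -> tab false (dual_cols a n Cs).
Proof.
move=> hC [_ oC]; split=> [|j].
  by apply: sub_all (cols_in_dual_cols a n Cs) => C /andP[].
have [jC|jC] := ltnP j.+1 (size Cs);
  last by rewrite (nth_default _ (_ : size _ <= j.+1)) ?size_dual_cols.
rewrite !nth_dual_cols ?(ltnW jC) // => c.
have := oC (size Cs - j.+2) c; have -> : (size Cs - j.+2).+1 = size Cs - j.+1 by lia.
have hh q : 0 < q -> q <= size Cs ->
  line_sorted false (nth [::] Cs (size Cs - q)) /\ letters_in a (a + n) (nth [::] Cs (size Cs - q)).
  by move=> q0 qC; apply/andP; apply: (allP hC); apply: mem_nth;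
    rewrite ltn_subrL q0 (leq_trans q0 qC).
have [|s1 l1] := hh j.+1 isT; first exact: ltnW.
have [|s2 l2] := hh j.+2 isT; first by [].
have := count_compl_col (fun x => x < c) s1 l1; have := count_compl_col (fun x => x < c) s2 l2.
by rewrite /= addn0; lia.
Qed.

Lemma cols_inP a n Cs : tab false Cs -> letters_in a (a + n) (cword Cs) -> cols_in a n Cs.
Proof.
move=> [/allP sC _] /allP lC; apply/allP => C CC; rewrite sC //=.
by apply/allP => x xC; apply: lC; rewrite (perm_mem (perm_cword Cs)); apply/flattenP; exists C.
Qed.

Lemma letters_in_cols_in a n Cs : cols_in a n Cs -> letters_in a (a + n) (cword Cs).
Proof.
move=> /allP h; rewrite /letters_in (perm_all _ (perm_cword Cs));
  apply/allP => x /flattenP[C CC xC].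
by have /andP[_ /allP] := h C CC; apply.
Qed.

Lemma cols_crystal_op a n o Cs : op_in a (a + n) o -> tab false Cs -> cols_in a n Cs ->
  exists Cs2, [/\ crystal_op o (cword Cs) = cword Cs2,
    crystal_op (flip_op o) (cword (dual_cols a n Cs)) = cword (dual_cols a n Cs2),
    shape Cs2 = shape Cs, tab false Cs2 & cols_in a n Cs2].
Proof.
case: o => b i /andP[/= ai ia] tC cC.
(* Since duality is an involution, [fop] on [Cs] is treated as the dual side of [eop] on the dual
   columns. *)
wlog : b Cs tC cC / b.
  case: b => [h|h]; first exact: h.
  have [Cs2 [e1 e2 e3 t2 c2]] :=
    h true _ (tab_dual_cols cC tC) (cols_in_dual_cols a n Cs) isT.
  exists (dual_cols a n Cs2); split; rewrite ?dual_colsK //.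
  - by rewrite -e2 dual_colsK.
  - by rewrite -[in RHS](dual_colsK cC) shape_dual_cols // e3 [RHS]shape_dual_cols ?cols_in_dual_cols.
  - exact: tab_dual_cols.
  - exact: cols_in_dual_cols.
case: b => // _; rewrite /crystal_op /flip_op /=.
have [e0|e0] := posnP (eps i (cword Cs)).
  exists Cs; split=> //; first exact: eop_id.
  by apply: fop_id; have [-> _] := dual_cols_sig ai ia (proj1 tC).
have [Cs2 [e1 e2 e3 t2 _]] := cols_eop ai ia tC e0.
exists Cs2; split=> //; apply: cols_inP => //; rewrite -e1.
by apply: (@letters_in_crystal_op _ _ (true, i));
  [rewrite /op_in /= ai|exact: letters_in_cols_in].
Qed.

(** [dual n k] is convertible to [dual_from 1 n k]. The first letter is a parameter because lowest
    weight words in the alphabet of a pair are also studied through their duals. *)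
Definition dual_from (a n k : nat) (T : tableau) : tableau :=
  transp n (dual_cols a n (transp k T)).

Definition boxed (a n k : nat) (T : tableau) : Prop :=
  [/\ size T = n, tab true T, line_size T 0 <= k & letters_in a (a + n) (rword T)].

Lemma crystal_eq_letters_in a b w w' : crystal_eq w w' -> letters_in a b w -> letters_in a b w'.
Proof. by move=> /crystal_eq_perm h; rewrite /letters_in (perm_all _ h). Qed.

Lemma line_size_leq n Cs : all (fun C => size C <= n) Cs -> line_size Cs 0 <= n.
Proof. by case: Cs => //= C Cs /andP[]. Qed.

Lemma cols_in_line_size a n Cs : cols_in a n Cs -> line_size Cs 0 <= n.
Proof.
move=> h; apply: line_size_leq; apply: sub_all h => C /andP[sC lC].
by have := size_compl_col sC lC; lia.
Qed.

Lemma boxed_cols a n k T : boxed a n k T ->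
  [/\ tab false (transp k T), cols_in a n (transp k T),
      crystal_eq (rword T) (cword (transp k T)) & transp n (transp k T) = T].
Proof.
move=> [sT tT kT lT]; have h := crystal_eq_rword_transp tT kT.
have t' : tab false (transp k T) by exact: (@tab_transp true).
split=> //; first by apply: cols_inP => //; apply: crystal_eq_letters_in lT.
by rewrite -sT transpK //; exact: tab_decr tT.
Qed.

Lemma cols_boxed a n k Cs : size Cs = k -> tab false Cs -> cols_in a n Cs ->
  boxed a n k (transp n Cs) /\ transp k (transp n Cs) = Cs.
Proof.
move=> sC tC cC; have hn := cols_in_line_size cC; have dC := tab_decr tC.
have e : transp k (transp n Cs) = Cs by rewrite -sC transpK.
split=> //; split; first exact: size_transp.
- exact: (@tab_transp false).
- by apply: leq_from_lt => j; rewrite transp_line_size // => /andP[_ /line_size_gt0]; rewrite sC.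
- by apply: crystal_eq_letters_in (letters_in_cols_in cC); exact: crystal_eq_cword_transp.
Qed.

Lemma boxed_dual_from a n k T : boxed a n k T ->
  boxed a n k (dual_from a n k T) /\ transp k (dual_from a n k T) = dual_cols a n (transp k T).
Proof.
move=> /boxed_cols[tC cC _ _]; apply: cols_boxed.
- by rewrite size_dual_cols size_transp.
- exact: tab_dual_cols.
- exact: cols_in_dual_cols.
Qed.

Lemma dual_fromK a n k T : boxed a n k T -> dual_from a n k (dual_from a n k T) = T.
Proof.
move=> wT; have [_ e] := boxed_dual_from wT; have [tC cC _ eT] := boxed_cols wT.
by rewrite /dual_from e dual_colsK.
Qed.

Lemma dual_from_sig a n k T i : boxed a n k T -> a <= i -> i.+1 < a + n ->
  phi i (rword (dual_from a n k T)) = eps i (rword T) /\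
  eps i (rword (dual_from a n k T)) = phi i (rword T).
Proof.
move=> wT ai ia; have [w2 e] := boxed_dual_from wT.
have [tC cC h _] := boxed_cols wT; have [_ _ h2 _] := boxed_cols w2.
rewrite (crystal_eq_phi _ h2) (crystal_eq_eps _ h2) (crystal_eq_phi _ h) (crystal_eq_eps _ h) e.
exact: dual_cols_sig (proj1 tC).
Qed.

Lemma dual_from_count a n k T x : boxed a n k T -> a <= x < a + n ->
  count_mem x (rword (dual_from a n k T)) + count_mem x (rword T) = k.
Proof.
move=> wT xn; have [w2 e] := boxed_dual_from wT.
have [tC cC h _] := boxed_cols wT; have [_ _ h2 _] := boxed_cols w2.
rewrite (seq.permP (crystal_eq_perm h2)) (seq.permP (crystal_eq_perm h)) e.
rewrite -[k in RHS](size_transp k T).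
elim: (transp k T) cC => //= C Cs IH /andP[/andP[sC lC] /IH{}IH].
rewrite dual_cols_cons cword_rcons cword_cons !count_cat !count_rev.
have := count_compl_col (pred1 x) sC lC.
by rewrite (count_uniq_mem x (iota_uniq a n)) mem_iota xn /=; lia.
Qed.

Lemma size_nth_transp m T j : j < m ->
  line_size (transp m T) j = count (fun s => j < s) (shape T).
Proof. by move=> jm; rewrite /line_size nth_transp // size_map size_filter count_map. Qed.

Lemma shape_transp m T :
  shape (transp m T) = [seq count (fun s => j < s) (shape T) | j <- iota 0 m].
Proof.
by rewrite /shape /transp -map_comp; apply: eq_map => j /=;
  rewrite size_map size_filter count_map.
Qed.

Lemma dual_from_line_size a n k T j : boxed a n k T -> j < n ->
  line_size (dual_from a n k T) j + line_size T (n - j.+1) = k.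
Proof.
move=> wT jn; have [tC cC h eT] := boxed_cols wT.
rewrite -{2}eT !size_nth_transp; [|lia|lia].
rewrite shape_dual_cols // count_rev count_map.
rewrite -[RHS](size_transp k T) -(size_map size) -(count_predC (fun s => n - j.+1 < s)) addnC.
congr addn; move: (transp k T) cC {tC h eT} => Cs cC; rewrite !count_map;
  apply: eq_in_count => C /(allP cC) /andP[sC lC] /=.
by have := size_compl_col sC lC; lia.
Qed.

Lemma crystal_op_sig o w w' : crystal_eq w w' -> crystal_op o w = w -> crystal_op o w' = w'.
Proof.
case: o => b i; rewrite /crystal_op /= => h; case: b => e.
  have [/eop_id //|p] := posnP (eps i w').
  have := @eps_phi_eop i w; rewrite e (crystal_eq_eps i h) => -[//|]; lia.
have [/fop_id //|p] := posnP (phi i w').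
have := @eps_phi_fop i w; rewrite e (crystal_eq_phi i h) => -[//|]; lia.
Qed.

(** Transports an operator from the column word to the row word: both results are crystal equivalent
    tableaux with the same number of rows, hence equal. *)
Lemma rword_crystal_op a n k o T C2 : boxed a n k T ->
  crystal_op o (cword (transp k T)) = cword C2 -> shape C2 = shape (transp k T) ->
  tab false C2 -> cols_in a n C2 ->
  crystal_op o (rword T) = rword (transp n C2).
Proof.
move=> wT e es t2 c2; have [tC cC h eT] := boxed_cols wT.
have hs : size C2 = k by rewrite (shape_size es) size_transp.
have [[sT2 tT2 _ _] _] := cols_boxed hs t2 c2.
have c2T := crystal_eq_cword_transp t2 (cols_in_line_size c2).
have [sT tT _ _] := wT.
have [eT'|eT'] := eqVneq (crystal_op o (rword T)) (rword T).
  have := crystal_op_sig h eT'; rewrite e => /cword_inj -> //.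
  by rewrite eT.
have h2 : crystal_eq (crystal_op o (rword T)) (rword (transp n C2)).
  by apply: crystal_eq_trans (crystal_eq_crystal_op o h) _; rewrite e.
case: o e eT' h2 => -[] i; rewrite /crystal_op /= => e.
  have [/eop_id -> /eqP//|e0 _ h2] := posnP (eps i (rword T)).
  have [T2 [e2 es2 t2' _]] := row_eop tT e0; rewrite e2 in h2 *; congr rword.
  apply: tab_crystal_eq_eq => //; by rewrite sT2 -sT (shape_size es2).
(* [row_eop] treats raising only, so the lowered tableau is raised again and the result recognised
   as [T]. *)
have [/fop_id -> /eqP//|p0 _ h2] := posnP (phi i (rword T)).
have [e0 _] := eps_phi_fop p0.
have [|T3 [e3 es3 t3 _]] := @row_eop i _ tT2; first by rewrite -(crystal_eq_eps i h2) e0.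
suff e4 : T3 = T.
  by rewrite -e4 -e3 eopK // -(crystal_eq_eps i h2) e0.
apply: tab_crystal_eq_eq => //.
  by rewrite sT -sT2 (shape_size es3).
rewrite -e3; apply: crystal_eq_sym; rewrite -{1}(fopK p0).
exact: (crystal_eq_crystal_op (true, i)).
Qed.

Lemma tab_crystal_op a n k o T : op_in a (a + n) o -> boxed a n k T ->
  exists T2, [/\ boxed a n k T2, shape T2 = shape T, crystal_op o (rword T) = rword T2 &
    crystal_op (flip_op o) (rword (dual_from a n k T)) = rword (dual_from a n k T2)].
Proof.
move=> ho wT; have [tC cC h eT] := boxed_cols wT.
have [C2 [e1 e2 es t2 c2]] := cols_crystal_op ho tC cC.
have hs : size C2 = k by rewrite (shape_size es) size_transp.
have [w2 e3] := cols_boxed hs t2 c2.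
exists (transp n C2); split=> //.
- by rewrite -[in RHS]eT (shape_transp n C2) es -shape_transp.
- exact: (rword_crystal_op wT).
have [wd ed] := boxed_dual_from wT.
rewrite /dual_from e3; apply: (rword_crystal_op wd); rewrite ?ed //.
- by rewrite !shape_dual_cols // es.
- exact: tab_dual_cols.
- exact: cols_in_dual_cols.
Qed.

Lemma tab_run a n k g T : all (op_in a (a + n)) g -> boxed a n k T ->
  exists T2, [/\ boxed a n k T2, shape T2 = shape T, run g (rword T) = rword T2 &
    run (map flip_op g) (rword (dual_from a n k T)) = rword (dual_from a n k T2)].
Proof.
move=> + wT; elim: g => [_|o g IH /andP[ho /IH[T1 [w1 s1 e1 d1]]]] /=; first by exists T.
have [T2 [w2 s2 e2 d2]] := tab_crystal_op ho w1.
by exists T2; rewrite s2 e1 d1.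
Qed.

Lemma line_size_cat_nil T m j : line_size (T ++ nseq m [::]) j = line_size T j.
Proof.
rewrite /line_size nth_cat; case: ltnP => // h.
by rewrite (nth_default _ h) nth_nseq if_same.
Qed.

Lemma boxed_pad a N w : letters_in a (a + N) w ->
  let P := schensted w in let T := P ++ nseq (N - size P) [::] in
  boxed a N (line_size P 0) T /\ crystal_eq w (rword T).
Proof.
move=> lw; have [t n c] := schenstedP w.
split; last by rewrite rword_pad.
split; rewrite ?line_size_cat_nil //; last by rewrite rword_pad; exact: crystal_eq_letters_in lw.
  by rewrite size_cat size_nseq subnKC // (size_schensted lw).
exact: tab_pad.
Qed.

(** * Lowest weight tableaux *)

Lemma dual_from_high a n k T : boxed a n k T ->
  (forall i, i.+1 < a + n -> phi i (rword T) = 0) ->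
  dual_from a n k T = yamanouchi a (shape (dual_from a n k T)).
Proof.
move=> wT hT; have [[_ td _ ld] _] := boxed_dual_from wT.
apply: high_yamanouchi (letters_in_leq ld) _ => // i ai.
have [ia|ia] := ltnP i.+1 (a + n); first by have [_ ->] := dual_from_sig wT ai ia; rewrite hT.
by apply: eps0; apply/negP => /(allP ld); lia.
Qed.

(** The dual is Yamanouchi, with content equal to shape. Duality complements contents letter by
    letter but complements shapes in reversed order, hence the reversed index. *)
Lemma low_count_tab a n k T j : boxed a n k T ->
  (forall i, i.+1 < a + n -> phi i (rword T) = 0) -> j < n ->
  count_mem (a + j) (rword T) = line_size T (n - j.+1).
Proof.
move=> wT hT jn; have := dual_from_high wT hT; have := dual_from_line_size wT jn.
have /(dual_from_count wT) : a <= a + j < a + n by lia.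
by move=> + + e; rewrite {1}e count_yamanouchi shapeE /=; rewrite -/(line_size _ _); lia.
Qed.

Lemma low_count a N w j : letters_in a (a + N) w ->
  (forall i, i.+1 < a + N -> phi i w = 0) -> j < N ->
  count_mem (a + j) w = line_size (schensted w) (N - j.+1).
Proof.
move=> lw hw jN; have [wT c] := boxed_pad lw.
rewrite (seq.permP (crystal_eq_perm c)) (low_count_tab wT) ?line_size_cat_nil //.
by move=> i /hw; rewrite (crystal_eq_phi i c).
Qed.

Lemma low_unique a n k T1 T2 : boxed a n k T1 -> boxed a n k T2 ->
  (forall i, i.+1 < a + n -> phi i (rword T1) = 0) ->
  (forall i, i.+1 < a + n -> phi i (rword T2) = 0) ->
  shape T1 = shape T2 -> T1 = T2.
Proof.
move=> w1 w2 h1 h2 es; rewrite -(dual_fromK w1) -(dual_fromK w2); congr dual_from.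
rewrite (dual_from_high w1 h1) (dual_from_high w2 h2); congr yamanouchi.
have [_ c1 _ _] := boxed_cols w1; have [_ c2 _ _] := boxed_cols w2.
by rewrite !shape_transp !shape_dual_cols // !shape_transp es.
Qed.

(** * Littlewood-Richardson tableaux for two rectangles *)

Lemma sig_filter (p : pred nat) i w : p i -> p i.+1 ->
  phi i (filter p w) = phi i w /\ eps i (filter p w) = eps i w.
Proof.
move=> pi pi1; elim: w => //= x w [IHp IHe]; case: ifP => px /=; first by rewrite IHp IHe.
have [h1 h2] : (x == i) = false /\ (x == i.+1) = false.
  by split; apply: contraFF px => /eqP ->.
by rewrite h1 h2 subn0 addn0.
Qed.

Lemma crystal_op_filter (p : pred nat) o w : p o.2 -> p o.2.+1 ->
  crystal_op o (filter p w) = filter p (crystal_op o w).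
Proof.
case: o => b i /= pi pi1; rewrite /crystal_op /=; case: b.
  elim: w => //= x w IH; have [hp _] := sig_filter w pi pi1.
  case: ifP => px /=.
    by rewrite hp; case: ifP => _ /=; rewrite ?pi ?px ?IH.
  have -> : (x == i.+1) = false by apply: contraFF px => /eqP ->.
  by rewrite ltn0 /= px.
elim: w => //= x w IH; have [hp _] := sig_filter w pi pi1.
case: ifP => px /=.
  rewrite hp; case: ifP => _ /=; first by rewrite px IH.
  by case: ifP => _; rewrite ?pi1 ?px.
have -> : (x == i.+1) = false by apply: contraFF px => /eqP ->.
case: ifP => h /=; first by rewrite px IH.
have -> : (x == i) = false by apply: contraFF px => /eqP ->.
by rewrite px IH fop_id //; lia.
Qed.

Lemma run_filter (p : pred nat) g w :
  all (fun o => p o.2 && p o.2.+1) g ->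
  run g (filter p w) = filter p (run g w).
Proof.
by elim: g => //= o g IH /andP[/andP[h1 h2] /IH ->]; exact: crystal_op_filter.
Qed.

(** This is the lattice condition: [eps] does not increase on passing to a final subword, and there
    its vanishing compares the two contents. *)
Lemma eps0P i w : eps i w = 0 <->
  forall j, count_mem i.+1 (drop j w) <= count_mem i (drop j w).
Proof.
split=> [e0 j|].
  have : eps i (drop j w) = 0.
    by move: e0; rewrite -{1}(cat_take_drop j w) eps_cat; lia.
  by have := phi_eps_count i (drop j w); move=> + e; rewrite e /=; lia.
elim: w => //= x w IH h.
have e0 : eps i w = 0 by apply: IH => j; exact: (h j.+1).
have := phi_eps_count i w; have := h 0; rewrite e0 /=; lia.
Qed.

Lemma latticeP a m w :
  lattice a m w <-> forall i, a <= i -> i.+1 < a + m -> eps i w = 0.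
Proof.
split=> [/allP h i ai ia|h].
  apply/eps0P => j; have [jw|jw] := ltnP j (size w); last by rewrite drop_oversize.
  have := h j; rewrite mem_iota /= => /(_ jw) /(sortedP 0) /(_ (i - a)).
  rewrite size_map size_iota => /(_ ltac:(lia)) /=.
  rewrite !(nth_map 0) ?size_iota ?nth_iota; try lia.
  by rewrite addnS subnKC.
apply/allP => j _; apply/(sortedP 0) => i; rewrite size_map size_iota => im.
rewrite !(nth_map 0) ?size_iota ?nth_iota ?(ltnW im) //= addnS.
have /eps0P e : eps (a + i) w = 0 by apply: h; lia.
exact: e.
Qed.

Lemma word_restr a m T :
  word (restr a m T) = [seq x <- rword T | a <= x < a + m].
Proof.
by rewrite /word /restr /rword filter_flatten map_rev -map_comp.
Qed.

Definition rect_word (b m c : nat) (w : seq nat) : Prop :=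
  (forall x, b <= x < b + m -> count_mem x w = c) /\
  (forall i, b <= i -> i.+1 < b + m -> eps i w = 0).

Lemma rect_word_crystal_eq b m c w w' : crystal_eq w w' -> rect_word b m c w ->
  rect_word b m c w'.
Proof.
move=> h [h1 h2]; split=> [x /h1 <-|i bi ib]; first by rewrite (seq.permP (crystal_eq_perm h)).
by rewrite -(crystal_eq_eps i h) h2.
Qed.

Lemma rect_word_phi b m c w i : rect_word b m c w -> b <= i -> i.+1 < b + m -> phi i w = 0.
Proof.
move=> [h1 h2] bi ib; have := phi_eps_count i w.
by rewrite h2 // !h1 //; lia.
Qed.

Lemma rect_word_filter b m c (p : pred nat) w : (forall x, b <= x < b + m -> p x) ->
  rect_word b m c (filter p w) <-> rect_word b m c w.
Proof.
move=> hp.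
have hc x : b <= x < b + m -> count_mem x (filter p w) = count_mem x w.
  move=> hx; rewrite count_filter; apply: eq_in_count => y _ /=.
  by case: eqP => //= ->; rewrite hp.
have he i : b <= i -> i.+1 < b + m -> eps i (filter p w) = eps i w.
  move=> bi ib; have pi : p i by apply: hp; lia.
  have pi1 : p i.+1 by apply: hp; lia.
  by have [_ ->] := sig_filter w pi pi1.
split=> -[h1 h2]; split=> [x hx|i bi ib].
- by rewrite -hc // h1.
- by rewrite -he // h2.
- by rewrite hc // h1.
- by rewrite he // h2.
Qed.

Lemma colstrictP T : decr T -> colstrict (straight T) <-> tab true T.
Proof.
move=> dT; rewrite /colstrict /straight all_map pairwise_map.
have eS : all (preim (fun r => (0, r)) (fun r : nat * seq nat => sorted leq r.2)) T = all (line_sorted true) T.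
  by apply: eq_all => r; rewrite row_sortedE.
rewrite eS; split=> [/andP[sT pT]|tT].
  have sn i : line_sorted true (nth [::] T i).
    have [iT|iT] := ltnP i (size T); last by rewrite nth_default.
    by have /allP := sT; apply; exact: mem_nth.
  split=> // i; apply/line_leP => //; split; first exact: dT.
  move=> c ci; have iT := line_size_gt0 ci.
  have /(pairwiseP [::]) h := pT; have := h i i.+1 (ltnW iT) iT (ltnSn i).
  rewrite /relpre /= /row_above => /allP /(_ c).
  rewrite mem_iota /in_row /entry /= !add0n subn0 ci (leq_trans ci) ?dT //.
  by rewrite addn1; exact.
have [sT _] := tT; rewrite sT /=; have [_ _ h3] := proj1 (tabP _ _) tT.
have hc i j c : i < j -> c < line_size T j -> entry_at T i c < entry_at T j c.
  elim: j => // j IH; rewrite ltnS leq_eqVlt => /predU1P[->|ij] cj.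
    by have := h3 j c cj; rewrite addn1.
  have cj' := leq_trans cj (dT j).
  by apply: ltn_trans (IH ij cj') _; have := h3 j c cj; rewrite addn1.
apply/(pairwiseP [::]) => i j iT jT ij; apply/allP => c _; apply/implyP.
rewrite /in_row /entry /= !add0n subn0 => /andP[_ cj].
exact: hc.
Qed.

Lemma row_split a b r : a <= b -> line_sorted true r ->
  r = [seq x <- r | x < a] ++ [seq x <- r | a <= x < b] ++ [seq x <- r | b <= x].
Proof.
move=> ab; elim: r => // x r IH; rewrite line_sorted_cons => /andP[/allP xr /IH{}IH] /=.
have xr' y : y \in r -> x <= y by move=> /xr /=; rewrite addn1.
have F (p : pred nat) : (forall y, x <= y -> ~~ p y) -> filter p r = [::].
  move=> h; apply/eqP; rewrite -size_eq0 size_filter -leqn0 leqNgt -has_count.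
  by apply/hasPn => y /xr' /h.
case: (ltnP x a) => xa /=.
  by rewrite leqNgt (leq_trans xa ab) /= -IH.
rewrite (F (fun y => y < a)) /= in IH *; last by move=> y; lia.
case: (ltnP x b) => xb /=; first by rewrite -IH.
rewrite (F (fun y => a <= y < b)) /= in IH *; last by move=> y; lia.
by rewrite -IH.
Qed.

Lemma row_split2 b r : line_sorted true r -> r = [seq x <- r | x < b] ++ [seq x <- r | b <= x].
Proof.
move=> /(row_split (leqnn b)) {1}->; congr cat; rewrite -[RHS]cat0s; congr cat.
by rewrite -[RHS](filter_pred0 r); apply: eq_filter => x /=; lia.
Qed.

Lemma nth_map_nil (f : seq nat -> seq nat) T j : f [::] = [::] ->
  nth [::] (map f T) j = f (nth [::] T j).
Proof.
move=> f0; have [jT|jT] := ltnP j (size T); first by rewrite (nth_map [::]).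
by rewrite !nth_default ?size_map.
Qed.

Lemma rword_filter p T : rword [seq filter p r | r <- T] = filter p (rword T).
Proof. by rewrite /rword filter_flatten map_rev. Qed.

Lemma rword_cat T U : rword (T ++ U) = rword U ++ rword T.
Proof. by rewrite /rword rev_cat flatten_cat. Qed.

Lemma nth_yamanouchi a sh j : nth [::] (yamanouchi a sh) j = nseq (nth 0 sh j) (a + j).
Proof.
elim: sh a j => [|s sh IH] a [|j] //=; first by rewrite addn0.
by rewrite IH addSnnS.
Qed.

Lemma tab_filter_lt b T : tab true T -> tab true [seq [seq x <- r | x < b] | r <- T].
Proof.
move=> [sT oT]; split=> [|j].
  by rewrite all_map; apply: sub_all sT => r; exact: line_sorted_filter.
rewrite !(nth_map_nil (f := filter _)) // => c; rewrite !count_filter.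
have [cb|bc] := leqP c b.
  have := oT j c; set n1 := count _ _ => h; apply: leq_trans (sub_count _ _) (leq_trans h _);
    first by move=> x /=; case/andP.
  by apply: sub_count => x /= xc; rewrite xc (leq_trans xc).
(* Beyond the cut-off all thresholds count the same letters of the lower row, so the inequality at
   the predecessor of the cut-off suffices. *)
case: b bc => [|b] bc.
  rewrite (eq_count (a2 := pred0)) ?count_pred0 // => x /=; lia.
have := oT j b; set n1 := count _ _ => h; apply: leq_trans (sub_count _ _) (leq_trans h _).
  by move=> x /= ; lia.
by apply: sub_count => x /=; lia.
Qed.

Lemma schensted_line_size T j : tab true T -> line_size (schensted (rword T)) j = line_size T j.
Proof.
move=> tT; have [t n c] := schenstedP (rword T).
have e : T ++ nseq (size (schensted (rword T))) [::] = schensted (rword T) ++ nseq (size T) [::].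
  apply: tab_crystal_eq_eq; rewrite ?rword_pad //; try exact: tab_pad.
  by rewrite !size_cat !size_nseq addnC.
by rewrite -(line_size_cat_nil T (size (schensted (rword T)))) e line_size_cat_nil.
Qed.

Lemma line_size_shape T1 T2 j : shape T1 = shape T2 -> line_size T1 j = line_size T2 j.
Proof. by move=> h; rewrite -!shapeE h. Qed.

Lemma nonnil_shape T1 T2 : nonnil T1 -> nonnil T2 ->
  (forall j, line_size T1 j = line_size T2 j) -> shape T1 = shape T2.
Proof.
move=> n1 n2 h; have hlt U j : nonnil U -> (j < size U) = (0 < line_size U j).
  move=> nU; apply/idP/idP => [jU|]; last exact: line_size_gt0.
  exact: (allP nU _ (mem_nth [::] jU)).
apply: (@eq_from_nth _ 0); last by move=> j _; rewrite !shapeE.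
rewrite !size_map; apply/eqP; rewrite eqn_leq; apply/andP.
by split; apply: leq_from_lt => j; rewrite !hlt // h.
Qed.

Lemma low_schensted_unique a N w1 w2 : letters_in a (a + N) w1 -> letters_in a (a + N) w2 ->
  (forall i, i.+1 < a + N -> phi i w1 = 0) ->
  (forall i, i.+1 < a + N -> phi i w2 = 0) ->
  (forall j, line_size (schensted w1) j = line_size (schensted w2) j) -> crystal_eq w1 w2.
Proof.
move=> l1 l2 h1 h2 hs; have [W1 c1] := boxed_pad l1; have [W2 c2] := boxed_pad l2.
have [_ n1 _] := schenstedP w1; have [_ n2 _] := schenstedP w2.
have es := nonnil_shape n1 n2 hs; have ez := shape_size es.
rewrite -hs in W2; apply: (crystal_eq_trans c1); apply: crystal_eq_sym;
  apply: (crystal_eq_trans c2).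
rewrite (low_unique W2 W1); first exact: crystal_eq_refl.
- by move=> i /h2; rewrite (crystal_eq_phi i c2).
- by move=> i /h1; rewrite (crystal_eq_phi i c1).
- by rewrite /shape !map_cat -!/(shape _) es ez.
Qed.

Definition pair_word_ok (a m1 c1 m2 c2 : nat) (w : seq nat) : Prop :=
  [/\ rect_word a m1 c1 w, rect_word (a + m1) m2 c2 w & letters_in a (a + (m1 + m2)) w].

(* The letters of the second rectangle form, in the first [m1] rows, a highest weight
   tableau, and below them a lowest weight tableau whose shape is complementary. *)
Lemma pair_structure a m1 c1 m2 c2 T : tab true T ->
  pair_word_ok a m1 c1 m2 c2 (rword T) ->
  let b := a + m1 in
  let top := take m1 [seq [seq x <- r | b <= x] | r <- T] in
  [/\ forall j, [seq x <- nth [::] T j | x < b] = if j < m1 then nseq c1 (a + j) else [::],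
      top = yamanouchi b (shape top),
      tab true (drop m1 T) /\ letters_in b (b + m2) (rword (drop m1 T)),
      forall i, i.+1 < b + m2 -> phi i (rword (drop m1 T)) = 0 &
      forall j, if j < m2 then line_size top j + line_size (drop m1 T) (m2 - j.+1) = c2
                else line_size top j = 0].
Proof.
move=> tT [[r11 r12] r2 lT] b top; have [r21 r22] := r2.
(* The letters of the first rectangle form a Yamanouchi tableau; its content is its shape, so it is
   the rectangle itself, at the left of the first [m1] rows. *)
set P1 := [seq [seq x <- r | x < b] | r <- T].
have tP1 : tab true P1 by exact: tab_filter_lt.
have hP1 : P1 = yamanouchi a (shape P1).
  apply: high_yamanouchi => //.
    by rewrite rword_filter; apply/allP => x; rewrite mem_filter => /andP[_ /(allP lT)] /andP[].
  move=> i ai; rewrite rword_filter; have [ib|ib] := ltnP i.+1 b.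
    have [_ ->] := @sig_filter (fun x => x < b) i (rword T) (ltnW ib) ib.
    exact: r12.
  by apply: eps0; rewrite mem_filter ltnNge ib.
have S1 j : [seq x <- nth [::] T j | x < b] = if j < m1 then nseq c1 (a + j) else [::].
  have -> : [seq x <- nth [::] T j | x < b] = nth [::] P1 j
    by rewrite (nth_map_nil (f := filter _)).
  rewrite hP1 nth_yamanouchi -(count_yamanouchi a) -hP1 rword_filter count_filter.
  case: ifP => jm.
    congr nseq; rewrite -(r11 (a + j)); last by lia.
    apply: eq_in_count => x _ /=; case: eqP => //= ->; rewrite /b; lia.
  rewrite (eq_count (a2 := pred0)) ?count_pred0 // => x /=; case: eqP => //= ->; rewrite /b; lia.
have sn j : line_sorted true (nth [::] T j).
  have [jT|jT] := ltnP j (size T); last by rewrite nth_default.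
  by have [/allP h _] := tT; apply: h; exact: mem_nth.
have rs j := row_split2 b (sn j).
set P2 := [seq [seq x <- r | b <= x] | r <- T] in top *.
have nP2 j : nth [::] P2 j = [seq x <- nth [::] T j | b <= x].
  by rewrite (nth_map_nil (f := filter _)).
have ntop j : j < m1 -> nth [::] top j = [seq x <- nth [::] T j | b <= x].
  by move=> jm; rewrite nth_take.
have top_default j : m1 <= j -> nth [::] top j = [::].
  by move=> jm; rewrite nth_default // size_take_min; lia.
have dP2 : drop m1 P2 = drop m1 T.
  apply: (@eq_from_nth _ [::]); first by rewrite !size_drop size_map.
  move=> j _; rewrite !nth_drop nP2 [RHS]rs S1.
  by rewrite ltnNge leq_addr.
(* In this concatenation vanishing [eps] passes to the right factor and vanishing [phi] to the left
   one: the top is of highest weight, the bottom of lowest weight. *)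
have hr : [seq x <- rword T | b <= x] = rword (drop m1 T) ++ rword top.
  by rewrite -rword_filter -/P2 -{1}(cat_take_drop m1 P2) rword_cat dP2.
have tbot : tab true (drop m1 T).
  split=> [|j]; last by rewrite !nth_drop addnS; have [_ h] := tT; exact: h.
  by have [/allP h _] := tT; apply/allP => r /mem_drop /h.
have lr : letters_in b (b + m2) (rword (drop m1 T) ++ rword top).
  rewrite -hr; apply/allP => x; rewrite mem_filter => /andP[bx /(allP lT)].
  by rewrite /b in bx *; lia.
have ttop : tab true top.
  split=> [|j].
    apply/(all_nthP [::]) => j jt; have jm : j < m1 by move: jt; rewrite size_take_min; lia.
    by rewrite ntop //; apply: line_sorted_filter.
  have [jm|jm] := ltnP j.+1 m1; last by rewrite (top_default _ jm); exact: line_le_nil.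
  rewrite !ntop ?(ltnW jm) // => c; have [_ /(_ j c)] := tT.
  have [cb|bc] := ltnP c b.
    move=> _; rewrite count_filter (eq_count (a2 := pred0)) ?count_pred0 // => x /=; lia.
  have cs p q : count p (nth [::] T q) = count p (if q < m1 then nseq c1 (a + q) else [::]) +
      count p [seq x <- nth [::] T q | b <= x] by rewrite -S1 -count_cat -rs.
  rewrite !cs jm (ltnW jm) !count_nseq /=.
  have -> : a + j < c by rewrite /b in bc; lia.
  have -> : a + j.+1 < c + true by rewrite /b /= in bc *; lia.
  by rewrite leq_add2l.
have rr : rect_word b m2 c2 (rword (drop m1 T) ++ rword top).
  by rewrite -hr; apply/rect_word_filter => // x /andP[].
have [rr1 rr2] := rr.
have htop : top = yamanouchi b (shape top).
  apply: high_yamanouchi => //.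
    by apply/allP => x xt;
      have /(allP lr)/andP[] : x \in rword (drop m1 T) ++ rword top by rewrite mem_cat xt orbT.
  move=> i bi; have [ib|ib] := ltnP i.+1 (b + m2).
    by have := rr2 i bi ib; rewrite eps_cat; lia.
  apply: eps0; apply/negP => it.
  have /(allP lr) : i.+1 \in rword (drop m1 T) ++ rword top by rewrite mem_cat it orbT.
  by lia.
have lbot : letters_in b (b + m2) (rword (drop m1 T)).
  by move: lr; rewrite /letters_in all_cat => /andP[].
have hbot i : i.+1 < b + m2 -> phi i (rword (drop m1 T)) = 0.
  move=> ib; have [bi|ib'] := leqP b i.
    by have := rect_word_phi rr bi ib; rewrite phi_cat; lia.
  by apply: phi0; apply/negP => /(allP lbot); lia.
split=> // j; case: ltnP => jm; last first.
  rewrite -shapeE -(count_yamanouchi b) -htop count0_notin //; apply/negP => jt.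
  have /(allP lr) : b + j \in rword (drop m1 T) ++ rword top by rewrite mem_cat jt orbT.
  by lia.
(* The [c2] letters [b + j] are counted by row [j] of the top and, since a lowest weight content is
   the reversed shape, by row [m2 - j.+1] of the bottom. *)
have := rr1 (b + j); rewrite count_cat {1}htop count_yamanouchi shapeE.
rewrite (low_count lbot hbot jm) schensted_line_size //.
by move=> h; rewrite addnC h //; lia.
Qed.

(** The shape fixes the lowest weight tableau below row [m1] and, once the first rectangle is
    removed, the row lengths of the Yamanouchi tableau above. *)
Lemma pair_unique a m1 c1 m2 c2 T T' : tab true T -> tab true T' ->
  pair_word_ok a m1 c1 m2 c2 (rword T) -> pair_word_ok a m1 c1 m2 c2 (rword T') ->
  shape T = shape T' -> T = T'.
Proof.
move=> tT tT' pT pT' es; have hs := shape_size es.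
have [S1 St [tb lb] lob _] := pair_structure tT pT.
have [S1' St' [tb' lb'] lob' _] := pair_structure tT' pT'.
set b := a + m1 in S1 St tb lb lob S1' St' tb' lb' lob' *.
have sn U j : tab true U -> line_sorted true (nth [::] U j).
  move=> [/allP h _]; have [jT|jT] := ltnP j (size U); last by rewrite nth_default.
  by apply: h; exact: mem_nth.
have ebot : drop m1 T = drop m1 T'.
  apply: tab_crystal_eq_eq => //; first by rewrite !size_drop hs.
  apply: low_schensted_unique lb lb' lob lob' _ => j; rewrite !schensted_line_size //.
  by rewrite /line_size !nth_drop; exact: line_size_shape.
have esz j : size [seq x <- nth [::] T j | b <= x] = size [seq x <- nth [::] T' j | b <= x].
  have := line_size_shape j es; rewrite /line_size {1}(row_split2 b (sn _ j tT)).
  by rewrite {1}(row_split2 b (sn _ j tT')) !size_cat S1 S1' => /addnI.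
have etop : take m1 [seq [seq x <- r | b <= x] | r <- T] =
            take m1 [seq [seq x <- r | b <= x] | r <- T'].
  rewrite St St'; congr yamanouchi; rewrite -!map_take /shape -!map_comp.
  apply: (@eq_from_nth _ 0); first by rewrite !size_map !size_take hs.
  move=> j; rewrite size_map => jT.
  rewrite !(nth_map [::]) /=; try by move: jT; rewrite !size_take hs.
  have jm : j < m1 by move: jT; rewrite size_take_min; lia.
  by rewrite !nth_take.
apply: (@eq_from_nth _ [::]) => // j jT.
have [jm|jm] := ltnP j m1; last first.
  by have := congr1 (fun U => nth [::] U (j - m1)) ebot; rewrite !nth_drop subnKC.
rewrite (row_split2 b (sn T j tT)) (row_split2 b (sn T' j tT')) S1 S1'.
congr cat; have := congr1 (fun U => nth [::] U j) etop.
by rewrite !nth_take // !(nth_map [::]) // -hs.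
Qed.

Lemma sum_support m m' (g : nat -> nat) :
  (forall j, m <= j -> g j = 0) -> (forall j, m' <= j -> g j = 0) ->
  \sum_(j < m) g j = \sum_(j < m') g j.
Proof.
move=> h h'; rewrite (big_ord_widen (m + m')) ?leq_addr //.
rewrite [RHS](big_ord_widen (m + m')) ?leq_addl // big_mkcond [RHS]big_mkcond.
by apply: eq_bigr => j _; case: ltnP => [_|/h ->]; case: ltnP => // /h' ->.
Qed.

(** Let [s_j] be the row lengths of the top tableau of the second rectangle. The first [m1] rows
    have length [c1 + s_j] and the next [m2] rows, in reversed order, [c2 - s_j]. Excess over the
    maximum occurs only in the former, deficit from the minimum only in the latter, and both equal
    the truncated [s_j - (c2 - c1)]. The right side runs backwards to match the row order of the
    dual. *)
Lemma pair_overhang a m1 c1 m2 c2 T : tab true T ->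
  pair_word_ok a m1 c1 m2 c2 (rword T) ->
  \sum_(j < m1 + m2) (line_size T j - maxn c1 c2) =
  \sum_(j < m1 + m2) (minn c1 c2 - line_size T (m1 + m2 - j.+1)).
Proof.
move=> tT pT; have [S1 _ _ _ S5] := pair_structure tT pT.
set top := take _ _ in S5.
have hs j : j < m1 -> line_size T j = c1 + line_size top j.
  move=> jm; have sn : line_sorted true (nth [::] T j).
    have [/allP h _] := tT; have [jT|jT] := ltnP j (size T); last by rewrite nth_default.
    by apply: h; exact: mem_nth.
  rewrite /line_size nth_take // (nth_map_nil (f := filter _)) //.
  by rewrite {1}(row_split2 (a + m1) sn) size_cat S1 jm size_nseq.
have hd j : line_size T (m1 + j) = line_size (drop m1 T) j by rewrite /line_size nth_drop.
have eR : \sum_(j < m1 + m2) (minn c1 c2 - line_size T (m1 + m2 - j.+1)) =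
          \sum_(j < m1 + m2) (minn c1 c2 - line_size T j).
  by rewrite [RHS](reindex_inj rev_ord_inj).
have h1 j : m1 <= j -> line_size top j = 0.
  by move=> jm; rewrite /line_size nth_default // size_take_min; lia.
have h2 j : m2 <= j -> line_size top j = 0 by have := S5 j; case: ltnP.
have h12 j : j < m2 -> line_size top j <= c2 by have := S5 j; case: ltnP => // _ + _; lia.
rewrite eR !big_split_ord /= [X in _ + X = _]big1 ?addn0; last first.
  move=> j _; have := S5 (m2 - j.+1); rewrite hd.
  have -> : m2 - (m2 - j.+1).+1 = j by have := ltn_ord j; lia.
  by case: ifP => jm; have := ltn_ord j; lia.
rewrite [X in _ = X + _]big1 ?add0n; last by move=> j _; rewrite hs //; lia.
rewrite [RHS](reindex_inj rev_ord_inj) /=.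
transitivity (\sum_(j < m1) (line_size top j - (c2 - c1))).
  by apply: eq_bigr => j _; rewrite hs //; lia.
rewrite (@sum_support m1 m2 (fun j => line_size top j - (c2 - c1))).
- apply: eq_bigr => j _; rewrite hd.
  by have := S5 j; have := h12 j (ltn_ord j); rewrite ltn_ord; lia.
- by move=> j /h1 ->.
- by move=> j /h2 ->.
Qed.

(* The Schuetzenberger involution on words; it exchanges [eop] and [fop]. *)
Definition reversal (a N : nat) (w : seq nat) : seq nat :=
  rev [seq a + a + N - 1 - x | x <- w].

(** The reflection [x -> a + a + N - 1 - x] of the alphabet sends the pair [i], [i.+1] to [j.+1],
    [j] with [j = a + a + N - 2 - i]. *)
Definition reversal_op (a N : nat) (o : bool * nat) : bool * nat :=
  (~~ o.1, a + a + N - 2 - o.2).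

Lemma reversal_cons a N x w : reversal a N (x :: w) = reversal a N w ++ [:: a + a + N - 1 - x].
Proof. by rewrite /reversal /= rev_cons -cats1. Qed.

Lemma letters_in_reversal a N w : letters_in a (a + N) w -> letters_in a (a + N) (reversal a N w).
Proof.
move=> /allP lw; apply/allP => x; rewrite mem_rev => /mapP[y /lw /= hy ->].
by lia.
Qed.

Lemma count_reversal a N w x : letters_in a (a + N) w -> a <= x < a + N ->
  count_mem x (reversal a N w) = count_mem (a + a + N - 1 - x) w.
Proof.
move=> /allP lw hx; rewrite count_rev count_map; apply: eq_in_count => y /lw hy /=.
by apply/eqP/eqP; move: hy; lia.
Qed.

Lemma sig_reversal a N w i : letters_in a (a + N) w -> a <= i -> i.+1 < a + N ->
  phi i (reversal a N w) = eps (a + a + N - 2 - i) w /\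
  eps i (reversal a N w) = phi (a + a + N - 2 - i) w.
Proof.
move=> lw ai ia; elim: w lw => // x w IH /= /andP[lx /IH[hp he]].
have e1 : (a + a + N - 1 - x == i) = (x == (a + a + N - 2 - i).+1) by lia.
have e2 : (a + a + N - 1 - x == i.+1) = (x == a + a + N - 2 - i) by lia.
by rewrite reversal_cons phi_cat eps_cat hp he /= e1 e2 !sub0n !subn0 !addn0 !add0n; split; lia.
Qed.

Lemma crystal_op_reversal a N w o : letters_in a (a + N) w -> op_in a (a + N) o ->
  crystal_op o (reversal a N w) = reversal a N (crystal_op (reversal_op a N o) w).
Proof.
case: o => b i; rewrite /op_in /crystal_op /reversal_op /= => + /andP[ai ia].
elim: w => [|x w IH] /=; first by case: b.
move=> /andP[lx lw]; have [hp he] := sig_reversal lw ai ia.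
have e1 : (a + a + N - 1 - x == i) = (x == (a + a + N - 2 - i).+1) by lia.
have e2 : (a + a + N - 1 - x == i.+1) = (x == a + a + N - 2 - i) by lia.
case: b IH => /= /(_ lw) IH.
  rewrite !reversal_cons eop_cat IH he /= e1 e2 sub0n addn0.
  case: ifP => _; rewrite reversal_cons //; congr (_ ++ _).
  by case: eqP => [->|_] //=; congr cons; lia.
rewrite !reversal_cons fop_cat IH he /= e1 e2 sub0n addn0.
case: ifP => h; rewrite reversal_cons //; congr (_ ++ _).
by case: eqP h => [ex h|_]; [congr cons; lia|rewrite ltn0].
Qed.

Lemma run_reversal a N g w : letters_in a (a + N) w -> all (op_in a (a + N)) g ->
  run (map (reversal_op a N) g) (reversal a N w) = reversal a N (run g w).
Proof.
move=> lw; elim: g => //= o g IH /andP[ho hg].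
have hb : op_in a (a + N) (reversal_op a N o) by move: ho; rewrite /op_in /reversal_op /=; lia.
rewrite IH // crystal_op_reversal ?(letters_in_run hg) //; congr (reversal _ _ (crystal_op _ _)).
by case: o ho {IH hb} => b i; rewrite /op_in /reversal_op /= negbK => h; congr pair; lia.
Qed.

(* The reversal exchanges highest and lowest weight words, whose contents are the shape and
   the reversed shape. *)
Lemma shape_schensted_reversal a N w : letters_in a (a + N) w ->
  shape (schensted (reversal a N w)) = shape (schensted w).
Proof.
move=> lw; have lb := letters_in_reversal lw.
have [_ n1 _] := schenstedP (reversal a N w); have [_ n2 _] := schenstedP w.
apply: nonnil_shape => // j.
have [jN|jN] := leqP N j.
  by rewrite /line_size !nth_default ?(leq_trans (size_schensted lw) jN) ?(leq_trans (size_schensted lb) jN).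
have [g [hg hl]] := lower lw.
have lg := letters_in_run hg lw; have lbg := letters_in_reversal lg.
rewrite -(line_size_schensted_run (map (reversal_op a N) g)) run_reversal //.
rewrite -(high_count (a := a)); last 2 first.
- exact: letters_in_leq lbg.
- move=> i ai; have [ia|ia] := ltnP i.+1 (a + N).
    by have [_ ->] := sig_reversal lg ai ia; apply: hl; lia.
  by apply: eps0; apply/negP => /(allP lbg); lia.
rewrite count_reversal //; last by lia.
have -> : a + a + N - 1 - (a + j) = a + (N - j.+1) by lia.
rewrite (low_count lg hl) ?line_size_schensted_run; last by lia.
by congr line_size; lia.
Qed.

Lemma pair_word_ok_crystal_eq a m1 c1 m2 c2 w w' : crystal_eq w w' ->
  pair_word_ok a m1 c1 m2 c2 w -> pair_word_ok a m1 c1 m2 c2 w'.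
Proof.
by move=> h [r1 r2 l]; split;
  [exact: rect_word_crystal_eq r1|exact: rect_word_crystal_eq r2|exact: crystal_eq_letters_in l].
Qed.

(** Reversal turns the conditions on [eps] into conditions on [phi], which hold because the content
    of a rectangle is constant. *)
Lemma pair_word_ok_reversal a m1 c1 m2 c2 w : pair_word_ok a m1 c1 m2 c2 w ->
  pair_word_ok a m2 c2 m1 c1 (reversal a (m1 + m2) w).
Proof.
move=> [r1 r2 lw]; split; last by rewrite (addnC m2); exact: letters_in_reversal.
- split=> [x hx|i ai ia].
    by rewrite count_reversal //; first (case: r2 => -> //); lia.
  have [|_ ->] := sig_reversal lw ai; first by lia.
  by apply: (rect_word_phi r2); lia.
- split=> [x hx|i ai ia].
    by rewrite count_reversal //; first (case: r1 => -> //); lia.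
  have [||_ ->] := @sig_reversal a (m1 + m2) w i lw; [lia|lia|].
  by apply: (rect_word_phi r1); lia.
Qed.

Lemma pair_swap a m1 c1 m2 c2 T : tab true T -> nonnil T ->
  pair_word_ok a m1 c1 m2 c2 (rword T) ->
  exists T', [/\ tab true T', nonnil T', shape T' = shape T &
    pair_word_ok a m2 c2 m1 c1 (rword T')].
Proof.
move=> tT nT pT; exists (schensted (reversal a (m1 + m2) (rword T))).
have [t n c] := schenstedP (reversal a (m1 + m2) (rword T)).
split=> //; last by apply: pair_word_ok_crystal_eq c _; exact: pair_word_ok_reversal.
by rewrite shape_schensted_reversal ?schensted_tab //; case: pT.
Qed.

(** * Injectivity of column insertion *)

(** In the new column the inserted letter is the last one that is at most [y], which determines its
    position. *)
Lemma bump_col_inj l1 l2 x1 x2 y l' : line_sorted false l1 -> line_sorted false l2 ->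
  Defs.bump leq x1 l1 = (Some y, l') -> Defs.bump leq x2 l2 = (Some y, l') ->
  x1 = x2 /\ l1 = l2.
Proof.
have key u1 x v1 u2 z v2 : line_sorted false (u1 ++ y :: v1) -> z <= y ->
    u1 ++ x :: v1 = u2 ++ z :: v2 -> size u2 <= size u1.
  rewrite line_sorted_cat line_sorted_cons => /and3P[_ _ /andP[/allP yv _]] zy e.
  rewrite leqNgt; apply/negP => h.
  have hz : nth 0 (u1 ++ x :: v1) (size u2) = z by rewrite e nth_cat ltnn subnn.
  have hs : size u2 < size (u1 ++ x :: v1) by rewrite e size_cat /=; lia.
  have : z \in v1.
    rewrite -hz nth_cat ltnNge (ltnW h) /=.
    have -> : size u2 - size u1 = (size u2 - size u1).-1.+1 by lia.
    by apply: mem_nth; move: hs; rewrite size_cat /=; lia.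
  by move=> /yv /=; lia.
move=> s1 s2; case: (@bumpP false) => // u1 y1 v1 e1 _ h1 [ey1 <-]; subst y1.
case: (@bumpP false) => // u2 y2 v2 e2 _ h2 [ey e]; subst y2.
rewrite e1 in s1 *; rewrite e2 in s2 *; rewrite addn0 in h1; rewrite addn0 in h2.
have hs : size u1 = size u2.
  apply/eqP; rewrite eqn_leq (key _ _ _ _ _ _ s2 h1 e).
  exact: (key _ _ _ _ _ _ s1 h2 (esym e)).
by move/eqP: e; rewrite eqseq_cat // eqseq_cons => /and3P[/eqP -> /eqP -> /eqP ->].
Qed.

(** Nonempty columns make it visible whether the last letter opened a new column or joined an old
    one. *)
Lemma insert_col_inj x1 x2 T1 T2 T j :
  all (line_sorted false) T1 -> all (line_sorted false) T2 -> nonnil T1 -> nonnil T2 ->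
  insert leq x1 T1 = (T, j) -> insert leq x2 T2 = (T, j) -> x1 = x2 /\ T1 = T2.
Proof.
elim: T1 x1 x2 T2 T j => [|l1 T1 IH] x1 x2 [|l2 T2] T j //=.
- by move=> _ _ _ _ [<- <-] [].
- move=> _ _ _ /andP[n2 _] [<- <-]; case: (@bumpP false) => [_|u y v _ _ _].
    by case=> /(congr1 size); rewrite size_rcons; move: n2; case: size.
  by case: (insert _ _ _).
- move=> _ _ /andP[n1 _] _ + [ eT ej]; rewrite -eT -ej; case: (@bumpP false) => [_|u y v _ _ _].
    by case=> /(congr1 size); rewrite size_rcons; move: n1; case: size.
  by case: (insert _ _ _).
move=> /andP[s1 sT1] /andP[s2 sT2] /andP[n1 nT1] /andP[n2 nT2].
have := @bump_col_inj l1 l2 x1 x2; have := @bumpP false x1 l1; have := @bumpP false x2 l2.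
case: (Defs.bump leq x1 l1) => -[y1|] l1'; case: (Defs.bump leq x2 l2) => -[y2|] l2' b2 b1 hb.
- case e1: (insert _ _ _) => [T1' j1] [<- <-].
  case e2: (insert _ _ _) => [T2' j2] [el eT ej].
  rewrite eT ej in e2; have [ey eT'] := IH _ _ _ _ _ sT1 sT2 nT1 nT2 e1 e2.
  by have [-> ->] := hb y1 l1' s1 s2 erefl (congr2 pair (congr1 Some (esym ey)) el); rewrite eT'.
- by case: (insert _ _ _) => [T1' j1] [<- <-] [].
- by move=> [<- <-]; case: (insert _ _ _).
- inversion b1; inversion b2; subst => -[<- <-] [] /rcons_inj[-> ->] ->.
  by [].
Qed.

Lemma shape_set_nth (Q : tableau) j x :
  shape (set_nth [::] Q j (rcons (nth [::] Q j) x)) = incr_nth (shape Q) j.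
Proof.
apply: (@eq_from_nth _ 0).
  by rewrite size_map size_set_nth size_incr_nth size_map /maxn;
    case: (ltngtP j (size Q)) => h; case: ltngtP; lia.
move=> i _; rewrite shapeE nth_incr_nth shapeE /line_size nth_set_nth /=.
by case: eqP => [->|]; rewrite ?eqxx ?size_rcons // eq_sym => /eqP/negbTE ->.
Qed.

Lemma all_nth_lines (p : pred nat) (Q : tableau) :
  all p (flatten Q) <-> forall i, all p (nth [::] Q i).
Proof.
split=> [/allP h i|h].
  apply/allP => x xi; apply: h; apply/flattenP; exists (nth [::] Q i) => //.
  by apply: mem_nth; case: ltnP xi => // /(nth_default [::]) ->.
by apply/allP => x /flattenP[r /(nthP [::])[i _ <-]]; exact: (allP (h i)).
Qed.

Lemma sumn_incr_nth (s : seq nat) j : sumn (incr_nth s j) = (sumn s).+1.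
Proof.
elim: s j => [|n s IH] [|j] //=; last by rewrite IH addnS.
by elim: j.
Qed.

Lemma recording_spec w : let: (P, Q) := column_insertion_cols w in
  [/\ shape Q = shape P, size (flatten Q) = size w &
      all (fun x => x <= size w) (flatten Q)].
Proof.
elim: w => //= x w; have [tP nP _] := col_insP w.
case: (column_insertion_cols w) tP nP => P Q /= tP nP [es ez lQ].
have := @shape_insert false x P; rewrite /lerel.
case: (insert _ _ _) => P' j /= eP'.
have eQ := shape_set_nth Q j (size (flatten Q)).+1.
split; first by rewrite eP' eQ es.
  by rewrite size_flatten eQ sumn_incr_nth -size_flatten ez.
apply/all_nth_lines => i; rewrite nth_set_nth /=; case: eqP => [_|_].
  rewrite all_rcons ez leqnn /=; have /all_nth_lines := lQ.
  by move=> /(_ j); apply: sub_all => y; lia.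
by have /all_nth_lines := lQ; move=> /(_ i); apply: sub_all => y; lia.
Qed.

Lemma incr_nth_inj (s : seq nat) i j : incr_nth s i = incr_nth s j -> i = j.
Proof.
move/(congr1 (fun s => nth 0 s i)); rewrite !nth_incr_nth eqxx.
by case: eqP => // _; lia.
Qed.

Lemma nonnil_eq T1 T2 : nonnil T1 -> nonnil T2 ->
  (forall j, nth [::] T1 j = nth [::] T2 j) -> T1 = T2.
Proof.
move=> n1 n2 h; apply: (@eq_from_nth _ [::]) => [|j _]; last exact: h.
by apply: shape_size; apply: nonnil_shape => // j; rewrite /line_size h.
Qed.

(** The largest entry of the recording tableau marks the column that grew last; from there the last
    insertion is undone. *)
Lemma column_insertion_cols_inj w w' :
  column_insertion_cols w = column_insertion_cols w' -> w = w'.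
Proof.
elim: w w' => [|x w IH] [|x' w'] //.
- move=> /= e; have := recording_spec (x' :: w').
  by rewrite -[column_insertion_cols (x' :: w')]e => -[].
- move=> /= e; have := recording_spec (x :: w).
  by rewrite [column_insertion_cols (x :: w)]e => -[].
move=> e; have hs : size w = size w'.
  have := recording_spec (x :: w); have := recording_spec (x' :: w').
  by rewrite e; case: (column_insertion_cols _) => P Q [_ -> _] [_ [->] _].
move: e (IH w') => /=.
have [tP nP _] := col_insP w; have [tP' nP' _] := col_insP w'.
have := recording_spec w; have := recording_spec w'.
case: (column_insertion_cols w) tP nP => P Q /= tP nP.
case: (column_insertion_cols w') tP' nP' => P' Q' /= tP' nP' [es' ez' lQ'] [es ez lQ].
case eI: (insert leq x P) => [P1 j]; case eI': (insert leq x' P') => [P1' j'].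
rewrite ez ez' -hs => -[eP eQ] {}IH.
have bnd U i : all (fun z => z <= size w) (flatten U) -> (size w).+1 \notin nth [::] U i.
  by move=> /all_nth_lines /(_ i) h; apply/negP => /(allP h); rewrite ltnn.
have eQi i : nth [::] (set_nth [::] Q j (rcons (nth [::] Q j) (size w).+1)) i =
    nth [::] (set_nth [::] Q' j' (rcons (nth [::] Q' j') (size w).+1)) i by rewrite eQ.
rewrite -hs in lQ'.
have ej : j = j'.
  apply/eqP; apply/negPn/negP => nj; have := eQi j.
  rewrite !nth_set_nth /= eqxx (negbTE nj) => h.
  by have := bnd _ j lQ'; rewrite -h mem_rcons mem_head.
subst j'.
have eQ0 : Q = Q'.
  apply: nonnil_eq.
  - by apply: shape_nonnil nP; rewrite es.
  - by apply: shape_nonnil nP'; rewrite es'.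
  move=> i; have := eQi i; rewrite !nth_set_nth /=; case: eqP => // -> /rcons_inj[].
  by [].
have [ex eP0] := insert_col_inj (proj1 tP) (proj1 tP') nP nP' eI (etrans eI' (congr2 pair (esym eP) erefl)).
by rewrite ex IH // eP0 eQ0.
Qed.

Definition transp_head (P : tableau) : tableau := transp (size (head [::] P)) P.

Lemma transp_head_line_size P : decr P -> nonnil P -> line_size (transp_head P) 0 = size P.
Proof.
move=> dP nP; rewrite /transp_head;
  have -> : size (head [::] P) = line_size P 0 by rewrite /line_size nth0.
have h i : (i < size P) = (0 < line_size P i).
  apply/idP/idP => [iP|]; last exact: line_size_gt0.
  exact: (allP nP _ (mem_nth [::] iP)).
have h0 i : 0 < line_size P i -> 0 < line_size P 0 by move=> /leq_trans; apply; exact: decr_leq.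
apply/eqP; rewrite eqn_leq; apply/andP.
split; apply: leq_from_lt => i; rewrite transp_line_size // h; first by case/andP.
by move=> hi; rewrite hi (h0 i).
Qed.

Lemma transp_headK P : decr P -> nonnil P -> transp_head (transp_head P) = P.
Proof.
move=> dP nP; rewrite {1}/transp_head.
have -> : size (head [::] (transp_head P)) = size P
  by rewrite -transp_head_line_size // /line_size nth0.
by apply: transpK => //; rewrite /line_size nth0.
Qed.

Lemma column_insertionE w :
  column_insertion w = (transp_head (column_insertion_cols w).1, transp_head (column_insertion_cols w).2).
Proof. by rewrite /column_insertion; case: (column_insertion_cols w). Qed.

Lemma decr_shape T1 T2 : shape T1 = shape T2 -> decr T1 -> decr T2.
Proof. by move=> es h i; rewrite -!(line_size_shape _ es). Qed.

Lemma column_insertion_inj w w' : column_insertion w = column_insertion w' -> w = w'.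
Proof.
rewrite !column_insertionE => -[eP eQ]; apply: column_insertion_cols_inj.
have [tP nP _] := col_insP w; have [tP' nP' _] := col_insP w'.
have := recording_spec w; have := recording_spec w'.
case: (column_insertion_cols w) eP eQ tP nP => P Q /= eP eQ /tab_decr dP nP.
case: (column_insertion_cols w') eP eQ tP' nP' => P' Q' /= eP eQ /tab_decr dP' nP'.
move=> [es' _ _] [es _ _].
rewrite -(transp_headK dP nP) eP transp_headK // -(@transp_headK Q) ?eQ ?transp_headK //.
- by apply: decr_shape dP'.
- exact: shape_nonnil nP'.
- by apply: decr_shape dP.
- exact: shape_nonnil nP.
Qed.

Lemma shape_col_row_insert w w' : shape (schensted w) = shape (schensted w') ->
  shape (column_insertion_cols w).1 = shape (column_insertion_cols w').1.
Proof.
rewrite -!column_insertion_fst !column_insertionE /=.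
have [/tab_decr dP nP _] := col_insP w; have [/tab_decr dP' nP' _] := col_insP w'.
move: (_.1) (_.1) dP nP dP' nP' => P P' dP nP dP' nP' es.
have e U : decr U -> nonnil U -> shape U =
    [seq count (fun s => i < s) (shape (transp_head U)) | i <- iota 0 (head 0 (shape (transp_head U)))].
  move=> dU nU; rewrite -{1}(transp_headK dU nU) {1}/transp_head shape_transp.
  by case: (transp_head U).
by rewrite (e P) // (e P') // es.
Qed.

(** By the tensor product rule. Hence an operator preserves the insertion shapes of all final
    subwords, and with them the recording tableau. *)
Lemma drop_crystal_op d o w : drop d (crystal_op o w) = drop d w \/ drop d (crystal_op o w) = crystal_op o (drop d w).
Proof.
have [dw|wd] := leqP d (size w); last first.
  by left; have h := ltnW wd; rewrite (drop_oversize h) drop_oversize // size_crystal_op.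
have st : size (take d w) = d by rewrite size_takel.
move: (take d w) (drop d w) (cat_take_drop d w) st => u v <- st.
case: o => -[] i; rewrite /crystal_op /=.
  rewrite eop_cat; case: ifP => _; [left|right]; rewrite drop_cat.
    by rewrite size_eop st ltnn subnn drop0.
  by rewrite st ltnn subnn drop0.
rewrite fop_cat; case: ifP => _; [right|left]; rewrite drop_cat.
  by rewrite st ltnn subnn drop0.
by rewrite size_fop st ltnn subnn drop0.
Qed.

(* The recording tableau only depends on the shapes of the insertion tableaux of the final
   subwords. *)
Lemma recording_eq w w' : size w = size w' ->
  (forall d, shape (column_insertion_cols (drop d w)).1
           = shape (column_insertion_cols (drop d w')).1) ->
  (column_insertion_cols w).2 = (column_insertion_cols w').2.
Proof.
elim: w w' => [|x w IH] [|x' w'] //= [hs] h.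
have := IH _ hs (fun d => h d.+1); have := h 0; have := h 1; rewrite /= !drop0.
have := recording_spec w; have := recording_spec w'.
case: (column_insertion_cols w) => P Q; case: (column_insertion_cols w') => P' Q'.
move=> [_ ez' _] [_ ez _] /=.
have := @shape_insert false x P; have := @shape_insert false x' P'; rewrite /lerel.
case: (insert _ _ _) => P1' j'; case: (insert _ _ _) => P1 j /= -> -> -> /incr_nth_inj -> ->.
by [].
Qed.

Lemma recording_run g w : (column_insertion (run g w)).2 = (column_insertion w).2.
Proof.
rewrite !column_insertionE /=; congr transp_head; elim: g => //= o g <-.
move: (run g w) => {}w; apply: recording_eq => [|d]; first exact: size_crystal_op.
apply: shape_col_row_insert; have [->|->] := drop_crystal_op d o w => //.
exact: (shape_schensted_run [:: o]).
Qed.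

(** * The symmetry bijections and the statistic *)

Lemma tab_col_lt T i j c : tab true T -> i < j -> c < line_size T j ->
  entry_at T i c < entry_at T j c.
Proof.
move=> tT; have [dT _ h3] := proj1 (tabP _ _) tT.
elim: j => // j IH; rewrite ltnS leq_eqVlt => /predU1P[->|ij] cj.
  by have := h3 j c cj; rewrite addn1.
have cj' := leq_trans cj (dT j).
by apply: ltn_trans (IH ij cj') _; have := h3 j c cj; rewrite addn1.
Qed.

(** The letters below [a] fill the first cells of the row, so the offset puts each kept letter back
    into its own column. *)
Lemma entry_restr a m (r : seq nat) c : line_sorted true r ->
  let: r' := (count (fun x => x < a) r, [seq x <- r | a <= x < a + m]) in
  in_row r' c -> c < size r /\ entry r' c = nth 0 r c.
Proof.
move=> sr; rewrite /in_row /entry /= => /andP[h1 h2].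
rewrite -size_filter in h1 h2 *; have e := row_split (leq_addr m a) sr.
split; first by rewrite {1}e !size_cat; move: h2; lia.
rewrite {3}e nth_cat ltnNge h1 /= nth_cat; case: ltnP => // h.
by move: h; rewrite leq_subRL // leqNgt h2.
Qed.

Lemma colstrict_restr a m T : tab true T -> colstrict (restr a m T).
Proof.
move=> tT; have [sT _] := tT; rewrite /colstrict /restr all_map pairwise_map.
apply/andP; split.
  by apply: sub_all sT => r sr /=; rewrite -row_sortedE; exact: line_sorted_filter.
apply/(pairwiseP [::]) => i j iT jT ij; apply/allP => c _; apply/implyP => /andP[ci cj].
have si := allP sT _ (mem_nth [::] iT); have sj := allP sT _ (mem_nth [::] jT).
have [_ ei] := entry_restr si ci; have [hj ej] := entry_restr sj cj.
by rewrite ei ej; exact: tab_col_lt hj.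
Qed.

(** Forgets which letter of the interval stands in a cell. Operators of the interval preserve the
    collapsed word, which therefore records the cells of the interval and everything outside it. *)
Definition collapse (a m x : nat) : nat := if a <= x < a + m then a else x.

Lemma collapse_crystal_op a m o w : op_in a (a + m) o ->
  map (collapse a m) (crystal_op o w) = map (collapse a m) w.
Proof.
case: o => b i; rewrite /op_in /crystal_op /= => hi.
have ei : collapse a m i = a by rewrite /collapse ifT //; lia.
have ei1 : collapse a m i.+1 = a by rewrite /collapse ifT //; lia.
case: b; elim: w => //= x w IH.
  case: ifP => h /=; last by rewrite IH.
  have -> : x = i.+1 by move: h; case: eqP => // _; rewrite ltn0.
  by rewrite ei ei1.
case: ifP => h /=; first by rewrite IH.
by case: eqP => // ->; rewrite ei ei1.
Qed.

Lemma collapse_run a m g w : all (op_in a (a + m)) g ->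
  map (collapse a m) (run g w) = map (collapse a m) w.
Proof. by elim: g => //= o g IH /andP[ho /IH <-]; exact: collapse_crystal_op. Qed.

Lemma filter_collapse a m (p : pred nat) w : (forall x, p x -> ~~ (a <= x < a + m)) ->
  [seq x <- map (collapse a m) w | p x] = [seq x <- w | p x].
Proof.
move=> hp; elim: w => //= x w IH; case hx: (a <= x < a + m); last first.
  have -> : collapse a m x = x by rewrite /collapse hx.
  by rewrite IH.
have -> : collapse a m x = a by rewrite /collapse hx.
have -> : p x = false by apply/negP => /hp; rewrite hx.
have -> : p a = false by apply/negP => /hp; move: hx; lia.
exact: IH.
Qed.

Lemma count_collapse a m w : count (fun x => a <= x < a + m) (map (collapse a m) w) =
  count (fun x => a <= x < a + m) w.
Proof. by rewrite count_map; apply: eq_count => x /=; rewrite /collapse; case: ifP => //;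
  lia. Qed.

Lemma rword_map f T : rword (map (map f) T) = map f (rword T).
Proof. by rewrite /rword map_flatten map_rev. Qed.

Lemma collapse_run_tab a m g T T2 : all (op_in a (a + m)) g -> shape T2 = shape T ->
  run g (rword T) = rword T2 -> map (map (collapse a m)) T2 = map (map (collapse a m)) T.
Proof.
move=> hg es e; apply: rword_inj; last by rewrite !rword_map -e collapse_run.
have hs U : shape (map (map (collapse a m)) U) = shape U.
  by rewrite /shape -map_comp; apply: eq_map => r /=; rewrite size_map.
by rewrite !hs.
Qed.

Lemma skew_shape_restr a m T :
  skew_shape (restr a m T) =
  [seq (count (fun x => x < a) r, count (fun x => a <= x < a + m) r)
  | r <- map (map (collapse a m)) T].
Proof.
rewrite /skew_shape /restr -!map_comp; apply: eq_map => r /=.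
rewrite size_filter count_collapse; congr pair.
by rewrite -!size_filter filter_collapse // => x; lia.
Qed.

(** Equal collapses mean that the rows of [T] and [T2] have the same letters outside the
    interval. *)
Lemma paste_restr a m T T2 : tab true T2 ->
  map (map (collapse a m)) T2 = map (map (collapse a m)) T -> paste a m T (restr a m T2) = T2.
Proof.
case=> + _; rewrite /paste /restr; elim: T2 T => [|r2 T2 IH] [|r T] //=.
move=> /andP[s2 sT] [er eT]; rewrite IH //; congr cons.
rewrite [RHS](row_split (leq_addr m a) s2).
have hf (p : pred nat) : (forall x, p x -> ~~ (a <= x < a + m)) ->
  [seq x <- r | p x] = [seq x <- r2 | p x].
  by move=> hp; rewrite -(filter_collapse _ hp) -er filter_collapse.
by rewrite !hf // => x; lia.
Qed.

Lemma skew_eq (X Y : skewtab) : skew_shape X = skew_shape Y ->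
  word X = word Y -> X = Y.
Proof.
move=> es ew; have e2 : unzip2 X = unzip2 Y.
  apply: rword_inj => //.
  have := congr1 (map snd) es; rewrite /skew_shape /shape -!map_comp //.
rewrite -(zip_unzip X) -(zip_unzip Y) e2; congr zip.
by have := congr1 (map fst) es; rewrite /skew_shape -!map_comp.
Qed.

(** * Littlewood-Richardson conditions as conditions on words *)

Lemma block_startS a R i : i < size R ->
  block_start a R i.+1 = block_start a R i + block_size R i.
Proof.
move=> iR; rewrite /block_start (take_nth 0) ?size_map // sumn_rcons addnA.
by rewrite (nth_map (0, 0)).
Qed.

Lemma block_start0 a R : block_start a R 0 = a.
Proof. by rewrite /block_start take0 addn0. Qed.

Lemma block_start_leq a R i j : i <= j -> j <= size R ->
  block_start a R i <= block_start a R j.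
Proof.
elim: j => [|j IH]; first by rewrite leqn0 => /eqP ->.
rewrite leq_eqVlt => /predU1P[->//|]; rewrite ltnS => ij jR.
by rewrite block_startS // (leq_trans (IH ij (ltnW jR))) ?leq_addr.
Qed.

Lemma LRTP a lam R T : sorted geq lam -> LRT a lam R T <->
  [/\ shape T = lam, tab true T, letters_in a (block_start a R (size R)) (rword T) &
    forall i, i < size R ->
      rect_word (block_start a R i) (block_size R i) (ncols (rect_at R i)) (rword T)].
Proof.
move=> sl; rewrite /LRT; split=> [/and4P[/eqP es cT lT hT]|[es tT lT hT]].
  have dT : decr T by apply/decr_sorted; rewrite es.
  split=> //; [exact/colstrictP|by rewrite /letters_in (perm_all _ (perm_rword T))|].
  move=> i iR; have := allP hT i; rewrite mem_iota /= => /(_ iR) /andP[/allP h1 /latticeP h2].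
  split=> [x hx|j bj jb].
    by rewrite (seq.permP (perm_rword T)); apply/eqP; apply: h1; rewrite mem_iota.
  have := h2 j bj jb; rewrite word_restr.
  by have [||_ ->] := @sig_filter (fun x => block_start a R i <= x < block_start a R i + block_size R i) j (rword T); lia.
have dT : decr T by exact: tab_decr tT.
apply/and4P; split; [exact/eqP|exact/colstrictP|by move: lT;
  rewrite /letters_in (perm_all _ (perm_rword T))|].
apply/allP => i; rewrite mem_iota /= => iR; have [h1 h2] := hT i iR.
apply/andP; split.
  apply/allP => x; rewrite mem_iota => hx.
  by rewrite -(seq.permP (perm_rword T)) h1.
apply/latticeP => j bj jb; rewrite word_restr -[RHS](h2 j bj jb).
by have [||_ ->] := @sig_filter (fun x => block_start a R i <= x < block_start a R i + block_size R i) j (rword T); lia.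
Qed.

Lemma LRT_pair a rho (r1 r2 : rect) X : sorted geq rho -> LRT a rho [:: r1; r2] X <->
  [/\ shape X = rho, tab true X &
    pair_word_ok a (nrows r1) (ncols r1) (nrows r2) (ncols r2) (rword X)].
Proof.
move=> srho; split=> [/(LRTP _ _ _ srho)[es tX lX hX]|[es tX [h1 h2 lX]]].
  split=> //; split.
  - by have := hX 0 isT; rewrite /block_start /= addn0.
  - by have := hX 1 isT; rewrite /block_start /= addn0.
  - by move: lX; rewrite /block_start /= addn0.
apply/LRTP => //; split=> //; first by rewrite /block_start /= addn0.
by case=> [|[|i]] // _; rewrite /block_start /= addn0.
Qed.

(** Evaluates the two choices in [adj_tab]. The first is settled by [pair_unique]; for the second,
    the path [g] preserves the recording tableau and the skew shape, and column insertion is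
    injective. *)
Lemma adj_tab_eq p R T T2 g :
  let a := pair_start R p in
  let m := pair_size R p in
  let r1 := rect_at R p in
  let r2 := rect_at R p.+1 in
  tab true T -> tab true T2 -> shape T2 = shape T ->
  all (op_in a (a + m)) g -> run g (rword T) = rword T2 ->
  pair_word_ok a (nrows r2) (ncols r2) (nrows r1) (ncols r1)
    [seq x <- rword T2 | a <= x < a + m] ->
  adj_tab p R T = T2.
Proof.
move=> a m r1 r2 tT tT2 es hg eg pw2.
pose w := [seq x <- rword T | a <= x < a + m].
pose w2 := [seq x <- rword T2 | a <= x < a + m].
have ew : run g w = w2.
  rewrite /w run_filter; first by rewrite eg.
  by apply: sub_all hg => o; rewrite /op_in; lia.
have ec := collapse_run_tab hg es eg.
rewrite /adj_tab /restr_pair -/a -/m word_restr -/w.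
have e1 := column_insertion_fst w; have e2 := recording_run g w.
have e3 := column_insertion_fst w2; rewrite ew in e2.
case: (column_insertion w) e1 e2 => P Q /= -> e2.
have [t n c] := schenstedP w; have [t2 n2 c2] := schenstedP w2.
have srho : sorted geq (shape (schensted w)) by apply/decr_sorted; exact: tab_decr t.
have esh : shape (schensted w2) = shape (schensted w) by rewrite -ew shape_schensted_run.
rewrite (@xget_unique _ _ _ (schensted w2)); last 2 first.
- by apply/LRT_pair => //; split=> //; exact: pair_word_ok_crystal_eq pw2.
- move=> X /(LRT_pair _ _ _ _ srho)[eX tX pX].
  by apply: (pair_unique tX t2 pX) => //; [exact: pair_word_ok_crystal_eq pw2|rewrite eX].
rewrite (@xget_unique _ _ _ (restr a m T2)); last 2 first.
- apply/and3P; split; first by rewrite !skew_shape_restr ec.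
    exact: colstrict_restr.
  by rewrite word_restr -/w2 -e2 -e3; case: (column_insertion w2).
- move=> X /and3P[/eqP eX _ /eqP qX]; apply: skew_eq.
    by rewrite eX !skew_shape_restr ec.
  rewrite word_restr; apply: column_insertion_inj; rewrite qX -/w2 -e2 -e3.
  by case: (column_insertion w2).
exact: paste_restr.
Qed.

Lemma run_inv I g w : all (fun o : bool * nat => I o.2) g ->
  exists2 g', all (fun o : bool * nat => I o.2) g' & run g' (run g w) = w.
Proof.
elim: g => [_|o g IH /andP[ho /IH[g' hg' e]]] /=; first by exists [::].
have [h|h] := flip_opK o (run g w); first by exists g' => //; rewrite h.
exists (rcons g' (flip_op o)); first by rewrite all_rcons ho.
by rewrite -cats1 run_cat /= h.
Qed.

(** Both tableaux are raised to the same Yamanouchi tableau; the path of the second is then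
    undone. *)
Lemma connected a N T T' : tab true T -> tab true T' -> shape T = shape T' ->
  letters_in a (a + N) (rword T) -> letters_in a (a + N) (rword T') ->
  exists2 g, all (op_in a (a + N)) g & run g (rword T) = rword T'.
Proof.
move=> t t' es l l'.
have [g1 [h1 f1 e1]] := raise l; have [g2 [h2 f2 e2]] := raise l'.
have [Y1 [r1 s1 y1]] := run_raise_tab f1 t.
have [Y2 [r2 s2 y2]] := run_raise_tab f2 t'.
have k1 : Y1 = yamanouchi a (shape T).
  rewrite -s1; apply: high_yamanouchi => //; rewrite -r1 //.
  exact: letters_in_leq (letters_in_run h1 l).
have k2 : Y2 = yamanouchi a (shape T).
  rewrite es -s2; apply: high_yamanouchi => //; rewrite -r2 //.
  exact: letters_in_leq (letters_in_run h2 l').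
have [g3 h3 e3] := @run_inv (fun i => op_in a (a + N) (true, i)) g2 (rword T') h2.
exists (g3 ++ g1); first by rewrite all_cat h3 h1.
by rewrite run_cat r1 k1 -k2 -r2 e3.
Qed.

(** The shape is left free inside the box, so that a change of shape under duality needs no
    bookkeeping here. *)
Definition lrt (n k : nat) (R : seq rect) (T : tableau) : Prop :=
  boxed 1 n k T /\
  forall i, i < size R ->
    rect_word (block_start 1 R i) (block_size R i) (ncols (rect_at R i)) (rword T).

Definition rects_ok (n k : nat) (R : seq rect) : Prop :=
  block_start 1 R (size R) = 1 + n /\ all (fun r => ncols r <= k) R.

Definition dual_rects (k : nat) (R : seq rect) : seq rect :=
  [seq (k - ncols r, nrows r) | r <- R].

Lemma rect_word_dual_from a n k T b m c : boxed a n k T -> a <= b -> b + m <= a + n ->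
  rect_word b m c (rword T) -> rect_word b m (k - c) (rword (dual_from a n k T)).
Proof.
move=> wT ab bn rT; split=> [x hx|i bi ib].
  have /(dual_from_count wT) : a <= x < a + n by lia.
  by have [/(_ x hx) -> _] := rT; lia.
have [||_ ->] := dual_from_sig (i := i) wT; [lia|lia|exact: rect_word_phi rT bi ib].
Qed.

Lemma size_dual_rects k R : size (dual_rects k R) = size R.
Proof. exact: size_map. Qed.

Lemma rect_at_dual k R i : i < size R ->
  rect_at (dual_rects k R) i = (k - ncols (rect_at R i), nrows (rect_at R i)).
Proof. by move=> iR; rewrite /rect_at (nth_map (0, 0)). Qed.

Lemma ncols_dual k R i : i < size R ->
  ncols (rect_at (dual_rects k R) i) = k - ncols (rect_at R i).
Proof. by move=> iR; rewrite rect_at_dual. Qed.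

Lemma nrows_dual k R i : i < size R ->
  nrows (rect_at (dual_rects k R) i) = nrows (rect_at R i).
Proof. by move=> iR; rewrite rect_at_dual. Qed.

Lemma block_size_dual k R i : i < size R ->
  block_size (dual_rects k R) i = block_size R i.
Proof. by move=> iR; rewrite /block_size rect_at_dual. Qed.

Lemma block_start_dual a k R i :
  block_start a (dual_rects k R) i = block_start a R i.
Proof. by rewrite /block_start /dual_rects -map_comp. Qed.

Lemma block_bounds n k R i : rects_ok n k R -> i < size R ->
  1 <= block_start 1 R i /\ block_start 1 R i + block_size R i <= 1 + n.
Proof.
move=> [<- _] iR; split; first by rewrite -{1}(block_start0 1 R) block_start_leq // ltnW.
by rewrite -block_startS // block_start_leq.
Qed.

Lemma rects_ok_dual n k R : rects_ok n k R -> rects_ok n k (dual_rects k R).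
Proof.
move=> [h _]; split; first by rewrite block_start_dual size_dual_rects.
by rewrite all_map; apply/allP => r _ /=; rewrite leq_subr.
Qed.

Lemma lrt_dual n k R T : rects_ok n k R -> lrt n k R T ->
  lrt n k (dual_rects k R) (dual n k T).
Proof.
move=> ok [wT hT]; split; first by have [] := boxed_dual_from wT.
move=> i; rewrite size_dual_rects => iR; have [h1 h2] := block_bounds ok iR.
rewrite block_start_dual block_size_dual // rect_at_dual //=.
exact: rect_word_dual_from (hT i iR).
Qed.

(** * Exchange of adjacent rectangles *)

Lemma size_adj_rects p R : size (adj_rects p R) = size R.
Proof. exact: size_mkseq. Qed.

Lemma rect_at_adj p R i : i < size R -> rect_at (adj_rects p R) i = rect_at R (adj p i).
Proof. by move=> iR; rewrite {1}/rect_at nth_mkseq. Qed.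

Lemma adj_lt p t i : p.+1 < t -> i < t -> adj p i < t.
Proof. by rewrite /adj => pt it; case: eqP => _ //; case: eqP => // _; lia. Qed.

Lemma block_size_adj p R i : i < size R ->
  block_size (adj_rects p R) i = block_size R (adj p i).
Proof. by move=> iR; rewrite /block_size rect_at_adj. Qed.

(** Only the boundary between the two exchanged blocks moves. *)
Lemma block_start_adj a p R i : p.+1 < size R -> i <= size R ->
  block_start a (adj_rects p R) i =
  if i == p.+1 then block_start a R p + block_size R p.+1 else block_start a R i.
Proof.
move=> pR; elim: i => [|i IH] iR; first by rewrite !block_start0.
rewrite block_startS ?size_adj_rects // IH ?(ltnW iR) //.
rewrite block_size_adj // /adj eqSS.
have [->|ip] := eqVneq i p.
  by rewrite (_ : (p == p.+1) = false) //; lia.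
have [->|ip1] := eqVneq i p.+1; last by rewrite block_startS.
by rewrite block_startS // (block_startS _ (ltnW pR)); lia.
Qed.

Lemma adj_rects_dual k p R : p.+1 < size R ->
  adj_rects p (dual_rects k R) = dual_rects k (adj_rects p R).
Proof.
move=> pR; apply: (@eq_from_nth _ (0, 0));
  first by rewrite size_adj_rects !size_dual_rects size_adj_rects.
rewrite size_adj_rects size_dual_rects => i iR.
rewrite -!/(rect_at _ i) rect_at_adj ?size_dual_rects // rect_at_dual ?adj_lt //.
by rewrite rect_at_dual ?size_adj_rects // rect_at_adj.
Qed.

Lemma rects_ok_adj n k p R : p.+1 < size R -> rects_ok n k R ->
  rects_ok n k (adj_rects p R).
Proof.
move=> pR [h1 h2]; split.
  by rewrite size_adj_rects block_start_adj // h1; case: eqP => // e; lia.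
apply/(all_nthP (0, 0)) => i; rewrite size_adj_rects => iR.
rewrite -/(rect_at _ i) rect_at_adj //.
by apply: (allP h2); apply: mem_nth; exact: adj_lt.
Qed.

Definition pair_word (R : seq rect) (p : nat) (T : tableau) : seq nat :=
  [seq x <- rword T | pair_start R p <= x < pair_start R p + pair_size R p].

Lemma pair_bounds n k R p : rects_ok n k R -> p.+1 < size R ->
  [/\ 1 <= pair_start R p, pair_start R p + pair_size R p <= 1 + n &
      block_start 1 R p.+1 = pair_start R p + block_size R p].
Proof.
move=> ok pR; have [h1 h2] := block_bounds ok (ltnW pR).
have [h3 h4] := block_bounds ok pR; rewrite block_startS ?(ltnW pR) // in h3 h4 *.
by split=> //; rewrite /pair_start /pair_size addnA.
Qed.

Lemma letters_in_pair_word R p T :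
  letters_in (pair_start R p) (pair_start R p + pair_size R p) (pair_word R p T).
Proof. exact: filter_all. Qed.

Lemma lrt_pair_word_ok n k R T p : rects_ok n k R -> p.+1 < size R -> lrt n k R T ->
  pair_word_ok (pair_start R p) (nrows (rect_at R p)) (ncols (rect_at R p))
    (nrows (rect_at R p.+1)) (ncols (rect_at R p.+1)) (pair_word R p T).
Proof.
move=> ok pR [wT hT]; have [h1 h2 h3] := pair_bounds ok pR.
split; last exact: letters_in_pair_word.
- apply/rect_word_filter; last exact: hT (ltnW pR).
  by rewrite /pair_size /block_size => x; lia.
- apply/rect_word_filter; last by have := hT _ pR; rewrite h3.
  by rewrite /pair_size /block_size => x; lia.
Qed.

Lemma op_in_sub a b a' b' g : a' <= a -> b <= b' -> all (op_in a b) g -> all (op_in a' b') g.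
Proof. by move=> ha hb; apply: sub_all => o; rewrite /op_in; lia. Qed.

Lemma run_pair_word R p g w : all (op_in (pair_start R p) (pair_start R p + pair_size R p)) g ->
  run g [seq x <- w | pair_start R p <= x < pair_start R p + pair_size R p] =
  [seq x <- run g w | pair_start R p <= x < pair_start R p + pair_size R p].
Proof. by move=> hg; rewrite run_filter //; apply: sub_all hg => o; rewrite /op_in; lia. Qed.

Lemma all_op_in_opp a b g : all (op_in a b) g -> all (op_in a b) (map flip_op g).
Proof. by rewrite all_map; apply: sub_all => o. Qed.

(** The conditions on a block see only its own letters, and deleting the interval gives the same
    word before and after the run. *)
Lemma rect_word_run_out a m g w b m' c : all (op_in a (a + m)) g ->
  (b + m' <= a) || (a + m <= b) -> rect_word b m' c w -> rect_word b m' c (run g w).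
Proof.
move=> hg hb; have hp x : b <= x < b + m' -> ~~ (a <= x < a + m) by lia.
move=> /(rect_word_filter _ _ hp) h; apply/(rect_word_filter _ _ hp).
by rewrite -(filter_collapse (a := a) (m := m)) ?(collapse_run _ hg) ?filter_collapse // => x.
Qed.

(** The image [T2] is constructed explicitly, from the exchanged insertion tableau given by
    [pair_swap], and it then serves both for [T] and for its dual. *)
Lemma adj_step n k R T p : rects_ok n k R -> p.+1 < size R -> lrt n k R T ->
  [/\ lrt n k (adj_rects p R) (adj_tab p R T), shape (adj_tab p R T) = shape T &
    adj_tab p (dual_rects k R) (dual n k T) = dual n k (adj_tab p R T)].
Proof.
move=> ok pR lT; have [wT hT] := lT; have [h1 h2 h3] := pair_bounds ok pR.
set a := pair_start R p in h1 h2 h3 *; set m := pair_size R p in h2 *.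
have pw := lrt_pair_word_ok ok pR lT.
set w := pair_word R p T in pw.
have [tP nP cP] := schenstedP w.
have pwP := pair_word_ok_crystal_eq cP pw.
have [P' [tP' nP' sP' pP']] := pair_swap tP nP pwP.
have lP : letters_in a (a + m) (rword (schensted w)) by case: pwP.
have lP' : letters_in a (a + m) (rword P') by case: pP' => _ _;
  rewrite addnC (addnC _ (nrows _)) addnC.
(* The path is found between insertion tableaux and then run on all of [T], which is possible as its
   indices lie in the alphabet of the pair. *)
have [g hg eg] := connected tP tP' (esym sP') lP lP'.
have [T2 [wT2 sT2 eT2 dT2]] := tab_run (op_in_sub h1 h2 hg) wT.
have ew2 : run g w = pair_word R p T2.
  by rewrite /w /pair_word run_pair_word // eT2.
have pw2 : pair_word_ok a (nrows (rect_at R p.+1)) (ncols (rect_at R p.+1))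
    (nrows (rect_at R p)) (ncols (rect_at R p)) (pair_word R p T2).
  by apply: pair_word_ok_crystal_eq pP'; rewrite -eg -ew2; apply: crystal_eq_run;
    exact: crystal_eq_sym.
have hb1 x : a <= x < a + nrows (rect_at R p.+1) -> a <= x < a + m.
  by rewrite /m /pair_size /block_size; lia.
have hb2 x : a + nrows (rect_at R p.+1) <= x < a + nrows (rect_at R p.+1) + nrows (rect_at R p) -> a <= x < a + m.
  by rewrite /m /pair_size /block_size; lia.
have [/(rect_word_filter _ _ hb1) q1 /(rect_word_filter _ _ hb2) q2 _] := pw2.
have [_ tT _ _] := wT; have [_ tT2 _ _] := wT2.
have e : adj_tab p R T = T2 by exact: (adj_tab_eq tT tT2 sT2 hg eT2 pw2).
rewrite e; split=> //.
  split=> // i; rewrite size_adj_rects => iR.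
  rewrite block_start_adj ?(ltnW iR) // block_size_adj // rect_at_adj //.
  rewrite /adj.
  have [->|ip] := eqVneq i p.
    rewrite (_ : (p == p.+1) = false); last by lia.
    exact: q1.
  have [_|ip1] := eqVneq i p.+1.
    exact: q2.
  rewrite -eT2; apply: (rect_word_run_out hg); last exact: hT.
  have [ip2|ip2] := leqP i p.
    have : i.+1 <= p by lia.
    by move=> /(@block_start_leq 1 R) /(_ (ltnW (ltnW pR)));
      rewrite block_startS // /a /pair_start => ->.
  have : p.+2 <= i by lia.
  move=> /(@block_start_leq 1 R) /(_ (ltnW iR)); rewrite block_startS // h3 => h.
  by rewrite /m /pair_size addnA h orbT.
have [[wd _] [wd2 _]] := (boxed_dual_from wT, boxed_dual_from wT2).
have [_ td _ _] := wd; have [_ td2 _ _] := wd2.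
have eps_ : pair_start (dual_rects k R) p = a by exact: block_start_dual.
have epz : pair_size (dual_rects k R) p = m.
  by rewrite /pair_size !block_size_dual // ltnW.
(* The opposite path leads from the dual of [T] to the dual of [T2], so the recognition criterion
   applies once more. *)
apply: (adj_tab_eq td td2) dT2 _.
- have [tc cc _ _] := boxed_cols wT; have [tc2 cc2 _ _] := boxed_cols wT2.
  by rewrite /dual_from !shape_transp !shape_dual_cols // !shape_transp sT2.
- by rewrite eps_ epz; exact: all_op_in_opp.
have pR' := ltnW pR; rewrite eps_ epz !ncols_dual // !nrows_dual //.
split.
- apply/rect_word_filter => //; apply: (rect_word_dual_from wT2) => //.
    by move: h2; rewrite /m /pair_size /block_size; lia.
- apply/rect_word_filter => //; apply: (rect_word_dual_from wT2).
  + by lia.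
  + by move: h2; rewrite /m /pair_size /block_size; lia.
  + exact: q2.
- apply/allP => x; rewrite mem_filter => /andP[+ _]; rewrite /m /pair_size /block_size; lia.
Qed.

(** * The statistic and the charge *)

Lemma sum_rows P m c : size P <= m ->
  \sum_(r <- P) (size r - c) = \sum_(j < m) (line_size P j - c).
Proof.
move=> hP; rewrite (big_nth [::]) big_mkord.
apply: (@sum_support _ _ (fun j => line_size P j - c)) => j hj.
  by rewrite /line_size nth_default.
by rewrite /line_size nth_default // (leq_trans hP).
Qed.

(** Operators preserve insertion shapes, so the subword may be lowered to lowest weight while its
    dual is raised to highest weight. Both row lengths then count the letter [a + j], which occurs
    in each column of exactly one of the two tableaux. *)
Lemma line_size_schensted_dual n k a m T j : boxed 1 n k T -> 1 <= a -> a + m <= 1 + n ->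
  j < m ->
  line_size (schensted [seq x <- rword (dual n k T) | a <= x < a + m]) j +
  line_size (schensted [seq x <- rword T | a <= x < a + m]) (m - j.+1) = k.
Proof.
move=> wT a1 am jm; set B := fun x => a <= x < a + m.
have lB v : letters_in a (a + m) (filter B v) by exact: filter_all.
have [g [hg lg]] := lower (lB (rword T)).
have [T2 [wT2 sT2 eT2 dT2]] := tab_run (op_in_sub a1 am hg) wT.
have hrun h v : all (op_in a (a + m)) h -> run h (filter B v) = filter B (run h v).
  by move=> hh; rewrite run_filter //; apply: sub_all hh => o; rewrite /op_in /B; lia.
have hgo := all_op_in_opp hg.
rewrite -(line_size_schensted_run g (filter B (rword T))).
rewrite -(line_size_schensted_run (map flip_op g) (filter B (rword (dual n k T)))).
have lw := letters_in_run hg (lB (rword T)).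
rewrite -(low_count lw lg jm).
have e : run (map flip_op g) (filter B (rword (dual n k T))) = filter B (rword (dual n k T2)).
  by rewrite hrun //; congr filter; exact: dT2.
rewrite e -(high_count (a := a)); last 2 first.
- exact: letters_in_leq (lB _).
- move=> i ai; have [ia|ia] := ltnP i.+1 (a + m); last first.
    by apply: eps0; apply/negP => /(allP (lB _)); lia.
  have Bi : B i by rewrite /B; lia.
  have Bi1 : B i.+1 by rewrite /B; lia.
  have [_ ->] := sig_filter (rword (dual n k T2)) Bi Bi1.
  have [||_ ->] := dual_from_sig (i := i) wT2; [lia|lia|].
  have [<- _] := sig_filter (rword T2) Bi Bi1.
  by rewrite -eT2 -hrun // lg.
rewrite hrun // eT2 !count_filter.
have Bj : B (a + j) by rewrite /B; lia.
have hB : predI (pred1 (a + j)) B =1 pred1 (a + j).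
  by move=> x /=; case: eqP => // ->; rewrite Bj.
by rewrite !(eq_count hB); apply: (dual_from_count wT2); lia.
Qed.

(** The dual rows are [k] minus the original rows in reversed order, and the dual maximum is [k]
    minus the minimum of the two column numbers. The dual overhang is thus the deficit from that
    minimum, to which [pair_overhang] applies. *)
Lemma d_at_dual n k R T p : rects_ok n k R -> p.+1 < size R -> lrt n k R T ->
  d_at p R T = d_at p (dual_rects k R) (dual n k T).
Proof.
move=> ok pR lT; have [wT hT] := lT; have [h1 h2 h3] := pair_bounds ok pR.
have pR' := ltnW pR.
have okr i : i < size R -> ncols (rect_at R i) <= k.
  by move=> iR; have [_ /allP h] := ok; apply: h; exact: mem_nth.
have pw := lrt_pair_word_ok ok pR lT.
rewrite /d_at /restr_pair !word_restr !ncols_dual //.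
have -> : pair_start (dual_rects k R) p = pair_start R p by exact: block_start_dual.
have -> : pair_size (dual_rects k R) p = pair_size R p.
  by rewrite /pair_size !block_size_dual.
have k1 := okr _ pR'; have k2 := okr _ pR.
have [tP _ cP] := schenstedP (pair_word R p T).
have over := pair_overhang tP (pair_word_ok_crystal_eq cP pw).
have lB v : letters_in (pair_start R p) (pair_start R p + pair_size R p)
  [seq x <- v | pair_start R p <= x < pair_start R p + pair_size R p] by exact: filter_all.
rewrite !(@sum_rows _ (pair_size R p)); try exact: size_schensted (lB _).
rewrite -/(pair_word R p T) [LHS]over; apply: eq_bigr => j _.
have := line_size_schensted_dual wT h1 h2 (ltn_ord j); rewrite -/(pair_word R p T).
rewrite -/(pair_size R p) => e; move: k1 k2 e; rewrite /pair_size /block_size.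
lia.
Qed.

Lemma act_word_dual n k R T a : rects_ok n k R -> lrt n k R T ->
  all (fun p => p.+1 < size R) a ->
  let RT := act_word a R T in
  [/\ size RT.1 = size R, rects_ok n k RT.1, lrt n k RT.1 RT.2 &
      act_word a (dual_rects k R) (dual n k T) = (dual_rects k RT.1, dual n k RT.2)].
Proof.
move=> ok lT; elim: a => //= p a IH /andP[pR /IH[es oks ls e]].
rewrite e /= size_adj_rects es; rewrite -es in pR.
have [l' _ e'] := adj_step oks pR ls.
by split=> //; [exact: rects_ok_adj|rewrite e' adj_rects_dual].
Qed.

Lemma d_stat_dual n k R T : rects_ok n k R -> lrt n k R T ->
  d_stat R T = d_stat (dual_rects k R) (dual n k T).
Proof.
move=> ok lT; rewrite /d_stat size_dual_rects !big_mkord; apply: eq_bigr => p _.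
by rewrite -(d_at_dual ok _ lT) //; have := ltn_ord p; lia.
Qed.

Lemma charge_dual t (rw : 'S_t -> seq nat) n k (R R' : t.-tuple rect) T :
  (forall u : 'S_t, reduced_word u (rw u)) -> rects_ok n k R -> lrt n k R T ->
  R' = dual_rects k R :> seq rect ->
  charge rw R T = charge rw R' (dual n k T).
Proof.
move=> hrw ok lT eR; rewrite /charge eR; congr (_ * _)%R; apply: eq_bigr => u _.
have [[hu _] _] := hrw u; have {}hu : all (fun p => p.+1 < size R) (rw u) by rewrite size_tuple.
have [_ oku lu ->] := act_word_dual ok lT hu.
by rewrite (d_stat_dual oku lu).
Qed.

Lemma dual_rectsK n k R : rects_ok n k R -> dual_rects k (dual_rects k R) = R.
Proof.
move=> [_ h]; rewrite /dual_rects -map_comp -[RHS]map_id.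
by apply/eq_in_map => -[c m] /(allP h) /= hc; rewrite subKn.
Qed.

Lemma LRT_lrt n k R lam T : rects_ok n k R -> sorted geq lam -> size lam = n ->
  head 0 lam <= k -> LRT 1 lam R T <-> shape T = lam /\ lrt n k R T.
Proof.
move=> [e _] sl zl hl; split=> [/(LRTP _ _ _ sl)[es tT lT hT]|[es [[sT tT kT lT] hT]]].
  split=> //; split=> //; split=> //; last by rewrite -e.
    by rewrite -zl -es size_map.
  by rewrite -shapeE es nth0.
by apply/LRTP => //; split=> //; rewrite e.
Qed.

Lemma shape_dual n k T : boxed 1 n k T ->
  shape (dual n k T) = rev [seq k - l | l <- shape T].
Proof.
move=> wT; have [[sT _ _ _] [[sd _ _ _] _]] := (wT, boxed_dual_from wT).
rewrite -[dual n k T]/(dual_from 1 n k T).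
move: (dual_from 1 n k T) sd (@dual_from_line_size 1 n k T ^~ wT) => D sD hD.
apply: (@eq_from_nth _ 0); first by rewrite size_rev !size_map sD.
move=> j; rewrite size_map sD => jn; rewrite nth_rev ?size_map ?sT //.
rewrite (nth_map 0) ?size_map ?sT; last by lia.
by rewrite !shapeE; have := hD j jn; lia.
Qed.

Theorem proposition8 (t : nat) (rw : 'S_t -> seq nat)
    (rw_reduced : forall u : 'S_t, reduced_word u (rw u))
    (n : nat) (eta : t.-tuple nat)
    (eta_gt0 : forall i : 'I_t, 0 < tnth eta i)
    (eta_sum : \sum_(i < t) tnth eta i = n)
    (mu : t.-tuple nat)
    (lam : n.-tuple nat)
    (lam_part : sorted geq lam)
    (lam_size : \sum_(j < n) tnth lam j = \sum_(i < t) tnth mu i * tnth eta i)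
    (k : nat) (k_gt0 : 0 < k)
    (lam_le_k : head 0 lam <= k)
    (mu_le_k : forall i : 'I_t, tnth mu i <= k) :
  let R := rects mu eta in
  let lam' := rev [seq k - l | l <- lam] in
  let R' := rects [tuple k - tnth mu i | i < t] eta in
  set_bij [set T | LRT 1 lam R T] [set T | LRT 1 lam' R' T] (dual n k) /\
  (forall T : tableau, LRT 1 lam R T ->
     charge rw R T = charge rw R' (dual n k T)).
Proof.
move=> R lam' R'.
have eR : R' = dual_rects k R :> seq rect.
  rewrite /dual_rects -map_comp; apply: eq_map => i /=.
  by rewrite tnth_map tnth_ord_tuple.
have ok : rects_ok n k R.
  split.
    rewrite /block_start take_oversize ?size_map // -eta_sum; congr addn.
    by rewrite sumnE -map_comp big_map big_enum.
  by rewrite all_map; apply/allP => i _; exact: mu_le_k.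
have ok' := rects_ok_dual ok.
have hl l : l \in (lam : seq nat) -> l <= k.
  move=> ll; apply: leq_trans lam_le_k; case: (tval lam) lam_part ll => //= x s.
  rewrite path_sortedE; last by move=> a b c; lia.
  by move=> /andP[/allP h _]; rewrite inE => /predU1P[->//|/h].
have zl : size lam = n by exact: size_tuple.
have zl' : size lam' = n by rewrite size_rev size_map.
have sl' : sorted geq lam'.
  rewrite rev_sorted sorted_map; apply: sub_sorted lam_part => x y /=; lia.
have hl' : head 0 lam' <= k.
  have : all (fun l => l <= k) lam'.
    by rewrite all_rev all_map; apply/allP => l _; exact: leq_subr.
  by case: (lam') => //= x s /andP[].
have iff1 T := @LRT_lrt n k R lam T ok lam_part zl lam_le_k.
have iff2 T : LRT 1 lam' R' T <-> shape T = lam' /\ lrt n k (dual_rects k R) T.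
  by rewrite eR; exact: LRT_lrt.
split; last by move=> T /iff1[_ lT]; exact: charge_dual eR.
split.
- move=> T /iff1[es lT]; apply/iff2; split; last exact: lrt_dual.
  by have [wT _] := lT; rewrite shape_dual // es.
- move=> T1 T2; rewrite !inE => /iff1[_ [w1 _]] /iff1[_ [w2 _]] e.
  by rewrite -(dual_fromK w1) -(dual_fromK w2); congr dual_from.
(* The preimage is the dual of [T]: duality is an involution on the box, and on the rectangles since
   [mu_i <= k]. *)
move=> T /iff2[es lT]; have [wT _] := lT; exists (dual n k T); last exact: dual_fromK.
apply/iff1; split; last first.
  by rewrite -(dual_rectsK ok); exact: lrt_dual.
rewrite shape_dual // es map_rev revK -map_comp -[RHS]map_id.
by apply/eq_in_map => l /hl /= h; rewrite subKn.
Qed.
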